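(* Let $A\colon\mathcal{S}'(\mathbb{R}^n)\to\mathcal{S}'(\mathbb{R}^n)$ be a continuous linear map with distribution kernel $K(x,y)\in\mathcal{S}'(\mathbb{R}^n\times\mathbb{R}^n)$. Suppose that $u\in\mathcal{S}'(\mathbb{R}^n)$ and $v\in C^\infty_0(\mathbb{R}^n)$ satisfy $$\operatorname{supp}K\cap\operatorname{supp}(v\otimes u)\ \text{is compact in }\mathbb{R}^n\times\mathbb{R}^n,\qquad\operatorname{sing\,supp}K\cap\operatorname{sing\,supp}(v\otimes u)=\emptyset.$$ Then $\langle Au,v\rangle=\langle K,v\otimes u\rangle$, with extended action of $\langle\cdot,\cdot\rangle$. When $A$ is a continuous linear map $\mathcal{D}'(\mathbb{R}^n)\to\mathcal{D}'(\mathbb{R}^n)$ (with kernel $K\in\mathcal{D}'(\mathbb{R}^n\times\mathbb{R}^n)$), this is valid for all $u\in\mathcal{D}'(\mathbb{R}^n)$, $v\in C^\infty_0(\mathbb{R}^n)$ fulfilling the two displayed conditions.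
   Context: The kernel $K$ of $A$ is characterised by $\langle A\varphi,v\rangle=\langle K,v\otimes\varphi\rangle$ for all $\varphi,v\in C^\infty_0(\mathbb{R}^n)$, where $(v\otimes\varphi)(x,y)=v(x)\varphi(y)$ and $\langle\cdot,\cdot\rangle$ is bilinear. Extended action: if $f,g\in\mathcal{D}'(\mathbb{R}^N)$ have $\operatorname{sing\,supp}f\cap\operatorname{sing\,supp}g=\emptyset$, the product $fg\in\mathcal{D}'(\mathbb{R}^N)$ is the unique distribution which on $\mathbb{R}^N\setminus\operatorname{sing\,supp}g$ equals the product of the distribution $f$ by the smooth function $g$, and on $\mathbb{R}^N\setminus\operatorname{sing\,supp}f$ equals the product of $g$ by the smooth function $f$. If moreover $\operatorname{supp}f\cap\operatorname{supp}g$ is compact, then $\langle g,f\rangle:=\langle fg,1\rangle=\langle fg,\varphi\rangle$ for any $\varphi\in C^\infty_0(\mathbb{R}^N)$ equal to $1$ around $\operatorname{supp}(fg)$. *)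

(* Defs.v *)
From HB Require Import structures.
From mathcomp Require Import all_boot all_order all_algebra.
From mathcomp Require Import complex.
From mathcomp Require Import all_classical all_reals all_analysis.

Set Implicit Arguments.
Unset Strict Implicit.
Unset Printing Implicit Defensive.

Import Order.TTheory GRing.Theory Num.Theory numFieldNormedType.Exports.

Local Open Scope classical_set_scope.
Local Open Scope ring_scope.
Local Open Scope complex_scope.

Section Smooth.
Variables (R : realType) (N : nat).
Local Notation V := 'rV[R]_N.

(* [R[i]] is only a normed space over itself in the library, so real-variable
   calculus on complex-valued functions is done on real and imaginary parts. *)
Definition re_part (f : V -> R[i]^o) : V -> R := fun x => complex.Re (f x).
Definition im_part (f : V -> R[i]^o) : V -> R := fun x => complex.Im (f x).

(* A word [:: i1; i2; ...] of directions stands for the iterated partial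
   derivative d_i1 (d_i2 (...)), in place of a multi-index. *)
Definition rpartial (s : seq 'I_N) (f : V -> R) : V -> R :=
  foldr (fun i (g : V -> R) => fun x => 'D_('e_i) g x) f s.

Definition partial (s : seq 'I_N) (f : V -> R[i]^o) : V -> R[i]^o :=
  fun x => rpartial s (re_part f) x +i* rpartial s (im_part f) x.

(* Only used for open [U]; values outside [U] are then irrelevant. *)
Definition rsmooth_on (U : set V) (f : V -> R) : Prop :=
  forall (s : seq 'I_N) (x : V), U x ->
    {for x, continuous (rpartial s f)} /\
    forall i : 'I_N, derivable (rpartial s f) x 'e_i.

Definition smooth_on (U : set V) (f : V -> R[i]^o) : Prop :=
  rsmooth_on U (re_part f) /\ rsmooth_on U (im_part f).

Definition fsupp (f : V -> R[i]^o) : set V := closure [set x | f x != 0].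

Definition is_test (f : V -> R[i]^o) : Prop :=
  smooth_on setT f /\ compact (fsupp f).

Definition is_schwartz (f : V -> R[i]^o) : Prop :=
  smooth_on setT f /\
  forall (k : nat) (s : seq 'I_N), exists M : R, forall x : V,
    ((1 + `|x|) ^+ k)%:C * `|partial s f x| <= M%:C.

Lemma rpartial_lin (a b : R) (f g : V -> R) (s : seq 'I_N) :
  rsmooth_on setT f -> rsmooth_on setT g ->
  rpartial s (fun x => a * f x + b * g x) =
  fun x => a * rpartial s f x + b * rpartial s g x.
Proof.
move=> sf sg; elim: s => [//|i s IH] /=.
rewrite IH; apply/funext => x.
have [_ /(_ i) df] := sf s x I; have [_ /(_ i) dg] := sg s x I.
rewrite -[LHS]/('D_('e_i) (a *: rpartial s f + b *: rpartial s g) x).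
by rewrite (deriveD (derivableZ (k:=a) df) (derivableZ (k:=b) dg)) !deriveZ.
Qed.

Lemma rsmooth_lin (a b : R) (f g : V -> R) :
  rsmooth_on setT f -> rsmooth_on setT g ->
  rsmooth_on setT (fun x => a * f x + b * g x).
Proof.
move=> sf sg s x _; rewrite rpartial_lin//.
have [cf df] := sf s x I; have [cg dg] := sg s x I; split.
  apply: (@continuousD _ _ _ (fun x => a * _) (fun x => b * _));
    by apply: continuousM => //; exact: cst_continuous.
by move=> i; exact: (derivableD (derivableZ (k:=a) (df i)) (derivableZ (k:=b) (dg i))).
Qed.

Lemma rpartial0 (s : seq 'I_N) : rpartial s (fun=> 0) = fun=> 0.
Proof.
elim: s => [//|i s IH] /=; rewrite IH; apply/funext => x.
by rewrite -[LHS]/('D_('e_i) (cst (0 : R)) x) derive_cst.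
Qed.

Lemma rsmooth0 : rsmooth_on setT (fun=> 0).
Proof.
move=> s x _; rewrite rpartial0; split; first exact: cst_continuous.
by move=> i; exact: derivable_cst.
Qed.

Lemma re_partZD (a : R[i]) (f g : V -> R[i]^o) : re_part (a *: f + g) =
  fun x => 1 * (complex.Re a * re_part f x + (- complex.Im a) * im_part f x)
           + 1 * re_part g x.
Proof.
apply/funext => x; rewrite /re_part /im_part !fctE/=.
case: a (f x) (g x) => [a b] [c d] [e h] /=.
by rewrite !mul1r mulNr.
Qed.

Lemma im_partZD (a : R[i]) (f g : V -> R[i]^o) : im_part (a *: f + g) =
  fun x => 1 * (complex.Re a * im_part f x + complex.Im a * re_part f x)
           + 1 * im_part g x.
Proof.
apply/funext => x; rewrite /re_part /im_part !fctE/=.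
case: a (f x) (g x) => [a b] [c d] [e h] /=.
by rewrite !mul1r.
Qed.

Lemma partialZD (a : R[i]) (f g : V -> R[i]^o) (s : seq 'I_N) (x : V) :
  smooth_on setT f -> smooth_on setT g ->
  partial s (a *: f + g) x = a * partial s f x + partial s g x.
Proof.
move=> [sf1 sf2] [sg1 sg2].
rewrite /partial re_partZD im_partZD.
do ![rewrite rpartial_lin//; last exact: rsmooth_lin].
rewrite !rpartial_lin// !mul1r.
by case: a => [a b] /=; rewrite mulNr.
Qed.

Lemma smoothZD (a : R[i]) (f g : V -> R[i]^o) :
  smooth_on setT f -> smooth_on setT g -> smooth_on setT (a *: f + g).
Proof.
move=> [sf1 sf2] [sg1 sg2]; rewrite /smooth_on re_partZD im_partZD.
by split; do 2?apply: rsmooth_lin.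
Qed.

Lemma smooth0 : smooth_on setT (0 : V -> R[i]^o).
Proof. by split; exact: rsmooth0. Qed.

Lemma test0 : is_test 0.
Proof.
split; first exact: smooth0.
have -> : fsupp 0 = set0; last exact: compact0.
rewrite /fsupp (_ : [set _ | _] = set0) ?closure0//.
by apply/seteqP; split => // x /=; rewrite eqxx.
Qed.

Lemma testZD (a : R[i]) (f g : V -> R[i]^o) :
  is_test f -> is_test g -> is_test (a *: f + g).
Proof.
move=> [sf cf] [sg cg]; split; first exact: smoothZD.
have cfg : compact (fsupp f `|` fsupp g) by exact: compactU.
apply: (subclosed_compact _ cfg); first exact: closed_closure.
rewrite /fsupp -closureU; apply: closure_subset => x /=.
rewrite -[(a *: f + g) x]/(a *: f x + g x).
have [->|f0 _] := eqVneq (f x) 0; last by left.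
by rewrite scaler0 add0r; right.
Qed.

Lemma schwartz0 : is_schwartz 0.
Proof.
split; first exact: smooth0.
move=> k s; exists 0 => x.
rewrite /partial (_ : re_part 0 = fun=> 0)// (_ : im_part 0 = fun=> 0)//.
by rewrite !rpartial0 (_ : 0 +i* 0 = 0)// normr0 mulr0.
Qed.

Lemma schwartzZD (a : R[i]) (f g : V -> R[i]^o) :
  is_schwartz f -> is_schwartz g -> is_schwartz (a *: f + g).
Proof.
move=> [sf bf] [sg bg]; split; first exact: smoothZD.
move=> k s; have [M1 h1] := bf k s; have [M2 h2] := bg k s.
exists (complex.Re `|a| * M1 + M2) => x.
rewrite partialZD// rmorphD rmorphM/=.
have -> : (complex.Re `|a|)%:C = `|a| by rewrite RRe_real// normr_real.
have w0 : 0 <= ((1 + `|x|) ^+ k)%:C :> R[i].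
  by rewrite lecR exprn_ge0// addr_ge0.
apply: (@le_trans _ _ (`|a| * (((1 + `|x|) ^+ k)%:C * `|partial s f x|) +
                       ((1 + `|x|) ^+ k)%:C * `|partial s g x|)).
  rewrite mulrCA -mulrDr; apply: ler_wpM2l => //.
  by rewrite -normrM; exact: ler_normD.
by apply: lerD => //; apply: ler_wpM2l.
Qed.

Definition test_pred : {pred V -> R[i]^o} := fun f => `[< is_test f >].
Definition schwartz_pred : {pred V -> R[i]^o} := fun f => `[< is_schwartz f >].

Lemma test_submod_closed : submod_closed test_pred.
Proof.
split; first by apply/asboolP; exact: test0.
by move=> a f g /asboolP tf /asboolP tg; apply/asboolP; exact: testZD.
Qed.

Lemma schwartz_submod_closed : submod_closed schwartz_pred.
Proof.
split; first by apply/asboolP; exact: schwartz0.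
by move=> a f g /asboolP tf /asboolP tg; apply/asboolP; exact: schwartzZD.
Qed.

HB.instance Definition _ :=
  GRing.isSubmodClosed.Build R[i] (V -> R[i]^o) test_pred test_submod_closed.
HB.instance Definition _ :=
  GRing.isSubmodClosed.Build R[i] (V -> R[i]^o) schwartz_pred
    schwartz_submod_closed.

Record testfun := TestFun {
  testfun_val :> V -> R[i]^o ;
  testfunP : testfun_val \in test_pred }.
Record schwartz := Schwartz {
  schwartz_val :> V -> R[i]^o ;
  schwartzP : schwartz_val \in schwartz_pred }.

HB.instance Definition _ := [isSub for testfun_val].
HB.instance Definition _ := [Choice of testfun by <:].
HB.instance Definition _ := [SubChoice_isSubLmodule of testfun by <:].
HB.instance Definition _ := [isSub for schwartz_val].
HB.instance Definition _ := [Choice of schwartz by <:].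
HB.instance Definition _ := [SubChoice_isSubLmodule of schwartz by <:].

End Smooth.

Section Restriction.
Variables (R : realType) (N : nat).
Local Notation V := 'rV[R]_N.

Lemma rpartial_eq0 (U : set V) (f : V -> R) (s : seq 'I_N) : open U ->
  (forall x, U x -> f x = 0) -> forall x, U x -> rpartial s f x = 0.
Proof.
move=> oU f0; elim: s => [//|i s IH] x Ux /=.
rewrite (@near_eq_derive _ _ _ _ (cst 0)) ?derive_cst//.
by near=> y; apply: IH; near: y; exact: open_nbhs_nbhs.
Unshelve. all: by end_near. Qed.

Lemma partial_eq0 (f : V -> R[i]^o) (s : seq 'I_N) (x : V) :
  ~ fsupp f x -> partial s f x = 0.
Proof.
move=> fx; have oU : open (~` fsupp f) by exact/closed_openC/closed_closure.
have f0 y : (~` fsupp f) y -> f y = 0.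
  by move=> fy; apply: contra_notP fy => /eqP fy; exact: subset_closure.
by rewrite /partial !(rpartial_eq0 s oU)// => y /f0; rewrite /re_part /im_part => ->.
Qed.

Lemma normc_le (z : R[i]) :
  `|z| <= (`|complex.Re z| + `|complex.Im z|)%:C.
Proof.
rewrite [z in X in X <= _]complexE (le_trans (ler_normD _ _))// normrM.
rewrite !normc_def/= !(expr0n, expr1n, addr0, add0r, sqrtr1, sqrtr_sqr) normr1 mul1r.
by rewrite rmorphD.
Qed.

Lemma compact_ubound (W : normedModType R) (h : V -> W) (K : set V) :
  compact K -> continuous h -> exists2 M : R, 0 <= M & forall x, K x -> `|h x| <= M.
Proof.
move=> cK ch.
have : compact (h @` K).
  by apply: continuous_compact => //; exact: continuous_subspaceT.
move/compact_bounded => [M [_ hM]].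
exists (`|M| + 1) => [|x Kx]; first by rewrite addr_ge0.
by apply: hM; [rewrite (le_lt_trans (ler_norm _))// ltrDl|exists x].
Qed.

Lemma weight_ge0 (x : V) (k : nat) : 0 <= ((1 + `|x|) ^+ k)%:C :> R[i].
Proof. by rewrite lecR exprn_ge0// addr_ge0. Qed.

Lemma is_schwartz_test (f : testfun R N) : is_schwartz f.
Proof.
have [[sr si] cf] : is_test f by have /asboolP := testfunP f.
split=> // k s.
have [B B0 hB] : exists2 M : R, 0 <= M & forall x, fsupp f x -> `|x| <= M.
  by apply: (compact_ubound (h := id)) => // x.
have [B1 B10 h1] : exists2 M : R, 0 <= M &
    forall x, fsupp f x -> `|rpartial s (re_part f) x| <= M.
  by apply: (compact_ubound (W := R^o)) => // x; exact: (sr s x I).1.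
have [B2 B20 h2] : exists2 M : R, 0 <= M &
    forall x, fsupp f x -> `|rpartial s (im_part f) x| <= M.
  by apply: (compact_ubound (W := R^o)) => // x; exact: (si s x I).1.
exists ((1 + B) ^+ k * (B1 + B2)) => x.
have [Kx|/partial_eq0 ->] := pselect (fsupp f x); last first.
  rewrite normr0 mulr0 lecR mulr_ge0//; first by rewrite exprn_ge0// addr_ge0.
  by rewrite addr_ge0.
rewrite rmorphM; apply: ler_pM => //; first exact: weight_ge0.
  by rewrite lecR lerXn2r ?nnegrE ?addr_ge0// lerD2l hB.
apply: (le_trans (normc_le _)); rewrite lecR; apply: lerD; [exact: h1|exact: h2].
Qed.

Definition schwartz_of_test (f : testfun R N) : schwartz R N :=
  Schwartz (asboolT (is_schwartz_test f)).


End Restriction.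

Section Distributions.
Variables (R : realType) (N : nat).
Local Notation V := 'rV[R]_N.

(* [M] ranges over the upper bounds of the relevant seminorms of [f]. *)
Definition is_distribution (T : testfun R N -> R[i]^o) : Prop :=
  linear T /\
  forall K : set V, compact K -> exists (C : R) (k : nat),
    forall (f : testfun R N) (M : R), fsupp f `<=` K ->
      (forall (s : seq 'I_N) (x : V), (size s <= k)%N ->
         `|partial s f x| <= M%:C) ->
      `|T f| <= (C * M)%:C.

Definition is_tempered (T : schwartz R N -> R[i]^o) : Prop :=
  linear T /\
  exists (C : R) (k : nat), forall (f : schwartz R N) (M : R),
    (forall (s : seq 'I_N) (x : V), (size s <= k)%N ->
       ((1 + `|x|) ^+ k)%:C * `|partial s f x| <= M%:C) ->
    `|T f| <= (C * M)%:C.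

Definition distr_pred : {pred testfun R N -> R[i]^o} :=
  fun T => `[< is_distribution T >].
Definition tempered_pred : {pred schwartz R N -> R[i]^o} :=
  fun T => `[< is_tempered T >].

Lemma linearZD (E : lmodType R[i]) (a : R[i]) (S T : E -> R[i]^o) :
  linear S -> linear T -> linear (a *: S + T).
Proof.
move=> lS lT b x y; rewrite !fctE lS lT !scalerDr !scalerA.
by rewrite (mulrC a b) !addrA; congr (_ + _); rewrite -!addrA (addrC (a *: S y)).
Qed.

Lemma ler_ZD (a z w : R[i]) (C D M : R) :
  `|z| <= (C * M)%:C -> `|w| <= (D * M)%:C ->
  `|a * z + w| <= ((complex.Re `|a| * C + D) * M)%:C.
Proof.
move=> hz hw; rewrite (le_trans (ler_normD _ _))// normrM mulrDl rmorphD.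
apply: lerD => //; rewrite -mulrA rmorphM/=.
have -> : (complex.Re `|a|)%:C = `|a| by rewrite RRe_real// normr_real.
exact: ler_wpM2l.
Qed.

Lemma distr_submod_closed : submod_closed distr_pred.
Proof.
split; first apply/asboolP; first split.
- by move=> a x y; rewrite -[RHS]/(a *: 0 + 0) scaler0 addr0.
- move=> K _; exists 0, 0%N => f M _ _.
  by rewrite -[X in `|X|]/(0 : R[i]) normr0 mul0r.
move=> a S T /asboolP[lS cS] /asboolP[lT cT]; apply/asboolP.
split; first exact: linearZD.
move=> K cK; have [C [k h]] := cS K cK; have [D [l h']] := cT K cK.
exists (complex.Re `|a| * C + D), (maxn k l) => f M fK fM.
apply: ler_ZD; [apply: h|apply: h'] => // s x sk; apply: fM;
  by rewrite leq_max sk ?orbT.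
Qed.

Lemma tempered_submod_closed : submod_closed tempered_pred.
Proof.
split; first apply/asboolP; first split.
- by move=> a x y; rewrite -[RHS]/(a *: 0 + 0) scaler0 addr0.
- exists 0, 0%N => f M _.
  by rewrite -[X in `|X|]/(0 : R[i]) normr0 mul0r.
move=> a S T /asboolP[lS [C [k h]]] /asboolP[lT [D [l h']]]; apply/asboolP.
split; first exact: linearZD.
exists (complex.Re `|a| * C + D), (maxn k l) => f M fM.
have w j (x : V) : (j <= maxn k l)%N ->
    ((1 + `|x|) ^+ j)%:C <= ((1 + `|x|) ^+ maxn k l)%:C :> R[i].
  by move=> jm; rewrite lecR ler_weXn2l// lerDl.
apply: ler_ZD; [apply: h|apply: h'] => s x sk.
- apply: le_trans (fM s x _); last by rewrite leq_max sk.
  by apply: ler_wpM2r => //; apply: w; rewrite leq_maxl.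
- apply: le_trans (fM s x _); last by rewrite leq_max sk orbT.
  by apply: ler_wpM2r => //; apply: w; rewrite leq_maxr.
Qed.

HB.instance Definition _ :=
  GRing.isSubmodClosed.Build R[i] (testfun R N -> R[i]^o) distr_pred
    distr_submod_closed.
HB.instance Definition _ :=
  GRing.isSubmodClosed.Build R[i] (schwartz R N -> R[i]^o) tempered_pred
    tempered_submod_closed.

Record distr := Distr {
  distr_val :> testfun R N -> R[i]^o ;
  distrP : distr_val \in distr_pred }.
Record tempered := Tempered {
  tempered_val :> schwartz R N -> R[i]^o ;
  temperedP : tempered_val \in tempered_pred }.

HB.instance Definition _ := [isSub for distr_val].
HB.instance Definition _ := [Choice of distr by <:].
HB.instance Definition _ := [SubChoice_isSubLmodule of distr by <:].
HB.instance Definition _ := [isSub for tempered_val].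
HB.instance Definition _ := [Choice of tempered by <:].
HB.instance Definition _ := [SubChoice_isSubLmodule of tempered by <:].

(* Both dual spaces carry the weak* topology (pointwise convergence). *)
HB.instance Definition _ := Topological.copy distr
  (initial_topology (distr_val : distr -> {ptws testfun R N -> R[i]^o})).
HB.instance Definition _ := Topological.copy tempered
  (initial_topology (tempered_val : tempered -> {ptws schwartz R N -> R[i]^o})).

Lemma is_distribution_tempered (T : tempered) :
  is_distribution (fun f => T (schwartz_of_test f)).
Proof.
have [lT [C [k h]]] : is_tempered T by have /asboolP := temperedP T.
split.
  move=> a f g; rewrite -lT; congr (T _); exact/val_inj.
move=> K cK.
have [B B0 hB] : exists2 M : R, 0 <= M & forall x, K x -> `|x| <= M.
  by apply: (compact_ubound (h := id)) => // x.
exists (C * (1 + B) ^+ k), k => f M fK fM; rewrite -mulrA.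
apply: h => s x sk.
have M0 : 0 <= M%:C :> R[i] := le_trans (normr_ge0 _) (fM s x sk).
have [Kx|/(partial_eq0 s) /= ->] := pselect (fsupp f x); last first.
  by rewrite normr0 mulr0 rmorphM mulr_ge0// lecR exprn_ge0// addr_ge0.
rewrite rmorphM; apply: ler_pM => //; first exact: weight_ge0.
  by rewrite lecR lerXn2r ?nnegrE ?addr_ge0// lerD2l hB//; apply: fK.
exact: fM.
Qed.

Definition distr_of_tempered (T : tempered) : distr :=
  Distr (asboolT (is_distribution_tempered T)).

End Distributions.

(* [insubd] turns a function that satisfies the defining property of a subtype
   into an element of it (the default value 0 is for functions that do not).
   Below it is applied only to expressions that satisfy the property. *)
Definition to_test (R : realType) (N : nat) (f : 'rV[R]_N -> R[i]^o) :
  testfun R N := insubd (0 : testfun R N) f.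
Definition to_distr (R : realType) (N : nat) (T : testfun R N -> R[i]^o) :
  distr R N := insubd (0 : distr R N) T.
Definition to_tempered (R : realType) (N : nat) (T : schwartz R N -> R[i]^o) :
  tempered R N := insubd (0 : tempered R N) T.

(* Integration over R^N as an iterated integral; all integrands below are
   continuous with compact support. *)
Fixpoint rint (R : realType) (N : nat) : ('rV[R]_N -> R) -> R :=
  match N with
  | 0 => fun f => f 0
  | N'.+1 => fun f => \int[lebesgue_measure]_t
      rint (fun y : 'rV[R]_N' => f (row_mx (t%:M : 'rV[R]_1) y))
  end.

Definition cint (R : realType) (N : nat) (f : 'rV[R]_N -> R[i]^o) : R[i] :=
  rint (re_part f) +i* rint (im_part f).

Section Operations.
Variables (R : realType) (N : nat).
Local Notation V := 'rV[R]_N.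

Definition distr_of_test (f : testfun R N) : distr R N :=
  to_distr (fun g : testfun R N => cint (fun x => f x * g x)).
Definition tempered_of_test (f : testfun R N) : tempered R N :=
  to_tempered (fun g : schwartz R N => cint (fun x => f x * g x)).

Definition vanishes_on (T : distr R N) (U : set V) : Prop :=
  forall f : testfun R N, fsupp f `<=` U -> T f = 0.

Definition supp (T : distr R N) : set V :=
  ~` \bigcup_(U in [set U | open U /\ vanishes_on T U]) U.

(* On [U], the distribution [T] is the smooth function [a]. *)
Definition equals_smooth_on (T : distr R N) (U : set V) (a : V -> R[i]^o) :
    Prop :=
  smooth_on U a /\
  forall f : testfun R N, fsupp f `<=` U -> T f = cint (fun x => a x * f x).

Definition sing_supp (T : distr R N) : set V :=
  ~` \bigcup_(U in [set U | open U /\ exists a, equals_smooth_on T U a]) U.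

(* On [U], [h] is the product of the distribution [f] by the smooth function
   that [g] is there. *)
Definition is_mul_on (U : set V) (f g h : distr R N) : Prop :=
  exists2 a : V -> R[i]^o, equals_smooth_on g U a &
    forall p : testfun R N, fsupp p `<=` U ->
      h p = f (to_test (fun x => a x * p x)).

Definition is_mul (f g h : distr R N) : Prop :=
  is_mul_on (~` sing_supp g) f g h /\ is_mul_on (~` sing_supp f) g f h.

(* The product, for [f] and [g] with disjoint singular supports. *)
Definition distr_mul (f g : distr R N) : distr R N :=
  xget 0 [set h | is_mul f g h].

Definition equals1_around (A : set V) (p : testfun R N) : Prop :=
  exists2 U : set V, open U /\ A `<=` U & forall x, U x -> p x = 1.

(* The extended pairing <g, f>, for [f] and [g] with moreover compact
   [supp f `&` supp g]. *)
Definition pairing (g f : distr R N) : R[i] :=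
  distr_mul f g (xget 0 [set p | equals1_around (supp (distr_mul f g)) p]).

End Operations.

Section Tensor.
Variables (R : realType) (n m : nat).

Definition tensor_test (v : testfun R n) (f : testfun R m) :
    testfun R (n + m) :=
  to_test (fun z : 'rV[R]_(n + m) => v (lsubmx z) * f (rsubmx z)).

Definition tensor (v : testfun R n) (u : distr R m) : distr R (n + m) :=
  to_distr (fun f : testfun R (n + m) =>
    u (to_test (fun y => cint (fun x => v x * f (row_mx x y))))).

End Tensor.

Section Kernel.
Variables (R : realType) (n : nat).

Definition is_kernel (A : distr R n -> distr R n) (K : distr R (n + n)) :
    Prop :=
  forall f v : testfun R n, A (distr_of_test f) v = K (tensor_test v f).

Definition is_tempered_kernel (A : tempered R n -> tempered R n)
    (K : tempered R (n + n)) : Prop :=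
  forall f v : testfun R n,
    A (tempered_of_test f) (schwartz_of_test v) =
    K (schwartz_of_test (tensor_test v f)).

End Kernel.

(* Main.v *)
Require Import Defs.
From HB Require Import structures.
From mathcomp Require Import all_boot all_order all_algebra.
From mathcomp Require Import complex.
From mathcomp Require Import all_classical all_reals all_analysis.
From mathcomp Require Import ring lra.
Import Order.TTheory GRing.Theory Num.Theory numFieldNormedType.Exports.
Local Open Scope classical_set_scope.
Local Open Scope ring_scope.

(** Why the formula holds.

    Fix [v].  A weak-star continuous linear functional of [u] is evaluation at
    a fixed function, so there is a [psi], a Schwartz function or a test
    function according to the case, with [A u v = u psi] for all [u]
    ([distr_transpose], [tempered_transpose]).  Applied to [u = phi] this turns
    the definition of the kernel into a statement about [psi] alone: the
    pairing of [K] with [v (x) phi] is the integral of [phi * psi].  It remains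
    to show that the extended pairing of [K] with [w = v (x) u] is [u psi].

    No regularisation of [u] is needed.  Let [h] be the product of [K] and [w],
    and let [chi] be a test function on the second factor.  Off the singular
    support of [K], [K] is a smooth function [a]; off that of [w], [w] is a
    smooth function [b].  The singular support of [w] contains the support of
    [v] times that of the singular support of [u] ([sing_supp_tensor_sup]),
    since freezing a point where [v] does not vanish shows that [u] is smooth
    wherever [w] is.  So the singular support of [u], cut to the compact support
    of [chi], has a neighbourhood over which, above the support of [v], [K] is
    smooth ([tube]).  Choose a test function [theta] that is 1 on that part of
    the singular support and lives in this neighbourhood, and a test function
    [eta] that is 1 around the support of [v], and split
      [eta (x) chi = eta (x) (theta chi) + eta (x) ((1 - theta) chi)].
    On the first piece [K] is the smooth function [a], and the kernel identity
    together with the fundamental lemma of the calculus of variations gives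
    that the integral of [v(x) a(x,y)] in [x] is [psi(y)] for the relevant [y];
    hence [h] takes the value [u (theta chi psi)] there.  On the second piece
    [u] is a smooth function [beta], so [w] is [v (x) beta] and [h] takes the
    value of [K] on [v (x) (beta (1 - theta) chi)], which by the kernel identity
    is [u ((1 - theta) chi psi)].  The sum is [u (chi psi)]
    ([product_on_tensor_test]).

    The support of [h] lies in that of [K] and in that of [w], so it is compact
    and [h] may be tested on [eta (x) chi] as soon as [chi] is 1 around its
    projection ([pairing_tensor]).  This gives [u (chi psi)] for every [chi]
    that is 1 around a certain compact set.  If [psi] has compact support,
    choose [chi] equal to 1 on it; if [psi] is only Schwartz, let [chi] exhaust
    the space and use that [chi psi] tends to [psi] ([schwartz_truncation]).

    The rest supplies the tools: Fubini's theorem and differentiation under the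
    integral for the iterated integral, smooth bump functions, partitions of
    unity in the form of an induction principle on test functions
    ([test_ind]), existence of products of distributions with disjoint singular
    supports ([is_mul_exists]), and the description of [v (x) u] as [u] applied
    to partial integrals ([tensorE]). *)

Set Implicit Arguments.
Unset Strict Implicit.
Unset Printing Implicit Defensive.

(** * Row vectors and integrals in one and two variables *)

Section RowVectors.
Variable R : realType.

Lemma cvg_rV (T : Type) (F : set_system T) (FF : Filter F) n
    (f : T -> 'rV[R]_n) (l : 'rV[R]_n) :
  (forall j, (fun x => f x 0 j) @ F --> l 0 j) -> f @ F --> l.
Proof.
move=> h A [P hP] sPA.
have : \forall x \near F, forall j, P 0 j (f x 0 j).
  by apply: filter_forall => j; exact: h (hP 0 j).
by apply: filterS => x hx; apply: sPA => i j; rewrite (ord1 i).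
Qed.

Lemma row_mx_continuous n m :
  continuous (fun p : 'rV[R]_n * 'rV[R]_m => row_mx p.1 p.2).
Proof.
move=> p; apply: cvg_rV => j.
rewrite mxE; under eq_fun do rewrite mxE.
case: (fintype.split j) => k.
  apply: (@continuous_comp _ _ _ fst (fun M : 'rV[R]_n => M 0 k)).
    exact: cvg_fst.
  exact: coord_continuous.
apply: (@continuous_comp _ _ _ snd (fun M : 'rV[R]_m => M 0 k)).
  exact: cvg_snd.
exact: coord_continuous.
Qed.

Lemma cons_mx_continuous n :
  continuous (fun p : R * 'rV[R]_n => row_mx (p.1%:M : 'rV[R]_1) p.2).
Proof.
move=> p; apply: cvg_rV => j.
rewrite mxE; under eq_fun do rewrite mxE.
case: (fintype.split j) => k.
  rewrite (ord1 k) mxE eqxx mulr1n; under eq_fun do rewrite mxE eqxx mulr1n.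
  exact: cvg_fst.
apply: (@continuous_comp _ _ _ snd (fun M : 'rV[R]_n => M 0 k)).
  exact: cvg_snd.
exact: coord_continuous.
Qed.

Lemma lsubmx_continuous n m : continuous (@lsubmx R 1 n m).
Proof.
move=> p; apply: (cvg_rV (nbhs_filter p)) => j.
rewrite mxE; under eq_fun do rewrite mxE.
exact: coord_continuous.
Qed.

Lemma rsubmx_continuous n m : continuous (@rsubmx R 1 n m).
Proof.
move=> p; apply: (cvg_rV (nbhs_filter p)) => j.
rewrite mxE; under eq_fun do rewrite mxE.
exact: coord_continuous.
Qed.

Lemma rV_norm_le n (x : 'rV[R]_n) (c : R) : 0 <= c ->
  (`|x| <= c) <-> (forall j, `|x 0 j| <= c).
Proof.
move=> c0; rewrite [`|x|]mx_normrE; split.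
  by move=> /bigmax_leP[_ h] j; exact: (h (0, j)).
by move=> h; apply/bigmax_leP; split => // -[i j] _ /=; rewrite (ord1 i).
Qed.

Lemma coord_norm_le n (x : 'rV[R]_n) j : `|x 0 j| <= `|x|.
Proof. by have /rV_norm_le := lexx `|x|; apply. Qed.

Lemma norm_row_mxl n m (x : 'rV[R]_n) (y : 'rV[R]_m) : `|x| <= `|row_mx x y|.
Proof.
apply/rV_norm_le => // j; rewrite -[x 0 j](@row_mxEl _ _ _ _ x y).
exact: coord_norm_le.
Qed.

Lemma norm_row_mxr n m (x : 'rV[R]_n) (y : 'rV[R]_m) : `|y| <= `|row_mx x y|.
Proof.
apply/rV_norm_le => // j; rewrite -[y 0 j](@row_mxEr _ _ _ _ x y).
exact: coord_norm_le.
Qed.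

Lemma norm_scalar1 (t : R) : `|t%:M : 'rV[R]_1| = `|t|.
Proof.
apply/eqP; rewrite eq_le; apply/andP; split.
  by apply/rV_norm_le => // j; rewrite (ord1 j) mxE eqxx mulr1n.
by have := coord_norm_le (t%:M : 'rV[R]_1) 0; rewrite mxE eqxx mulr1n.
Qed.

Lemma rV_ball_compact n (B : R) : compact [set x : 'rV[R]_n | `|x| <= B].
Proof.
apply: bounded_closed_compact.
  exists B; split; first by rewrite num_real.
  by move=> M BM x /= h; exact: (le_trans h (ltW BM)).
have cn : {in ~` ((fun x : 'rV[R]_n => `|x|) @^-1` [set r : R | r <= B]),
    continuous (fun x : 'rV[R]_n => `|x|)}.
  by move=> x _; exact: norm_continuous.
exact: (preimage_closed cn (@closed_le _ B)).
Qed.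

End RowVectors.

Section OneVariable.
Variable R : realType.
Local Notation mu := (@lebesgue_measure R).

Definition cc1 (B : R) (g : R -> R) :=
  continuous g /\ forall t, B < `|t| -> g t = 0.

Lemma cc1_restrict B g : cc1 B g -> g = g \_ `[- B, B].
Proof.
move=> [_ g0]; apply/funext => t; rewrite patchE; case: ifPn => // /negP h.
apply: g0; rewrite ltNge; apply/negP => h1; apply: h.
by rewrite inE /= in_itv /= -ler_norml.
Qed.

Lemma cc1_integrable_itv B g : cc1 B g -> mu.-integrable `[- B, B] (EFin \o g).
Proof.
move=> [cg _]; apply: continuous_compact_integrable; first exact: segment_compact.
exact: continuous_subspaceT.
Qed.

Lemma cc1_integrable B g : cc1 B g -> mu.-integrable setT (EFin \o g).
Proof.
move=> h; rewrite (cc1_restrict h) -restrict_EFin.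
apply/(integrable_mkcond _ _).1 => //; exact: (cc1_integrable_itv h).
Qed.

Lemma cc1_lin B (a b : R) f g : cc1 B f -> cc1 B g ->
  \int[mu]_t (a * f t + b * g t) = a * \int[mu]_t f t + b * \int[mu]_t g t.
Proof.
move=> hf hg.
have If := cc1_integrable hf; have Ig := cc1_integrable hg.
rewrite RintegralD// ?RintegralZl//.
- rewrite (_ : _ \o _ = fun x => (a%:E * (EFin \o f) x)%E); last by apply/funext.
  exact: integrableZl.
- rewrite (_ : _ \o _ = fun x => (b%:E * (EFin \o g) x)%E); last by apply/funext.
  exact: integrableZl.
Qed.

Lemma cc1_cst_itv (B M : R) : 0 <= B -> \int[mu]_(t in `[- B, B]%classic) M = M * (2 * B).
Proof.
move=> B0; rewrite Rintegral_cst// [X in fine X]lebesgue_measure_itv /= lte_fin.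
case: ltP => h; first by rewrite /= opprK mulrDl mul1r.
have -> : B = 0 by apply/eqP; rewrite eq_le B0 andbT; lra.
by rewrite /= !mulr0.
Qed.

Lemma cc1_bound B M g : 0 <= B -> cc1 B g -> (forall t, `|g t| <= M) ->
  `|\int[mu]_t g t| <= M * (2 * B).
Proof.
move=> B0 hg gM.
rewrite (cc1_restrict hg) -Rintegral_mkcond -cc1_cst_itv//.
apply: (le_trans (le_normr_Rintegral _ _)) => //; first exact: cc1_integrable_itv hg.
apply: le_Rintegral => //.
  have [cg _] := hg.
  apply: continuous_compact_integrable; first exact: segment_compact.
  apply: continuous_subspaceT => x; apply: continuous_comp; first exact: cg.
  exact: norm_continuous.
apply: continuous_compact_integrable; first exact: segment_compact.
by apply: continuous_subspaceT => x; exact: cst_continuous.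
Qed.

(** A continuous function that is positive at a point is bounded below by half
    its value on an interval around it. *)
Lemma cc1_gt0 B g t0 : cc1 B g -> (forall t, 0 <= g t) -> 0 < g t0 ->
  0 < \int[mu]_t g t.
Proof.
move=> hg g0 gt0; have [cg _] := hg.
have h2 : 0 < g t0 / 2 by rewrite divr_gt0.
have : \forall t \near t0, g t0 / 2 < g t.
  have lt2 : g t0 / 2 < g t0 by lra.
  by have := cvgr_gt _ (cg t0) _ lt2; apply.
move=> /nbhs_ballP[e /= e0 he].
pose I : set R := `[t0 - e / 2, t0 + e / 2]%classic.
have mI : measurable (I : set (measurableTypeR R)) by exact: measurable_itv.
have II : mu.-integrable I (EFin \o g).
  apply: continuous_compact_integrable; first exact: segment_compact.
  exact: continuous_subspaceT.
apply: (@lt_le_trans _ _ (\int[mu]_(t in I) (g t0 / 2))).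
  rewrite Rintegral_cst// [X in fine X]lebesgue_measure_itv /= lte_fin ifT.
    by rewrite mulr_gt0//=; lra.
  by lra.
apply: (@le_trans _ _ (\int[mu]_(t in I) g t)).
  apply: le_Rintegral => //.
    apply: continuous_compact_integrable; first exact: segment_compact.
    by apply: continuous_subspaceT => x; exact: cst_continuous.
  move=> x; rewrite /I /= in_itv /= => /andP[h h'].
  apply/ltW/he; rewrite /ball /= ltr_distlC; apply/andP; split; lra.
rewrite Rintegral_mkcond; apply: le_Rintegral => //.
- rewrite -restrict_EFin.
  by apply/(integrable_mkcond _ _).1 => //.
- exact: cc1_integrable hg.
- by move=> x _; rewrite patchE; case: ifP.
Qed.

End OneVariable.

Section PlaneFubini.
Variable R : realType.
Local Notation mu := (@lebesgue_measure R).
Local Notation T := (measurableTypeR R).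

(** Rectangles with rational endpoints form a countable base of the plane, so
    an open set is a countable union of measurable rectangles. *)
Lemma open_plane_measurable (O : set (R * R)) :
  open O -> measurable (O : set (T * T)%type).
Proof.
move=> oO.
pose rect (q : rat * rat * rat * rat) : set (T * T) :=
  `]ratr q.1.1.1, ratr q.1.1.2[%classic `*` `]ratr q.1.2, ratr q.2[%classic.
have -> : (O : set (T * T)) =
    \bigcup_q (if `[< rect q `<=` O >] then rect q else set0).
  apply/seteqP; split => [[x y] Oxy|p [q _]]; last first.
    by case: ifPn => // /asboolP; apply.
  have /nbhs_ballP[e /= e0 he] : nbhs (x, y) O by exact: open_nbhs_nbhs.
  have [a ha] : exists q : rat, ratr q \in `]x - e, x[ by apply: rat_in_itvoo; lra.
  have [b hb] : exists q : rat, ratr q \in `]x, x + e[ by apply: rat_in_itvoo; lra.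
  have [c hc] : exists q : rat, ratr q \in `]y - e, y[ by apply: rat_in_itvoo; lra.
  have [d hd] : exists q : rat, ratr q \in `]y, y + e[ by apply: rat_in_itvoo; lra.
  move: ha hb hc hd; rewrite !in_itv /=.
  move=> /andP[a1 a2] /andP[b1 b2] /andP[c1 c2] /andP[d1 d2].
  exists (a, b, c, d) => //; case: ifPn => [_|/asboolPn]; last first.
    move=> h; exfalso; apply: h => -[x' y'] []; rewrite /= !in_itv /=.
    move=> /andP[x1 x2] /andP[y1 y2]; apply: he; split; rewrite /ball /=;
      rewrite ltr_distlC; apply/andP; split; lra.
  by split; rewrite /= in_itv /= ?a2 ?c2.
apply: countable_bigcupT_measurable; first exact: countableP.
move=> q; case: ifPn => // _; apply: measurableX; exact: measurable_itv.
Qed.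

Lemma continuous_plane_measurable (H : R * R -> R) : continuous H ->
  measurable_fun setT (H : (T * T)%type -> T).
Proof.
move=> /continuousP cH; apply: (measurability _ (measurable_realfun.RGenOpens.measurableE R)).
move=> _ [_ [a [b ->] <-]]; rewrite setTI.
by apply: open_plane_measurable; apply/cH/interval_open.
Qed.

(** A continuous function that vanishes off a square is bounded with support
    of finite measure, hence integrable for the product measure, and the
    general theorem applies. *)
Lemma plane_fubini (B : R) (H : R -> R -> R) :
  continuous (fun p : R * R => H p.1 p.2) -> 0 <= B ->
  (forall t s, B < `|t| \/ B < `|s| -> H t s = 0) ->
  \int[mu]_t \int[mu]_s H t s = \int[mu]_s \int[mu]_t H t s.
Proof.
move=> cH B0 H0.
have slice1 t : cc1 B (H t).
  split=> [s|s Bs]; last by apply: H0; right.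
  apply: (@continuous_comp _ _ _ (fun s => (t, s)) (fun p : R * R => H p.1 p.2)).
    exact: (cvg_pair (cvg_cst t) cvg_id).
  exact: cH.
have slice2 s : cc1 B (H^~ s).
  split=> [t|t Bt]; last by apply: H0; left.
  apply: (@continuous_comp _ _ _ (fun t => (t, s)) (fun p : R * R => H p.1 p.2)).
    exact: (cvg_pair cvg_id (cvg_cst s)).
  exact: cH.
pose F (p : (T * T)%type) : R := H p.1 p.2.
have mF : measurable_fun setT (F : (T * T)%type -> T).
  exact: continuous_plane_measurable.
pose I : set T := `[- B, B]%classic.
have mI : measurable I by exact: measurable_itv.
have iF : (mu \x mu)%E.-integrable setT (EFin \o F).
  have -> : F = F \_ (I `*` I).
    apply/funext => p; rewrite patchE; case: ifPn => // /negP h; apply: H0.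
    apply: contrapT => /not_orP[/negP h1 /negP h2]; apply: h.
    by rewrite inE; split; rewrite /I /= in_itv /= -ler_norml leNgt.
  rewrite -restrict_EFin.
  apply/(integrable_mkcond _ _).1; first exact: measurableX.
  apply: measurable_bounded_integrable.
  - exact: measurableX.
  - have mIfin : mu I \is a fin_num.
      rewrite /I [mu _]lebesgue_measure_itv /= lte_fin.
      by case: ifP.
    apply: (@le_lt_trans _ _ (mu I * mu I)%E).
      by rewrite -product_measure1E.
    by rewrite ltey_eq fin_numM.
  - exact: measurable_funTS.
  - have cI : compact (I : set R) by exact: segment_compact.
    have := compact_setX cI cI.
    move=> /(continuous_compact (continuous_subspaceT cH)).
    move=> /(@compact_bounded _ R^o)[M [Mr hM]].
    exists M; split=> // x Mx p /= Ip; apply: hM => //.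
    by exists p.
have E1 : \int[mu]_t \int[mu]_s H t s = fine (\int[mu]_t \int[mu]_s (EFin \o F) (t, s))%E.
  congr fine; apply: eq_integral => t _.
  by rewrite fineK//; apply: integrable_fin_num => //; exact: cc1_integrable (slice1 t).
have E2 : \int[mu]_s \int[mu]_t H t s = fine (\int[mu]_s \int[mu]_t (EFin \o F) (t, s))%E.
  congr fine; apply: eq_integral => s _.
  by rewrite fineK//; apply: integrable_fin_num => //; exact: cc1_integrable (slice2 s).
by rewrite E1 E2 Fubini.
Qed.

End PlaneFubini.

(** * The iterated integral *)

Lemma pair_continuous (T W V : topologicalType) (f : T -> W) (g : T -> V) :
  continuous f -> continuous g -> continuous (fun x => (f x, g x)).
Proof.
move=> cf cg x A [[P Q] /= [Pw Qx] PQ]; rewrite nbhs_simpl /=.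
have FP : nbhs x (f @^-1` P) by exact: cf.
have FQ : nbhs x (g @^-1` Q) by exact: cg.
by apply: filterS (filterI FP FQ) => y [Py Qy]; exact: PQ.
Qed.

Lemma pairr_continuous (W V : topologicalType) (w : W) :
  continuous (fun x : V => (w, x)).
Proof. by apply: pair_continuous => x; [exact: cvg_cst|exact: cvg_id]. Qed.

Lemma comp_continuous (T W V : topologicalType) (f : T -> W) (g : W -> V) :
  continuous f -> continuous g -> continuous (fun x => g (f x)).
Proof. by move=> cf cg x; exact: (continuous_comp (cf x) (cg (f x))). Qed.

Lemma fst_continuous (W V : topologicalType) :
  continuous (fun p : W * V => p.1).
Proof. by move=> p; exact: cvg_fst. Qed.

Lemma snd_continuous (W V : topologicalType) :
  continuous (fun p : W * V => p.2).
Proof. by move=> p; exact: cvg_snd. Qed.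

Section IteratedIntegral.
Variable R : realType.
Local Notation mu := (@lebesgue_measure R).

Definition cc N (B : R) (f : 'rV[R]_N -> R) :=
  continuous f /\ forall x, B < `|x| -> f x = 0.

(** The support is bounded uniformly in the parameter [w]: this is what turns
    joint continuity into continuity that is uniform in the integration
    variable. *)
Definition pcc (W : topologicalType) N (B : R) (F : W -> 'rV[R]_N -> R) :=
  continuous (fun p : W * 'rV[R]_N => F p.1 p.2) /\
  forall w x, B < `|x| -> F w x = 0.

Lemma pcc_cc (W : topologicalType) N (B : R) (F : W -> 'rV[R]_N -> R) w :
  pcc B F -> cc B (F w).
Proof.
move=> [cF F0]; split=> [x|]; last exact: F0.
apply: (@continuous_comp _ _ _ (fun x => (w, x))
  (fun p : W * 'rV[R]_N => F p.1 p.2)); last exact: cF.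
exact: pairr_continuous.
Qed.

Lemma cc_lin N (B a b : R) (f g : 'rV[R]_N -> R) :
  cc B f -> cc B g -> cc B (fun x => a * f x + b * g x).
Proof.
move=> [cf f0] [cg g0]; split=> [x|x Bx]; last by rewrite f0// g0// !mulr0 addr0.
exact: (cvgD (cvgM (cvg_cst a) (cf x)) (cvgM (cvg_cst b) (cg x))).
Qed.

(** The variable that [rint] integrates last is put in front. *)
Definition consv N (t : R) (y : 'rV[R]_N) : 'rV[R]_N.+1 :=
  row_mx (t%:M : 'rV[R]_1) y.

Lemma consv_normr N t (y : 'rV[R]_N) : `|y| <= `|consv t y|.
Proof. exact: (@norm_row_mxr _ 1 N). Qed.

Lemma consv_norm N t (y : 'rV[R]_N) : `|t| <= `|consv t y|.
Proof. by rewrite -norm_scalar1; exact: (@norm_row_mxl _ 1 N). Qed.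

Lemma pcc_cons N (B : R) (f : 'rV[R]_N.+1 -> R) : cc B f ->
  pcc B (fun t y => f (consv t y)).
Proof.
move=> [cf f0]; split=> [p|t y By]; last first.
  by apply: f0; apply: lt_le_trans By _; exact: consv_normr.
apply: (@continuous_comp _ _ _ (fun p : R * 'rV[R]_N => consv p.1 p.2) f).
  exact: cons_mx_continuous.
exact: cf.
Qed.

Lemma rint0 N : rint (fun _ : 'rV[R]_N => 0) = 0.
Proof.
elim: N => //= N IH; rewrite IH /Rintegral.
by rewrite integral0.
Qed.

(** The closed ball that carries all the [F w] is compact, so joint continuity
    at each of its points holds uniformly over it. *)
Lemma pcc_near (W : topologicalType) N (B : R) (F : W -> 'rV[R]_N -> R) w e :
  pcc B F -> 0 < e -> \forall w' \near w, forall x, `|F w' x - F w x| <= e.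
Proof.
move=> [cF F0] e0.
have /compact_near_coveringP H := @rV_ball_compact R N B.
have {}H := H _ (nbhs w) (fun w' x => `|F w' x - F w x| <= e) (nbhs_filter w).
have {}H : \forall w' \near w, [set x | `|x| <= B] `<=` (fun x => `|F w' x - F w x| <= e).
  apply: H => x _ /=.
  have e2 : 0 < e / 2 by rewrite divr_gt0.
  have /cvgr_dist_lt /(_ _ e2) [[P Q] /= [nP nQ] PQ] := cF (w, x).
  exists (Q, P) => //= -[x' w'] /= [Qx' Pw'].
  have h1 := PQ (w', x') (conj Pw' Qx').
  have h2 := PQ (w, x') (conj (nbhs_singleton nP) Qx').
  rewrite /= in h1 h2.
  rewrite -(subrK (F w x) (F w' x')) -addrA (le_trans (ler_normD _ _))//.
  by rewrite distrC [leRHS](splitr e) lerD// ltW.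
apply: filterS H => w' Hw' x.
have [xB|Bx] := leP `|x| B; first exact: Hw'.
by rewrite !F0// subrr normr0 ltW.
Qed.

Lemma pcc_rint_continuous_from (W : topologicalType) N (B : R) (F : W -> 'rV[R]_N -> R) :
  0 <= B ->
  (forall (a b : R) (f g : 'rV[R]_N -> R), cc B f -> cc B g ->
    rint (fun x => a * f x + b * g x) = a * rint f + b * rint g) ->
  (forall (M : R) (f : 'rV[R]_N -> R), cc B f -> (forall x, `|f x| <= M) ->
    `|rint f| <= M * (2 * B) ^+ N) ->
  pcc B F -> continuous (fun w => rint (F w)).
Proof.
move=> B0 lin bd pF w.
have K0 : 0 <= (2 * B) ^+ N by rewrite exprn_ge0// mulr_ge0.
apply/cvgrPdist_le => e e0.
have e1 : 0 < e / ((2 * B) ^+ N + 1) by rewrite divr_gt0// ltr_wpDl.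
have := pcc_near w pF e1; apply: filterS => w' hw'.
have -> : rint (F w) - rint (F w') = rint (fun x => 1 * F w x + (-1) * F w' x).
  by rewrite lin; [rewrite mul1r mulN1r|exact: pcc_cc pF..].
apply: (@le_trans _ _ (e / ((2 * B) ^+ N + 1) * (2 * B) ^+ N)).
  apply: bd; first by apply: cc_lin; exact: pcc_cc pF.
  by move=> x; rewrite mul1r mulN1r distrC.
rewrite mulrAC -mulrA ler_piMr ?(ltW e0)// ler_pdivrMr ?mul1r ?lerDl ?ltr_wpDl//.
Qed.

(** The two facts are proved together, by induction on the dimension: in
    dimension [N] they make the inner integral a continuous function of the
    outer variable, which is what linearity and the bound of the outer integral
    require in dimension [N.+1]. *)
Lemma rint_lin_bound N (B : R) : 0 <= B ->
  (forall (a b : R) (f g : 'rV[R]_N -> R), cc B f -> cc B g ->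
    rint (fun x => a * f x + b * g x) = a * rint f + b * rint g) /\
  (forall (M : R) (f : 'rV[R]_N -> R), cc B f -> (forall x, `|f x| <= M) ->
    `|rint f| <= M * (2 * B) ^+ N).
Proof.
move=> B0; elim: N => [|N [lin bd]]; first by split=> //= M f _ fM; rewrite mulr1.
have cc1_slice (f : 'rV[R]_N.+1 -> R) : cc B f -> cc1 B (fun t => rint (fun y => f (consv t y))).
  move=> ccf; split.
    exact: (pcc_rint_continuous_from B0 lin bd (pcc_cons ccf)).
  move=> t Bt; rewrite (_ : (fun y => _) = fun=> 0) ?rint0//.
  apply/funext => y; apply: ccf.2; apply: lt_le_trans Bt _; exact: consv_norm.
split=> [a b f g ccf ccg|M f ccf fM] /=.
  rewrite -(cc1_lin a b (cc1_slice f ccf) (cc1_slice g ccg)).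
  apply: eq_Rintegral => t _; apply: lin; exact: pcc_cc (pcc_cons _).
rewrite exprSr mulrA; apply: (cc1_bound B0 (cc1_slice f ccf)) => t.
by apply: bd => //; exact: pcc_cc (pcc_cons ccf).
Qed.

Lemma rint_lin N (B : R) (a b : R) (f g : 'rV[R]_N -> R) : 0 <= B -> cc B f -> cc B g ->
  rint (fun x => a * f x + b * g x) = a * rint f + b * rint g.
Proof. by move=> B0; exact: (rint_lin_bound N B0).1. Qed.

Lemma rint_bound N (B M : R) (f : 'rV[R]_N -> R) : 0 <= B -> cc B f ->
  (forall x, `|f x| <= M) -> `|rint f| <= M * (2 * B) ^+ N.
Proof. by move=> B0; exact: (rint_lin_bound N B0).2. Qed.

Lemma pcc_rint_continuous (W : topologicalType) N (B : R) (F : W -> 'rV[R]_N -> R) :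
  0 <= B -> pcc B F -> continuous (fun w => rint (F w)).
Proof.
move=> B0; apply: pcc_rint_continuous_from => // [a b f g|M f];
  [exact: rint_lin|exact: rint_bound].
Qed.

Lemma cc1_slice N (B : R) (f : 'rV[R]_N.+1 -> R) : 0 <= B -> cc B f ->
  cc1 B (fun t => rint (fun y => f (consv t y))).
Proof.
move=> B0 ccf; split; first exact: pcc_rint_continuous (pcc_cons ccf).
move=> t Bt; rewrite (_ : (fun y => _) = fun=> 0) ?rint0//.
apply/funext => y; apply: ccf.2; apply: lt_le_trans Bt _; exact: consv_norm.
Qed.

Lemma rint_ge0 N (f : 'rV[R]_N -> R) : (forall x, 0 <= f x) -> 0 <= rint f.
Proof.
elim: N f => //= N IH f f0; apply: Rintegral_ge0 => t _; exact: IH.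
Qed.

Lemma rint_gt0 N (B : R) (f : 'rV[R]_N -> R) x0 : 0 <= B -> cc B f ->
  (forall x, 0 <= f x) -> 0 < f x0 -> 0 < rint f.
Proof.
move=> B0; elim: N f x0 => /= [|N IH] f x0 ccf f0 fx0.
  by rewrite (_ : 0 = x0)//; apply/rowP; case.
apply: (cc1_gt0 (t0 := lsubmx (x0 : 'rV_(1 + N)) 0 0) (cc1_slice B0 ccf)).
  by move=> t; exact: rint_ge0.
apply: (IH _ (rsubmx (x0 : 'rV_(1 + N)))) => //; first exact: pcc_cc (pcc_cons ccf).
by rewrite /consv -mx11_scalar hsubmxK.
Qed.

Lemma row_mx_cons n m t (x : 'rV[R]_n) (y : 'rV[R]_m) :
  row_mx (consv t x) y = consv t (row_mx x y) :> 'rV[R]_(n + m).+1.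
Proof.
rewrite /consv row_mxA; apply/rowP => j; rewrite castmxE /=.
by congr (row_mx _ _ _ _); apply: val_inj.
Qed.

(** The integral over the first [n] coordinates is already the outer one in the
    definition of [rint]. *)
Lemma rint_iter n m (f : 'rV[R]_(n + m) -> R) :
  rint f = rint (fun x : 'rV[R]_n => rint (fun y : 'rV[R]_m => f (row_mx x y))).
Proof.
elim: n f => [|n IH] f.
  rewrite [RHS]/=; congr rint; apply/funext => y; congr f.
  by apply/rowP => j; rewrite mxE; case: splitP => [[]//|k jk]; congr (y _ _); apply: val_inj.
rewrite [LHS]/=; apply: eq_Rintegral => t _; rewrite IH; congr rint.
apply/funext => x; congr rint; apply/funext => y; congr f.
by rewrite -/(consv t x) row_mx_cons.
Qed.

(** Induction on [m], exchanging one pair of real variables at a time. *)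
Lemma Rintegral_rint_swap m (B : R) (G : R -> 'rV[R]_m -> R) : 0 <= B -> pcc B G ->
  (forall t y, B < `|t| -> G t y = 0) ->
  \int[mu]_t rint (G t) = rint (fun y => \int[mu]_t G t y).
Proof.
move=> B0; elim: m G => [//|m IH] G pG G0 /=.
have pG' : pcc (W := (R * R)%type) B (fun p y => G p.1 (consv p.2 y)).
  split=> [p|p y By]; last first.
    by apply: pG.2; apply: lt_le_trans By _; exact: consv_normr.
  apply: (@comp_continuous _ _ _
    (fun p : (R * R) * 'rV[R]_m => (p.1.1, consv p.1.2 p.2))
    (fun p : R * 'rV[R]_m.+1 => G p.1 p.2)); last exact: pG.1.
  apply: pair_continuous.
    exact: (comp_continuous (@fst_continuous _ _) (@fst_continuous _ _)).
  apply: (@comp_continuous _ _ _ (fun p : (R * R) * 'rV[R]_m => (p.1.2, p.2))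
    (fun p : R * 'rV[R]_m => consv p.1 p.2)).
    apply: pair_continuous; last exact: snd_continuous.
    exact: (comp_continuous (@fst_continuous _ _) (@snd_continuous _ _)).
  exact: cons_mx_continuous.
rewrite (plane_fubini (B := B) (H := fun t s => rint (fun y => G t (consv s y))))//.
- apply: eq_Rintegral => s _; apply: IH.
    split=> [|t y By]; last by apply: (pG'.2 (t, s)).
    apply: (@comp_continuous _ _ _ (fun p : R * 'rV[R]_m => ((p.1, s), p.2))
      (fun p : (R * R) * 'rV[R]_m => G p.1.1 (consv p.1.2 p.2))).
      apply: pair_continuous; last exact: snd_continuous.
      apply: pair_continuous; first exact: fst_continuous.
      exact: cst_continuous.
    exact: pG'.1.
  by move=> t y Bt; exact: G0.
- exact: pcc_rint_continuous pG'.
- move=> t s h; rewrite (_ : (fun y => _) = fun=> 0) ?rint0//.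
  apply/funext => y; case: h => [Bt|Bs]; first exact: G0.
  by apply: pG.2; apply: lt_le_trans Bs _; exact: consv_norm.
Qed.

(** The order opposite to that of [rint_iter]: the first [n] coordinates are
    moved inside one by one. *)
Lemma rint_fubini n m (B : R) (f : 'rV[R]_(n + m) -> R) : 0 <= B -> cc B f ->
  rint f = rint (fun y : 'rV[R]_m => rint (fun x : 'rV[R]_n => f (row_mx x y))).
Proof.
move=> B0; elim: n f => [|n IH] f ccf; first exact: rint_iter.
rewrite [LHS]/=.
pose H (p : R * 'rV[R]_m) (x : 'rV[R]_n) := f (row_mx (consv p.1 x) p.2).
have pH : pcc B H.
  split=> [|[t y] x Bx]; last first.
    apply: ccf.2; apply: lt_le_trans Bx _; apply: le_trans (norm_row_mxl _ _).
    exact: consv_normr.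
  apply: (@comp_continuous _ _ _
    (fun p : (R * 'rV[R]_m) * 'rV[R]_n => row_mx (consv p.1.1 p.2) p.1.2) f);
    last exact: ccf.1.
  apply: (@comp_continuous _ _ _
    (fun p : (R * 'rV[R]_m) * 'rV[R]_n => (consv p.1.1 p.2, p.1.2))
    (fun p => row_mx p.1 p.2)); last exact: row_mx_continuous.
  apply: pair_continuous; last first.
    exact: (comp_continuous (@fst_continuous _ _) (@snd_continuous _ _)).
  apply: (@comp_continuous _ _ _ (fun p : (R * 'rV[R]_m) * 'rV[R]_n => (p.1.1, p.2))
    (fun p : R * 'rV[R]_n => consv p.1 p.2)); last exact: cons_mx_continuous.
  apply: pair_continuous; last exact: snd_continuous.
  exact: (comp_continuous (@fst_continuous _ _) (@fst_continuous _ _)).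
pose G t y := rint (H (t, y)).
have pG : pcc B G.
  split=> [|t y By].
    have -> : (fun p : R * 'rV[R]_m => G p.1 p.2) = fun p => rint (H p).
      by apply/funext => -[].
    exact: pcc_rint_continuous pH.
  rewrite /G (_ : H (t, y) = fun=> 0) ?rint0//; apply/funext => x.
  by apply: ccf.2; apply: lt_le_trans By _; exact: norm_row_mxr.
transitivity (\int[mu]_t rint (G t)).
  apply: eq_Rintegral => t _; rewrite (IH _ (pcc_cc t (pcc_cons ccf))).
  congr rint; apply/funext => y; congr rint; apply/funext => x.
  by rewrite /H /= row_mx_cons.
rewrite (Rintegral_rint_swap B0 pG)//.
move=> t y Bt; rewrite /G (_ : H (t, y) = fun=> 0) ?rint0//; apply/funext => x.
apply: ccf.2; apply: lt_le_trans Bt _; apply: le_trans (norm_row_mxl _ _).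
exact: consv_norm.
Qed.

End IteratedIntegral.

(** * Calculus of iterated partial derivatives *)

Section LineDerivatives.
Variable R : realType.

Lemma is_derive_affine (g : R -> R) (b c d : R) :
  is_derive b 1 g d -> is_derive (0 : R) 1 (fun h => g (h * c + b)) (c * d).
Proof.
move=> gd.
have gd' : is_derive (0 * c + b : R) 1 g d by rewrite mul0r add0r.
have ld : is_derive (0 : R) 1 (fun h : R => h * c + b) c.
  have -> : (fun h : R => h * c + b) = (c \*: id) + cst b.
    by apply/funext => h; rewrite !fctE /= mulrC.
  apply: is_derive_eq; by rewrite addr0 -[LHS]/(c * 1) mulr1.
split.
  apply/derivable1_diffP; apply: differentiable_comp.
    by apply/derivable1_diffP; case: ld.
  by apply/derivable1_diffP; case: gd'.
rewrite -derive1E (@derive1_comp _ (fun h : R => h * c + b) g).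
- by rewrite !derive1E (@derive_val _ _ _ _ _ _ _ gd') (@derive_val _ _ _ _ _ _ _ ld) mulrC.
- by case: ld.
- by case: gd'.
Qed.

Lemma is_derive_lineP n (f : 'rV[R]_n -> R) a v d :
  is_derive a v f d <-> is_derive (0 : R) 1 (fun h => f (h *: v + a)) d.
Proof.
have E : (fun h : R => h^-1 *: ((f \o shift a) (h *: v) - f a)) =
   (fun h : R => h^-1 *: (((fun h : R => f (h *: v + a)) \o shift 0) (h *: (1 : R)) -
                     f (0 *: v + a))).
  apply/funext => h; congr (_ *: (f _ - f _)).
    by rewrite /shift /= addr0 -[h *: 1]/(h * 1) mulr1.
  by rewrite scale0r add0r.
split=> -[h1 h2]; split; move: h1 h2; rewrite /derivable /derive.
- by rewrite E.
- by rewrite E.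
- by rewrite -E.
- by rewrite -E.
Qed.

(** Directional derivatives only see lines, so this chain rule for a map that
    is affine along one line needs no total differentiability. *)
Lemma is_derive_comp_affine n m (L : 'rV[R]_m -> 'rV[R]_n) (f : 'rV[R]_n -> R)
    x v w c d :
  (forall h : R, L (h *: v + x) = h * c *: w + L x) ->
  is_derive (L x) w f d -> is_derive x v (fun x => f (L x)) (c * d).
Proof.
move=> hL /is_derive_lineP h; apply/is_derive_lineP.
have /= := is_derive_affine c h.
by under eq_fun do rewrite addr0 -hL.
Qed.

Lemma is_derive_comp_invariant n m (L : 'rV[R]_m -> 'rV[R]_n) (f : 'rV[R]_n -> R)
    x v :
  (forall h : R, L (h *: v + x) = L x) -> is_derive x v (fun x => f (L x)) 0.
Proof.
move=> hL; apply/is_derive_lineP; under eq_fun do rewrite hL.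
exact: is_derive_cst.
Qed.

Lemma is_derive_coord n (g : R -> R) (j : 'I_n) (c b : R) (x : 'rV[R]_n) i d :
  is_derive (c * x 0 j + b) 1 g d ->
  is_derive (x : 'rV[R]_n) 'e_i (fun x => g (c * x 0 j + b)) ((c * (i == j)%:R) * d).
Proof.
move=> h; apply/is_derive_lineP.
have := is_derive_affine (c * (i == j)%:R) h.
under [X in _ -> is_derive _ _ X _]eq_fun do
  rewrite !mxE eqxx /= mulrDr mulrCA (eq_sym j) -addrA.
by [].
Qed.

End LineDerivatives.

Section Smoothness.
Variable R : realType.

Definition pd N (i : 'I_N) (f : 'rV[R]_N -> R) : 'rV[R]_N -> R :=
  fun x => 'D_('e_i) f x.

Lemma rpartial_rcons N s (i : 'I_N) (f : 'rV[R]_N -> R) :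
  rpartial (rcons s i) f = rpartial s (pd i f).
Proof. by rewrite /rpartial foldr_rcons. Qed.

(** Derivatives are stripped from the inside, one order at a time; unlike the
    condition on all words of derivatives at once, this form supports induction
    through the product and quotient rules. *)
Fixpoint Ck N (k : nat) (U : set 'rV[R]_N) (f : 'rV[R]_N -> R) : Prop :=
  (forall x, U x -> {for x, continuous f}) /\
  if k is k'.+1 then
    (forall x, U x -> forall i, derivable f x 'e_i) /\
    (forall i, Ck k' U (pd i f))
  else True.

Lemma rsmooth_onP N (U : set 'rV[R]_N) (f : 'rV[R]_N -> R) :
  rsmooth_on U f <-> forall k, Ck k U f.
Proof.
split=> [h k|h].
  elim: k f h => [|k IH] f h; split=> //=; try by move=> x Ux; exact: (h [::] x Ux).1.
  split; first by move=> x Ux; exact: (h [::] x Ux).2.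
  move=> i; apply: IH => s x Ux; rewrite -rpartial_rcons; exact: h.
move=> s; elim/last_ind: s f h => [|s i IH] f h x Ux.
  split; first exact: (h 0%N).1.
  by move=> i; have [_ [+ _]] := h 1%N; apply.
rewrite rpartial_rcons; apply: IH => // k.
by have [_ [_ +]] := h k.+1; apply.
Qed.

Lemma CkS N k (U : set 'rV[R]_N) f : Ck k.+1 U f -> Ck k U f.
Proof.
elim: k f => [|k IH] f; first by case.
by move=> [cf [df pf]]; split=> //; split=> // i; exact: IH (pf i).
Qed.

Lemma pd_eq_on N (U : set 'rV[R]_N) f g i : open U ->
  (forall x, U x -> f x = g x) -> forall x, U x -> pd i f x = pd i g x.
Proof.
move=> oU fg x Ux; apply: near_eq_derive.
by near=> y; apply: fg; near: y; exact: open_nbhs_nbhs.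
Unshelve. all: by end_near. Qed.

Lemma continuous_eq_on (T W : topologicalType) (U : set T) (f g : T -> W) x :
  open U -> (forall x, U x -> f x = g x) -> U x ->
  continuous_at x f -> continuous_at x g.
Proof.
move=> oU fg Ux cf; rewrite /continuous_at -(fg x Ux).
apply: cvg_trans cf; apply: near_eq_cvg.
by near=> y; apply: fg; near: y; exact: open_nbhs_nbhs.
Unshelve. all: by end_near. Qed.

Lemma Ck_eq_on N k (U : set 'rV[R]_N) f g : open U ->
  (forall x, U x -> f x = g x) -> Ck k U f -> Ck k U g.
Proof.
move=> oU; elim: k f g => [|k IH] f g fg [cf pf].
  by split=> // x Ux; exact: continuous_eq_on fg Ux (cf x Ux).
have [df {}pf] := pf; split; last split.
- by move=> x Ux; exact: continuous_eq_on fg Ux (cf x Ux).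
- move=> x Ux i; apply: (@near_eq_derivable _ _ _ f); last exact: df.
  by near=> y; apply: fg; near: y; exact: open_nbhs_nbhs.
- move=> i; apply: IH (pf i); exact: pd_eq_on.
Unshelve. all: by end_near. Qed.

Lemma Ck_cst N k (U : set 'rV[R]_N) (c : R) : Ck k U (fun=> c).
Proof.
elim: k c => [|k IH] c; split=> //=; try by move=> x _; exact: cst_continuous.
split=> [x _ i|i]; first exact: derivable_cst.
rewrite (_ : pd i _ = fun=> 0); first exact: IH.
by apply/funext => x; exact: derive_cst.
Qed.

Lemma Ck_lin N k (U : set 'rV[R]_N) (a b : R) f g : open U ->
  Ck k U f -> Ck k U g -> Ck k U (fun x => a * f x + b * g x).
Proof.
move=> oU; elim: k f g => [|k IH] f g [cf pf] [cg pg].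
  split=> // x Ux.
  exact: (cvgD (cvgM (cvg_cst a) (cf x Ux)) (cvgM (cvg_cst b) (cg x Ux))).
have [df {}pf] := pf; have [dg {}pg] := pg; split; last split.
- move=> x Ux.
  exact: (cvgD (cvgM (cvg_cst a) (cf x Ux)) (cvgM (cvg_cst b) (cg x Ux))).
- move=> x Ux i.
  exact: (derivableD (derivableZ (k:=a) (df x Ux i)) (derivableZ (k:=b) (dg x Ux i))).
- move=> i; apply: Ck_eq_on (IH _ _ (pf i) (pg i)) => // x Ux.
  rewrite /pd -[RHS]/('D_('e_i) (a *: f + b *: g) x).
  by rewrite (deriveD (derivableZ (k:=a) (df x Ux i)) (derivableZ (k:=b) (dg x Ux i))) !deriveZ//; [exact: dg|exact: df].
Qed.

Lemma pdM N (f g : 'rV[R]_N -> R) x i :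
  derivable f x 'e_i -> derivable g x 'e_i ->
  pd i (fun x => f x * g x) x = f x * pd i g x + g x * pd i f x.
Proof. by move=> df dg; exact: (deriveM df dg). Qed.

Lemma Ck_M N k (U : set 'rV[R]_N) f g : open U ->
  Ck k U f -> Ck k U g -> Ck k U (fun x => f x * g x).
Proof.
move=> oU; elim: k f g => [|k IH] f g Cf Cg.
  split=> // x Ux; exact: (cvgM (Cf.1 x Ux) (Cg.1 x Ux)).
have [cf [df pf]] := Cf; have [cg [dg pg]] := Cg; split; last split.
- by move=> x Ux; exact: (cvgM (cf x Ux) (cg x Ux)).
- by move=> x Ux i; exact: (derivableM (df x Ux i) (dg x Ux i)).
- move=> i.
  have := Ck_lin 1 1 oU (IH _ _ (CkS Cf) (pg i)) (IH _ _ (CkS Cg) (pf i)).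
  by apply: Ck_eq_on => // x Ux; rewrite pdM ?mul1r//; [exact: df|exact: dg].
Qed.

Lemma Ck_V N k (U : set 'rV[R]_N) f : open U -> (forall x, U x -> f x != 0) ->
  Ck k U f -> Ck k U (fun x => (f x)^-1).
Proof.
move=> oU f0; elim: k => [|k IH] Cf.
  by split=> // x Ux; apply: cvgV (Cf.1 x Ux); exact: f0.
have [cf [df pf]] := Cf; split; last split.
- by move=> x Ux; apply: cvgV (cf x Ux); exact: f0.
- by move=> x Ux i; apply: derivableV (df x Ux i); exact: f0.
- move=> i; have IV := IH (CkS Cf).
  have := Ck_lin (-1) 0 oU (Ck_M oU (Ck_M oU IV IV) (pf i)) (Ck_cst k U 0).
  apply: Ck_eq_on => // x Ux.
  rewrite /pd deriveV ?f0//; last exact: df.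
  by rewrite mul0r addr0 mulN1r expr2 invfM scaleNr.
Qed.

(** Covers restrictions to coordinate slices, coordinate projections and
    dilations: each basis direction is sent to zero or to a multiple of a basis
    direction, so partial derivatives go to partial derivatives. *)
Lemma Ck_comp N M k (L : 'rV[R]_M -> 'rV[R]_N) (U : set 'rV[R]_N)
    (W : set 'rV[R]_M) f :
  open U -> open W -> (forall x, W x -> U (L x)) -> continuous L ->
  (forall i, (forall x (h : R), L (h *: 'e_i + x) = L x) \/
     exists j c, forall x (h : R), L (h *: 'e_i + x) = h * c *: 'e_j + L x) ->
  Ck k U f -> Ck k W (fun x => f (L x)).
Proof.
move=> oU oW WU cL hL; elim: k f => [|k IH] f Cf.
  by split=> // x Wx; apply: continuous_comp; [exact: cL|apply: Cf.1; exact: WU].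
have [cf [df pf]] := Cf; split; last split.
- by move=> x Wx; apply: continuous_comp; [exact: cL|apply: cf; exact: WU].
- move=> x Wx i; have [h|[j [c h]]] := hL i.
    by have [] := is_derive_comp_invariant f (h x).
  by have [] := is_derive_comp_affine (h x) (derivableP (df _ (WU x Wx) j)).
- move=> i; have [h|[j [c h]]] := hL i.
    apply: Ck_eq_on (Ck_cst k W 0) => // x Wx.
    by have [_] := is_derive_comp_invariant f (h x) => <-.
  have := Ck_lin c 0 oW (IH _ (pf j)) (Ck_cst k W 0).
  apply: Ck_eq_on => // x Wx.
  have [_] := is_derive_comp_affine (h x) (derivableP (df _ (WU x Wx) j)).
  by rewrite mul0r addr0 => <-.
Qed.

(** [G] lists the successive derivatives of the one-variable function
    [G 0]. *)
Lemma Ck_coord N k (G : nat -> R -> R) (j : 'I_N) (c b : R) :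
  (forall l (t : R), is_derive t 1 (G l) (G l.+1 t)) ->
  forall l, Ck k setT (fun x : 'rV[R]_N => G l (c * x 0 j + b)).
Proof.
move=> dG.
have cG l : continuous (fun x : 'rV[R]_N => G l (c * x 0 j + b)).
  move=> x; apply: (@continuous_comp _ _ _ (fun x : 'rV[R]_N => c * x 0 j + b) (G l)).
    exact: (cvgD (cvgM (cvg_cst c) (@coord_continuous _ _ _ 0 j x)) (cvg_cst b)).
  by apply/differentiable_continuous/derivable1_diffP; case: (dG l (c * x 0 j + b)).
elim: k => [|k IH] l; first by split=> // x _; exact: cG.
have dd x i := is_derive_coord i (dG l (c * (x : 'rV[R]_N) 0 j + b)).
split; last split.
- by move=> x _; exact: cG.
- by move=> x _ i; case: (dd x i).
- move=> i; have := Ck_lin (c * (i == j)%:R) 0 openT (IH l.+1) (Ck_cst k setT 0).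
  apply: Ck_eq_on; first exact: openT.
  by move=> x _; case: (dd x i) => _; rewrite mul0r addr0 => <-.
Qed.

End Smoothness.

(** * Bump functions *)

Section FlatFunction.
Variable R : realType.
Implicit Types (P : {poly R}) (t s : R).

(** [P(1/t) exp(-1/t)] for [t > 0], extended by zero: the functions that occur as
    derivatives of [exp(-1/t)]. *)
Definition flat P t : R := if 0 < t then P.[t^-1] * expR (- t^-1) else 0.

Lemma horner_bound P s : 1 <= s ->
  `|P.[s]| <= (\sum_(i < size P) `|P`_i|) * s ^+ size P.
Proof.
move=> s1; have s0 : 0 <= s by lra.
rewrite horner_coef mulr_suml; apply: le_trans (ler_norm_sum _ _ _) _.
apply: ler_sum => i _; rewrite normrM normrX (ger0_norm s0).
by apply: ler_wpM2l => //; apply: ler_weXn2l => //; exact: ltnW.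
Qed.

(** With [s = 1/t], [exp s] exceeds [s ^+ n.+2 / n.+2!] while [P(s)] is at most a
    multiple of [s ^+ n] for [n = size P], which leaves a factor [t ^+ 2]. *)
Lemma flat_bound P : exists2 C : R, 0 <= C &
  forall t, 0 < t -> t <= 1 -> `|flat P t| <= C * t ^+ 2.
Proof.
pose n := size P; pose A := \sum_(i < n) `|P`_i|.
have A0 : 0 <= A by apply: sumr_ge0.
exists (A * (n.+2)`!%:R) => [|t t0 t1]; first by rewrite mulr_ge0.
have s1 : 1 <= t^-1 by rewrite invf_ge1.
have s0 : 0 < t^-1 by rewrite invr_gt0.
rewrite /flat t0 normrM (ger0_norm (expR_ge0 _)) expRN.
have e1 : (t^-1) ^+ n.+2 / n.+2`!%:R <= expR (t^-1).
  by apply: le_trans (expR_ge1Dxn n.+1 (ltW s0)); rewrite lerDr.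
have f0 : 0 < n.+2`!%:R :> R by rewrite ltr0n fact_gt0.
have e2 : (expR t^-1)^-1 <= n.+2`!%:R * t ^+ n.+2.
  have h0 : 0 < n.+2`!%:R * t ^+ n.+2 by rewrite mulr_gt0// exprn_gt0.
  rewrite -[leRHS]invrK lef_pV2 ?posrE ?expR_gt0 ?invr_gt0//.
  by rewrite invfM mulrC -exprVn.
have hb := horner_bound P s1; rewrite -/n -/A in hb.
apply: (@le_trans _ _ ((A * t^-1 ^+ n) * (n.+2`!%:R * t ^+ n.+2))).
  by apply: ler_pM => //; rewrite invr_ge0 expR_ge0.
move: (n.+2`!%:R) => F; rewrite -(addn2 n) exprD exprVn.
have tn0 : t ^+ n != 0 by rewrite expf_neq0// gt_eqF.
by rewrite mulrACA -!mulrA mulKf// mulrA.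
Qed.

(** The derivative is again of the same form.  At [0] the difference quotient
    tends to zero by [flat_bound]. *)
Lemma is_derive_flat P t :
  is_derive t 1 (flat P) (flat ('X^2 * (P - P^`())) t).
Proof.
have [t0|t0|<-] := ltgtP 0 t.
- have Dv : is_derive t 1 (fun s => s^-1) (- t ^- 2).
    have := @is_deriveV R id t 1 1 (lt0r_neq0 t0) (is_derive_id _ _).
    by rewrite -[_%:A]/(- t ^- 2 * 1) mulr1.
  have DN : is_derive t 1 (fun s => - s^-1) (t ^- 2).
    by rewrite -[t ^- 2]opprK; exact: is_deriveN.
  have DE : is_derive t 1 (fun s => expR (- s^-1)) (expR (- t^-1) * t ^- 2).
    exact: (@is_derive1_comp _ expR (fun s => - s^-1)).
  have DP : is_derive t 1 (fun s => P.[s^-1]) (P^`().[t^-1] * - t ^- 2).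
    exact: (@is_derive1_comp _ (horner P) (fun s => s^-1)).
  apply: (@near_eq_is_derive _ _ _ (fun s => P.[s^-1] * expR (- s^-1))).
  - by near=> s; rewrite /flat ifT//; near: s; exact: lt_nbhsr.
  - apply: (is_derive_eq (is_deriveM DP DE)).
    rewrite /flat t0 hornerM hornerXn hornerD hornerN exprVn.
    rewrite -[_ *: (expR _ * _)]/(_ * _) -[_ *: (_ * - _)]/(_ * _).
    by ring.
- have -> : flat ('X^2 * (P - P^`())) t = 0 by rewrite /flat ltNge (ltW t0).
  have h : \near t, cst 0 t = flat P t.
    by near=> s; rewrite /flat ltNge ltW//; near: s; exact: lt_nbhsl.
  exact: (near_eq_is_derive h (is_derive_cst _ _ _)).
- have -> : flat ('X^2 * (P - P^`())) 0 = 0 by rewrite /flat ltxx.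
  have [C C0 hC] := flat_bound P.
  suff h : (fun h : R => h^-1 *: ((flat P \o shift 0) (h *: (1 : R)) - flat P 0)) @ 0^' --> (0 : R).
    by split; [apply/cvg_ex; exists 0|exact: cvg_lim h].
  apply/cvgr0Pnorm_le => e e0.
  have e1 : 0 < Num.min 1 (e / (C + 1)).
    by rewrite lt_min ltr01 divr_gt0// ltr_wpDl.
  near=> h.
  have : `|h| <= Num.min 1 (e / (C + 1)) by near: h; exact: dnbhs0_le.
  rewrite le_min => /andP[h1 he].
  rewrite /= addr0 -[h *: 1]/(h * 1) mulr1 {2}/flat ltxx subr0 normrM normfV.
  have [h0|h0] := ltP 0 h; last first.
    by rewrite /flat ltNge h0 /= normr0 mulr0 ltW.
  rewrite (gtr0_norm h0) in h1 he *.
  apply: (@le_trans _ _ (h^-1 * (C * h ^+ 2))).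
    by rewrite ler_wpM2l ?invr_ge0 ?(ltW h0)// hC.
  rewrite expr2 mulrCA mulKf ?gt_eqF//.
  apply: (@le_trans _ _ ((C + 1) * h)); first by rewrite ler_wpM2r ?(ltW h0)// lerDl.
  by rewrite -ler_pdivlMl ?ltr_wpDl// mulrC.
Unshelve. all: by end_near. Qed.

Lemma smooth_family_flat : exists G : nat -> R -> R,
  [/\ (forall l (t : R), is_derive t 1 (G l) (G l.+1 t)),
      (forall t, t <= 0 -> G 0%N t = 0) & (forall t, 0 < t -> 0 < G 0%N t)].
Proof.
pose Q := fix Q l : {poly R} :=
  if l is l'.+1 then 'X^2 * (Q l' - (Q l')^`()) else 1.
exists (fun l => flat (Q l)); split=> [l t|t t0|t t0].
- exact: is_derive_flat.
- by rewrite /flat ltNge t0.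
- by rewrite /flat t0 hornerC mul1r expR_gt0.
Qed.

End FlatFunction.

Section Bumps.
Variable R : realType.

Lemma rV_norm_lt n (x : 'rV[R]_n) (c : R) : 0 < c ->
  (forall j, `|x 0 j| < c) -> `|x| < c.
Proof.
move=> c0 h; rewrite [`|x|]mx_normrE; apply/bigmax_ltP; split => // -[i j] _ /=.
by rewrite (ord1 i).
Qed.

Lemma Ck_prod N k (I : Type) (r : seq I) (F : I -> 'rV[R]_N -> R) :
  (forall i, Ck k setT (F i)) -> Ck k setT (fun x => \prod_(i <- r) F i x).
Proof.
move=> h; elim: r => [|i r IH].
  rewrite (_ : (fun x => _) = fun=> 1); first exact: Ck_cst.
  by apply/funext => x; rewrite big_nil.
rewrite (_ : (fun x => _) = fun x => F i x * \prod_(j <- r) F j x).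
  by apply: Ck_M => //; exact: openT.
by apply/funext => x; rewrite big_cons.
Qed.

(** With [g] flat at zero and positive after it, take
    [g(s) / (g(s) + g(r - s))] for [s = c x_j + b]. *)
Lemma coord_step N (j : 'I_N) (c b r : R) : 0 < r ->
  exists f : 'rV[R]_N -> R, [/\ (forall k, Ck k setT f), (forall x, 0 <= f x),
    (forall x : 'rV[R]_N, c * x 0 j + b <= 0 -> f x = 0) &
    (forall x : 'rV[R]_N, r <= c * x 0 j + b -> f x = 1)].
Proof.
move=> r0; have [G [dG G0 Gp]] := smooth_family_flat R.
have Gge0 t : 0 <= G 0%N t by have [/G0 ->//|/Gp/ltW] := leP t 0.
pose p (x : 'rV[R]_N) := G 0%N (c * x 0 j + b).
pose q (x : 'rV[R]_N) := G 0%N ((- c) * x 0 j + (r - b)).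
have qE x : q x = G 0%N (r - (c * x 0 j + b)) by congr (G 0%N _); ring.
have pq0 x : 0 < p x + q x.
  rewrite qE; have [h|h] := ltP 0 (c * x 0 j + b).
    by apply: ltr_wpDr; [exact: Gge0|exact: Gp].
  by apply: ltr_wpDl; [exact: Gge0|apply: Gp; lra].
exists (fun x => p x * (1 * p x + 1 * q x)^-1); split.
- move=> k; have sp : Ck k setT p by exact: Ck_coord.
  have sq : Ck k setT q by exact: Ck_coord.
  apply: Ck_M => //; first exact: openT.
  apply: Ck_V; [exact: openT| |by apply: Ck_lin => //; exact: openT].
  by move=> x _; rewrite !mul1r gt_eqF.
- by move=> x; rewrite mulr_ge0 ?invr_ge0 ?mul1r ?(ltW (pq0 x))//; exact: Gge0.
- by move=> x /G0 h; rewrite /p h mul0r.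
- move=> x h; have -> : q x = 0 by rewrite qE; apply: G0; lra.
  rewrite mulr0 addr0 mul1r mulfV// gt_eqF//; apply: Gp; lra.
Qed.

(** Balls of the sup norm are boxes: take the product over the coordinates of
    two steps, one for each end of the interval. *)
Lemma ball_bump N (a : 'rV[R]_N) (d e : R) : 0 < d -> d < e ->
  exists f : 'rV[R]_N -> R, [/\ (forall k, Ck k setT f), (forall x, 0 <= f x),
    (forall x, `|x - a| <= d -> f x = 1) & (forall x, e <= `|x - a| -> f x = 0)].
Proof.
move=> d0 de; have ed : 0 < e - d by lra.
have /choice[F hF] : forall j : 'I_N, exists f : 'rV[R]_N -> R,
    [/\ (forall k, Ck k setT f), (forall x, 0 <= f x),
    (forall x : 'rV[R]_N, `|x 0 j - a 0 j| <= d -> f x = 1) &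
    (forall x : 'rV[R]_N, e <= `|x 0 j - a 0 j| -> f x = 0)].
  move=> j.
  have [f [sf f0 f1 f2]] := coord_step j 1 (e - a 0 j) ed.
  have [g [sg g0 g1 g2]] := coord_step j (-1) (e + a 0 j) ed.
  exists (fun x => f x * g x); split.
  - by move=> k; apply: Ck_M => //; exact: openT.
  - by move=> x; rewrite mulr_ge0.
  - move=> x; rewrite ler_norml => /andP[h1 h2]; rewrite f2 ?g2 ?mulr1//; lra.
  - move=> x; rewrite ler_normr => /orP[h|h].
      by rewrite g1 ?mulr0//; lra.
    by rewrite f1 ?mul0r//; lra.
exists (fun x => \prod_(j < N) F j x); split.
- by move=> k; apply: Ck_prod => j; case: (hF j).
- by move=> x; apply: prodr_ge0 => j _; case: (hF j).
- move=> x xd; rewrite big1// => j _; have [_ _ + _] := hF j; apply.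
  have := coord_norm_le (x - a) j; rewrite !mxE => h; exact: le_trans h xd.
- move=> x xe.
  have [j hj] : exists j, e <= `|x 0 j - a 0 j|.
    apply: contrapT => /forallNP h; move: xe; rewrite leNgt => /negP; apply.
    apply: rV_norm_lt => [|j]; first lra.
    by rewrite !mxE ltNge; apply/negP; exact: h.
  by have [_ _ _ /(_ _ hj) h] := hF j; rewrite (bigD1 j)//= h mul0r.
Qed.

End Bumps.

(** * Complex-valued smooth functions and test functions *)

Local Open Scope complex_scope.

Section ComplexSmooth.
Variable R : realType.

Lemma smooth_onP N (U : set 'rV[R]_N) (f : 'rV[R]_N -> R[i]^o) :
  smooth_on U f <->
  (forall k, Ck k U (re_part f)) /\ (forall k, Ck k U (im_part f)).
Proof. by split=> -[h1 h2]; split; apply/rsmooth_onP. Qed.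

Lemma smooth_on_eq N (U : set 'rV[R]_N) (f g : 'rV[R]_N -> R[i]^o) : open U ->
  (forall x, U x -> f x = g x) -> smooth_on U f -> smooth_on U g.
Proof.
move=> oU fg /smooth_onP[h1 h2]; apply/smooth_onP.
by split=> k; [apply: Ck_eq_on (h1 k)|apply: Ck_eq_on (h2 k)] => // x Ux;
  rewrite /re_part /im_part fg.
Qed.

Lemma smooth_on_sub N (U W : set 'rV[R]_N) (f : 'rV[R]_N -> R[i]^o) : W `<=` U ->
  smooth_on U f -> smooth_on W f.
Proof. by move=> WU [h1 h2]; split=> s x /WU; [exact: h1|exact: h2]. Qed.

(** Smoothness at a point is tested on the global function near that point, so
    it is local. *)
Lemma smooth_on_cover N (U : set 'rV[R]_N) (f : 'rV[R]_N -> R[i]^o) :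
  (forall x, U x -> exists2 W, W x & smooth_on W f) -> smooth_on U f.
Proof.
by move=> h; split=> s x Ux; have [W Wx [h1 h2]] := h x Ux; [exact: h1|exact: h2].
Qed.

Lemma smooth_on_real N (U : set 'rV[R]_N) (f : 'rV[R]_N -> R) :
  (forall k, Ck k U f) -> smooth_on U (fun x => (f x)%:C : R[i]^o).
Proof.
by move=> h; apply/smooth_onP; split=> k; [exact: h|exact: Ck_cst].
Qed.

Lemma smooth_on_cst N (U : set 'rV[R]_N) (c : R[i]) :
  smooth_on U (fun=> c : R[i]^o).
Proof. by apply/smooth_onP; split=> k; exact: Ck_cst. Qed.

Lemma re_partM N (f g : 'rV[R]_N -> R[i]^o) : re_part (fun x => f x * g x) =
  fun x => 1 * (re_part f x * re_part g x) + (-1) * (im_part f x * im_part g x).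
Proof.
apply/funext => x; rewrite /re_part /im_part.
by case: (f x) (g x) => [a b] [c d] /=; rewrite mul1r mulN1r.
Qed.

Lemma im_partM N (f g : 'rV[R]_N -> R[i]^o) : im_part (fun x => f x * g x) =
  fun x => 1 * (re_part f x * im_part g x) + 1 * (im_part f x * re_part g x).
Proof.
apply/funext => x; rewrite /re_part /im_part.
by case: (f x) (g x) => [a b] [c d] /=; rewrite !mul1r.
Qed.

Lemma smooth_on_M N (U : set 'rV[R]_N) (f g : 'rV[R]_N -> R[i]^o) : open U ->
  smooth_on U f -> smooth_on U g -> smooth_on U (fun x => f x * g x).
Proof.
move=> oU /smooth_onP[f1 f2] /smooth_onP[g1 g2]; apply/smooth_onP.
by rewrite re_partM im_partM; split=> k; apply: Ck_lin => //; apply: Ck_M.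
Qed.

Lemma smooth_on_comp N M (L : 'rV[R]_M -> 'rV[R]_N) (U : set 'rV[R]_N)
    (W : set 'rV[R]_M) (f : 'rV[R]_N -> R[i]^o) :
  open U -> open W -> (forall x, W x -> U (L x)) -> continuous L ->
  (forall i, (forall x (h : R), L (h *: 'e_i + x) = L x) \/
     exists j c, forall x (h : R), L (h *: 'e_i + x) = h * c *: 'e_j + L x) ->
  smooth_on U f -> smooth_on W (fun x => f (L x)).
Proof.
move=> oU oW WU cL hL /smooth_onP[f1 f2]; apply/smooth_onP.
by split=> k; [exact: Ck_comp (f1 k)|exact: Ck_comp (f2 k)].
Qed.

(** Continuity through real and imaginary parts, the form in which iterated
    integrals of complex functions use it. *)
Definition ccont (T : topologicalType) (f : T -> R[i]^o) :=
  continuous (fun x => complex.Re (f x)) /\ continuous (fun x => complex.Im (f x)).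

Lemma smooth_ccont N (f : 'rV[R]_N -> R[i]^o) : smooth_on setT f -> ccont f.
Proof. by move=> [h1 h2]; split=> x; [exact: (h1 [::] x I).1|exact: (h2 [::] x I).1]. Qed.

Lemma ccontM (T : topologicalType) (f g : T -> R[i]^o) :
  ccont f -> ccont g -> ccont (fun x => f x * g x).
Proof.
move=> [f1 f2] [g1 g2]; split=> x.
  rewrite (_ : (fun x => _) = fun x => complex.Re (f x) * complex.Re (g x) -
    complex.Im (f x) * complex.Im (g x)).
    exact: (cvgB (cvgM (f1 x) (g1 x)) (cvgM (f2 x) (g2 x))).
  by apply/funext => y; case: (f y) (g y) => [a b] [c d].
rewrite (_ : (fun x => _) = fun x => complex.Re (f x) * complex.Im (g x) +
  complex.Im (f x) * complex.Re (g x)).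
  exact: (cvgD (cvgM (f1 x) (g2 x)) (cvgM (f2 x) (g1 x))).
by apply/funext => y; case: (f y) (g y) => [a b] [c d].
Qed.

Lemma ccont_comp (T W : topologicalType) (L : T -> W) (f : W -> R[i]^o) :
  continuous L -> ccont f -> ccont (fun x => f (L x)).
Proof.
move=> cL [f1 f2]; split.
  exact: (@comp_continuous _ _ _ L (fun x => complex.Re (f x))).
exact: (@comp_continuous _ _ _ L (fun x => complex.Im (f x))).
Qed.

End ComplexSmooth.

Section Supports.
Variables (R : realType) (N : nat).
Local Notation V := 'rV[R]_N.
Implicit Types (f g : V -> R[i]^o) (p q : testfun R N).

Lemma fsupp_out f x : ~ fsupp f x -> f x = 0.
Proof. by move=> fx; apply: contra_notP fx => /eqP fx; exact: subset_closure. Qed.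

Lemma closed_fsupp f : closed (fsupp f).
Proof. exact: closed_closure. Qed.

Lemma fsupp_subset (C : set V) f : closed C -> (forall x, ~ C x -> f x = 0) ->
  fsupp f `<=` C.
Proof.
move=> cC fC; have -> : C = closure C by apply/closure_id.
apply: closure_subset => x /= /eqP fx; exact: contra_notP (fC x) fx.
Qed.

Lemma fsuppM f g : fsupp (fun x => f x * g x) `<=` fsupp f `&` fsupp g.
Proof.
apply: fsupp_subset; first exact: closedI (@closed_fsupp f) (@closed_fsupp g).
by move=> x /not_andP[/fsupp_out ->|/fsupp_out ->]; rewrite ?mul0r ?mulr0.
Qed.

Lemma fsuppD f g : fsupp (f + g) `<=` fsupp f `|` fsupp g.
Proof.
apply: fsupp_subset; first exact: closedU (@closed_fsupp f) (@closed_fsupp g).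
move=> x /not_orP[/fsupp_out h1 /fsupp_out h2].
by rewrite -[LHS]/(f x + g x) h1 h2 addr0.
Qed.

Lemma test_is p : is_test p.
Proof. by have /asboolP := testfunP p. Qed.

Lemma test_smooth p : smooth_on setT p. Proof. exact: (test_is p).1. Qed.

Lemma test_compact p : compact (fsupp p). Proof. exact: (test_is p).2. Qed.

Lemma to_testE f : is_test f -> to_test f = f :> (V -> R[i]^o).
Proof. by move=> tf; rewrite /to_test /insubd insubT //=; exact/asboolP. Qed.

Lemma to_test_ext p f : (forall x, f x = p x) -> to_test f = p.
Proof.
move=> h; apply: val_inj; have -> : f = p by apply/funext.
by rewrite /= to_testE//; exact: test_is.
Qed.

Lemma test_ext p q : (forall x, p x = q x) -> p = q.
Proof. by move=> h; apply: val_inj; apply/funext. Qed.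

(** Near a point outside [fsupp p] the product vanishes identically, whatever
    [f] does there. *)
Lemma is_test_mul (U : set V) f p : open U -> smooth_on U f -> fsupp p `<=` U ->
  is_test (fun x => f x * p x).
Proof.
move=> oU sf pU; split; last first.
  apply: (@subclosed_compact _ _ (fsupp p)); first exact: closed_fsupp.
    exact: test_compact.
  by move=> x /fsuppM[].
apply: smooth_on_cover => x _.
have [px|px] := pselect (fsupp p x).
  exists U; first exact: pU.
  apply: (smooth_on_M oU sf).
  exact: (smooth_on_sub (@subsetT _ U) (test_smooth p)).
have oC : open (~` fsupp p) by apply: closed_openC; exact: closed_fsupp.
exists (~` fsupp p) => //; apply: (@smooth_on_eq _ _ _ (fun=> 0)) => //.
  by move=> y /fsupp_out ->; rewrite mulr0.
exact: smooth_on_cst.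
Qed.

Lemma is_test_smul f p : smooth_on setT f -> is_test (fun x => f x * p x).
Proof. by move=> sf; apply: (is_test_mul openT sf). Qed.

(** Meaningful when the product is a test function: for [f] smooth everywhere,
    or on an open set that contains [fsupp p]. *)
Definition tmul f p : testfun R N := to_test (fun x => f x * p x).

Lemma tmulE f p : smooth_on setT f -> tmul f p = (fun x => f x * p x) :> (V -> _).
Proof. by move=> sf; apply: to_testE; exact: is_test_smul. Qed.

Lemma tmul_onE (U : set V) f p : open U -> smooth_on U f -> fsupp p `<=` U ->
  tmul f p = (fun x => f x * p x) :> (V -> _).
Proof. by move=> oU sf pU; apply: to_testE; exact: is_test_mul pU. Qed.

Lemma tmulP f p x : smooth_on setT f -> tmul f p x = f x * p x.
Proof. by move=> sf; rewrite (tmulE p sf). Qed.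

Lemma tmul_testP (t p : testfun R N) x : tmul t p x = t x * p x.
Proof. exact: (tmulP p x (test_smooth t)). Qed.

End Supports.

(** * Cutoffs and partitions of unity *)

(** A property of sets that passes to subsets and finite unions and holds near
    each point of a compact set holds for that set, by a finite subcover. *)
Lemma compact_ind (T : ptopologicalType) (P : set T -> Prop) (K : set T) :
  compact K -> P set0 -> (forall A B, P A -> P B -> P (A `|` B)) ->
  (forall A B, A `<=` B -> P B -> P A) ->
  (forall x, K x -> exists W, [/\ open W, W x & P W]) -> P K.
Proof.
rewrite compact_cover => cK P0 PU PS hW.
have /choice[W hW'] : forall x, exists W, K x -> [/\ open W, W x & P W].
  move=> x; have [/hW[W h]|nK] := pselect (K x); first by exists W.
  by exists setT.
have [D DK KD] : finite_subset_cover K W K.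
  apply: cK => [x /hW'[]//|x Kx]; exists x => //; by have [] := hW' x Kx.
apply: (PS _ _ KD) => {KD}.
have : forall x, x \in finmap.enum_fset D -> K x by move=> x /DK; rewrite inE.
rewrite (_ : cover _ _ = \bigcup_(x in [set` finmap.enum_fset D]) W x)//.
elim: (finmap.enum_fset D) => [_|x s IH sK]; first by apply: (PS _ _ _ P0) => y [z /=]; rewrite inE.
apply: (PS _ (W x `|` \bigcup_(x in [set` s]) W x)).
  move=> y [z /=]; rewrite inE => /predU1P[->|zs] Wy; [by left|by right; exists z].
apply: PU; first by have [] := hW' x (sK x (mem_head _ _)).
by apply: IH => y ys; apply: sK; rewrite inE ys orbT.
Qed.

Section Localisation.
Variables (R : realType) (N : nat).
Local Notation V := 'rV[R]_N.
Implicit Types (p q : testfun R N).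

Lemma bump_at (U : set V) x : open U -> U x ->
  exists (r : R) (p : testfun R N), [/\ 0 < r, fsupp p `<=` U,
    (forall y, `|y - x| < r -> p y = 1) &
    exists f : V -> R, (forall y, 0 <= f y) /\ forall y, p y = (f y)%:C].
Proof.
move=> oU Ux.
have /nbhs_ballP[e /= e0 he] : nbhs x U by exact: open_nbhs_nbhs.
have d1 : 0 < e / 3 by rewrite divr_gt0.
have d2 : e / 3 < e / 2 by lra.
have [f [sf f0 f1 f2]] := ball_bump x d1 d2.
have supp : fsupp (fun y => (f y)%:C : R[i]^o) `<=` [set y | `|y - x| <= e / 2].
  apply: fsupp_subset; last first.
    by move=> y /= /negP; rewrite -ltNge => /ltW/f2 ->.
  have cn : {in ~` ((fun y : V => `|y - x|) @^-1` [set r : R | r <= e / 2]),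
      continuous (fun y : V => `|y - x|)}.
    move=> y _; apply: (@continuous_comp _ _ _ (fun y : V => y - x) (fun z => `|z|)).
      exact: (cvgB cvg_id (cvg_cst x)).
    exact: norm_continuous.
  exact: (preimage_closed cn (@closed_le _ (e / 2))).
have tf : is_test (fun y => (f y)%:C : R[i]^o).
  split; first exact: smooth_on_real.
  apply: (@subclosed_compact _ _ [set y | `|y| <= `|x| + e / 2]).
  - exact: closed_fsupp.
  - exact: rV_ball_compact.
  - move=> y /supp /= h; rewrite -(subrK x y) addrC.
    by apply: le_trans (ler_normD _ _) _; rewrite lerD2l.
exists (e / 3), (to_test (fun y => (f y)%:C)); split=> //.
- rewrite to_testE//; apply: subset_trans supp _ => y /= h.
  by apply: he; rewrite -ball_normE /= distrC (le_lt_trans h)//; lra.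
- by move=> y h; rewrite to_testE// f1// ltW.
- by exists f; split=> // y; rewrite to_testE.
Qed.

Lemma open_norm_ball (x : V) (r : R) : open [set y : V | `|y - x| < r].
Proof.
have [r0|r0] := ltP 0 r.
  have -> : [set y : V | `|y - x| < r] = ball x r.
    by rewrite -ball_normE; apply/seteqP; split=> y /=; rewrite distrC.
  exact: ball_open.
rewrite (_ : mkset _ = set0); first exact: open0.
by apply/seteqP; split=> y //= h; have := le_lt_trans (normr_ge0 _) h; rewrite ltNge r0.
Qed.

Lemma testD_val p q x : (p + q) x = p x + q x.
Proof. by []. Qed.

Lemma testN_val p x : (- p) x = - p x.
Proof. by []. Qed.

Lemma testB_val p q x : (p - q) x = p x - q x.
Proof. by []. Qed.

Lemma testZD_val (c : R[i]) p q x : (c *: p + q) x = c * p x + q x.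
Proof. by []. Qed.

Lemma fsupp_test0 (U : set V) : fsupp (0 : testfun R N) `<=` U.
Proof.
apply: (@subset_trans _ set0) => //.
by apply: fsupp_subset; first exact: closed0.
Qed.

(** Two cutoffs [p] and [q] combine to [1 - (1 - p)(1 - q)], which is 1 where
    either of them is. *)
Lemma cutoff (C U : set V) : compact C -> open U -> C `<=` U ->
  exists p : testfun R N, [/\ fsupp p `<=` U &
    exists2 G : set V, open G /\ C `<=` G & forall x, G x -> p x = 1].
Proof.
move=> cC oU CU.
apply: (@compact_ind _ (fun C => exists p : testfun R N, [/\ fsupp p `<=` U &
    exists2 G : set V, open G /\ C `<=` G & forall x, G x -> p x = 1]) C) => //.
- exists 0; split; first exact: fsupp_test0.
  by exists set0 => //; split=> //; exact: open0.
- move=> A B [p [pU [G [oG AO] hG1]]] [q [qU [G' [oG' BO'] gG1]]].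
  exists (p + q - tmul p q); split.
    have sub : fsupp (p + q - tmul p q) `<=` fsupp p `|` fsupp q.
      apply: fsupp_subset; first exact: closedU (@closed_fsupp _ _ p) (@closed_fsupp _ _ q).
      move=> x /not_orP[/fsupp_out hp /fsupp_out hq].
      rewrite testB_val testD_val tmulE; last exact: test_smooth.
      by rewrite hp hq mulr0 addr0 subr0.
    by move=> x /sub[/pU|/qU].
  exists (G `|` G'); first by split; [exact: openU|exact: setUSS].
  move=> x GGx; rewrite testB_val testD_val tmulE; last exact: test_smooth.
  case: GGx => [/hG1|/gG1] ->; first by rewrite mul1r addrK.
  by rewrite mulr1 addrAC subrr add0r.
- by move=> A B AB [p [pU [G [oG BO] hG1]]]; exists p; split=> //; exists G => //; split=> //; apply: subset_trans BO.
- move=> x Cx; have [r [p [r0 pU p1 _]]] := bump_at oU (CU _ Cx).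
  exists [set y | `|y - x| < r]; split; first exact: open_norm_ball.
    by rewrite /= subrr normr0.
  exists p; split=> //; exists [set y | `|y - x| < r] => //.
  by split=> //; exact: open_norm_ball.
Qed.

(** Partitions of unity, packaged as an induction principle: an additive property
    of test functions that holds for small supports near each point of [U] holds
    for all supports in [U].  The compact sets [A] on which the proof inducts are
    those with a function [t] that is 1 on [A] and such that all multiples of
    [t] have the property. *)
Lemma test_ind (P : testfun R N -> Prop) (U : set V) :
  P 0 -> (forall p q, P p -> P q -> P (p + q)) ->
  (forall x, U x -> exists W, [/\ open W, W x & forall p, fsupp p `<=` W -> P p]) ->
  forall p, fsupp p `<=` U -> P p.
Proof.
move=> P0 PD hP p pU.
suff [t t1 tP] : exists2 t : testfun R N, (forall x, fsupp p x -> t x = 1) &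
    forall q, P (tmul t q).
  have <- : tmul t p = p; last exact: tP.
  apply: test_ext => x; rewrite tmulE; last exact: test_smooth.
  by have [/t1 ->|/fsupp_out ->] := pselect (fsupp p x); rewrite ?mul1r ?mulr0.
apply: (@compact_ind _ (fun A => exists2 t : testfun R N, (forall x, A x -> t x = 1) &
    forall q, P (tmul t q)) (fsupp p)).
- exact: test_compact.
- exists 0 => // q; rewrite (_ : tmul _ q = 0)//; apply: test_ext => x.
  by rewrite tmulE; [rewrite mul0r|exact: test_smooth].
- move=> A B [s s1 sP] [t t1 tP]; exists (s + t - tmul s t).
    move=> x ABx; rewrite testB_val testD_val tmulE; last exact: test_smooth.
    case: ABx => [/s1|/t1] ->; first by rewrite mul1r addrK.
    by rewrite mulr1 addrAC subrr add0r.
  move=> q; have -> : tmul (s + t - tmul s t) q = tmul s q + tmul t (q - tmul s q).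
    apply: test_ext => x; rewrite testD_val !tmulE; try exact: test_smooth.
    rewrite !testB_val testD_val !tmulE; try exact: test_smooth.
    by ring.
  exact: PD.
- by move=> A B AB [t t1 tP]; exists t => // x /AB/t1.
- move=> x /pU/hP[W [oW Wx hW]].
  have [r [t [r0 tW t1 _]]] := bump_at oW Wx.
  exists [set y | `|y - x| < r]; split; first exact: open_norm_ball.
    by rewrite /= subrr normr0.
  exists t => // q; apply: hW; rewrite tmulE; last exact: test_smooth.
  by move=> y /fsuppM[/tW].
Qed.

End Localisation.

(** * The complex integral and the fundamental lemma of the calculus of variations *)

Section ComplexIntegral.
Variable R : realType.

Lemma cplx_eta (z : R[i]) : z = complex.Re z +i* complex.Im z.
Proof. by case: z. Qed.

Lemma normc_Re (z : R[i]) : (`|complex.Re z|)%:C <= `|z|.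
Proof.
rewrite normc_def lecR -sqrtr_sqr ler_wsqrtr//.
by rewrite lerDl sqr_ge0.
Qed.

Lemma normc_Im (z : R[i]) : (`|complex.Im z|)%:C <= `|z|.
Proof.
rewrite normc_def lecR -sqrtr_sqr ler_wsqrtr//.
by rewrite lerDr sqr_ge0.
Qed.

Definition ccs N (f : 'rV[R]_N -> R[i]^o) :=
  ccont f /\ exists2 B : R, 0 <= B & forall x, B < `|x| -> f x = 0.

Lemma ccs_parts N (f : 'rV[R]_N -> R[i]^o) : ccs f ->
  exists2 B : R, 0 <= B & cc B (re_part f) /\ cc B (im_part f).
Proof.
move=> [[c1 c2] [B B0 h]]; exists B => //.
by split; split=> // x Bx; rewrite /re_part /im_part h.
Qed.

Lemma ccs_parts2 N (f g : 'rV[R]_N -> R[i]^o) : ccs f -> ccs g ->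
  exists2 B : R, 0 <= B & [/\ cc B (re_part f), cc B (im_part f),
    cc B (re_part g) & cc B (im_part g)].
Proof.
move=> [[c1 c2] [B B0 h]] [[d1 d2] [B' B'0 h']]; exists (Num.max B B').
  by rewrite le_max B0.
by split; split=> // x; rewrite gt_max /re_part /im_part => /andP[/h hf /h' hg];
  rewrite ?hf ?hg.
Qed.

Lemma ccs_mul N (a f : 'rV[R]_N -> R[i]^o) : ccont a -> ccs f ->
  ccs (fun x => a x * f x).
Proof.
move=> ca [cf [B B0 h]]; split; first exact: ccontM.
by exists B => // x /h ->; rewrite mulr0.
Qed.

Lemma ccs_test N (p : testfun R N) : ccs p.
Proof.
split; first exact/smooth_ccont/test_smooth.
have [B B0 hB] : exists2 M : R, 0 <= M & forall x, fsupp p x -> `|x| <= M.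
  by apply: (compact_ubound (h := id)); [exact: test_compact|move=> x].
exists B => // x Bx; apply: fsupp_out => /hB; by rewrite leNgt Bx.
Qed.

Lemma cintD N (f g : 'rV[R]_N -> R[i]^o) : ccs f -> ccs g ->
  cint (fun x => f x + g x) = cint f + cint g.
Proof.
move=> hf hg; have [B B0 [f1 f2 g1 g2]] := ccs_parts2 hf hg.
rewrite /cint.
have -> : re_part (fun x => f x + g x) = fun x => 1 * re_part f x + 1 * re_part g x.
  by apply/funext => x; rewrite /re_part !mul1r; case: (f x) (g x) => [? ?] [].
have -> : im_part (fun x => f x + g x) = fun x => 1 * im_part f x + 1 * im_part g x.
  by apply/funext => x; rewrite /im_part !mul1r; case: (f x) (g x) => [? ?] [].
by rewrite !(rint_lin _ _ B0)// !mul1r.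
Qed.

Lemma cintZ N (a : R[i]) (f : 'rV[R]_N -> R[i]^o) : ccs f ->
  cint (fun x => a * f x) = a * cint f.
Proof.
move=> hf; have [B B0 [f1 f2]] := ccs_parts hf.
rewrite /cint; case: a => a b.
have -> : re_part (fun x => (a +i* b) * f x) = fun x => a * re_part f x + (- b) * im_part f x.
  by apply/funext => x; rewrite /re_part /im_part mulNr; case: (f x).
have -> : im_part (fun x => (a +i* b) * f x) = fun x => a * im_part f x + b * re_part f x.
  by apply/funext => x; rewrite /re_part /im_part; case: (f x).
by rewrite !(rint_lin _ _ B0)// mulNr.
Qed.

Lemma cint_bound N (f : 'rV[R]_N -> R[i]^o) (B M : R) : 0 <= B -> ccont f ->
  (forall x, B < `|x| -> f x = 0) -> (forall x, `|f x| <= M%:C) ->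
  `|cint f| <= (2 * (2 * B) ^+ N * M)%:C.
Proof.
move=> B0 [c1 c2] f0 fM; apply: (le_trans (normc_le _)); rewrite lecR /=.
have -> : 2 * (2 * B) ^+ N * M = M * (2 * B) ^+ N + M * (2 * B) ^+ N by ring.
apply: lerD; apply: rint_bound => //.
- by split=> // x /f0; rewrite /re_part => ->.
- by move=> x; rewrite -lecR; apply: le_trans (fM x); exact: normc_Re.
- by split=> // x /f0; rewrite /im_part => ->.
- by move=> x; rewrite -lecR; apply: le_trans (fM x); exact: normc_Im.
Qed.

Lemma cint_iter n m (f : 'rV[R]_(n + m) -> R[i]^o) :
  cint f = cint (fun x : 'rV[R]_n => cint (fun y : 'rV[R]_m => f (row_mx x y)) : R[i]^o).
Proof. by rewrite /cint !rint_iter. Qed.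

Lemma cint_fubini n m (f : 'rV[R]_(n + m) -> R[i]^o) : ccs f ->
  cint f = cint (fun y : 'rV[R]_m => cint (fun x : 'rV[R]_n => f (row_mx x y)) : R[i]^o).
Proof.
move=> hf; have [B B0 [f1 f2]] := ccs_parts hf.
by rewrite /cint (rint_fubini B0 f1) (rint_fubini B0 f2).
Qed.

Lemma cint_param_ccont (W : topologicalType) N (B : R) (F : W -> 'rV[R]_N -> R[i]^o) :
  0 <= B -> ccont (fun p : W * 'rV[R]_N => F p.1 p.2) ->
  (forall w x, B < `|x| -> F w x = 0) -> ccont (fun w => cint (F w) : R[i]^o).
Proof.
move=> B0 [c1 c2] F0; split.
  apply: (@pcc_rint_continuous _ _ _ B (fun w => re_part (F w))) => //.
  by split=> // w x /F0; rewrite /re_part => ->.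
apply: (@pcc_rint_continuous _ _ _ B (fun w => im_part (F w))) => //.
by split=> // w x /F0; rewrite /im_part => ->.
Qed.

(** Test against a bump supported in the open set where [h] is positive. *)
Lemma rint_orthogonal_le0 N (h : 'rV[R]_N -> R) : continuous h ->
  (forall (p : testfun R N) (f : 'rV[R]_N -> R), (forall x, p x = (f x)%:C) ->
     rint (fun x => h x * f x) = 0) ->
  forall x, h x <= 0.
Proof.
move=> ch h0 x; rewrite leNgt; apply/negP => hx.
have oU : open [set y | 0 < h y].
  by move/continuousP : ch => /(_ _ (@open_gt R 0)).
have [r [p [r0 pU p1 [f [f0 pf]]]]] := bump_at oU hx.
have := h0 p f pf; apply/eqP; rewrite gt_eqF//.
have [[cp _] [B B0 hB]] := ccs_test p.
have pE : f = re_part p by apply/funext => y; rewrite /re_part pf.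
apply: (rint_gt0 (B := B) (x0 := x)) => //.
- split=> [y|y /hB]; last by rewrite pf => -[->]; rewrite mulr0.
  apply: (cvgM (ch y)); rewrite pE; exact: cp.
- move=> y; have [py|/fsupp_out] := pselect (fsupp p y).
    by rewrite mulr_ge0// ltW//; exact: pU.
  by rewrite pf => -[->]; rewrite mulr0.
- have : p x = 1 by apply: p1; rewrite subrr normr0.
  by rewrite pf => -[->]; rewrite mulr1.
Qed.

Lemma rint_orthogonal N (h : 'rV[R]_N -> R) : continuous h ->
  (forall (p : testfun R N) (f : 'rV[R]_N -> R), (forall x, p x = (f x)%:C) ->
     rint (fun x => h x * f x) = 0) ->
  forall x, h x = 0.
Proof.
move=> ch h0 x; apply/eqP; rewrite eq_le rint_orthogonal_le0//=.
rewrite -oppr_le0; apply: (@rint_orthogonal_le0 _ (fun x => - h x)).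
  by move=> y; exact: (cvgN (ch y)).
move=> p f pf; have [B B0 [[c1 c2] _]] := ccs_parts (ccs_test p).
have pE : f = re_part p by apply/funext => y; rewrite /re_part pf.
have hc : cc B (fun x => h x * f x).
  rewrite pE; split=> [y|y /c2 ->]; last by rewrite mulr0.
  exact: (cvgM (ch y) (c1 y)).
rewrite (_ : (fun x => _) = fun x => -1 * (h x * f x) + 0 * (h x * f x)).
  by rewrite (rint_lin _ _ B0)// (h0 p)// !mulr0 addr0.
by apply/funext => y; rewrite mul0r addr0 mulN1r mulNr.
Qed.

(** The fundamental lemma of the calculus of variations; real test functions
    separate the real and imaginary parts. *)
Lemma cint_orthogonal N (a : 'rV[R]_N -> R[i]^o) : ccont a ->
  (forall p : testfun R N, cint (fun x => a x * p x) = 0) -> forall x, a x = 0.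
Proof.
move=> [c1 c2] h x; rewrite [a x]cplx_eta.
have -> : complex.Re (a x) = 0.
  apply: (rint_orthogonal c1) => p f pf; have [+ _] := h p.
  by move=> <-; congr rint; apply/funext => y; rewrite /re_part pf; case: (a y) => ? ? /=; rewrite mulr0 subr0.
have -> : complex.Im (a x) = 0 => //.
apply: (rint_orthogonal c2) => p f pf; have [_] := h p.
by move=> <-; congr rint; apply/funext => y; rewrite /im_part pf; case: (a y) => ? ? /=; rewrite mulr0 add0r.
Qed.

Lemma cint_orthogonal_on N (U : set 'rV[R]_N) (a : 'rV[R]_N -> R[i]^o) : open U ->
  smooth_on U a ->
  (forall p : testfun R N, fsupp p `<=` U -> cint (fun x => a x * p x) = 0) ->
  forall x, U x -> a x = 0.
Proof.
move=> oU sa h x Ux.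
have [r [p [r0 pU p1 _]]] := bump_at oU Ux.
have : tmul a p x = 0.
  apply: cint_orthogonal => [|q]; first exact/smooth_ccont/test_smooth.
  rewrite -[RHS](h (tmul p q)).
    congr cint; apply/funext => y; rewrite (tmul_onE oU)// tmulE; last exact: test_smooth.
    by rewrite mulrA.
  by rewrite tmulE; [move=> y /fsuppM[/pU]|exact: test_smooth].
by rewrite (tmul_onE oU)// p1 ?subrr ?normr0// mulr1.
Qed.

End ComplexIntegral.

(** * Leibniz bounds and the local structure of distributions *)

Section Leibniz.
Variables (R : realType) (N : nat).
Local Notation V := 'rV[R]_N.

Lemma rsmooth_pd (f : V -> R) i : rsmooth_on setT f -> rsmooth_on setT (pd i f).
Proof. by move=> sf s x _; rewrite -rpartial_rcons; exact: sf. Qed.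

Lemma rsmooth_M (f g : V -> R) : rsmooth_on setT f -> rsmooth_on setT g ->
  rsmooth_on setT (fun x => f x * g x).
Proof.
move=> /rsmooth_onP sf /rsmooth_onP sg; apply/rsmooth_onP => k.
by apply: Ck_M => //; exact: openT.
Qed.

(** The bound is pointwise in [x], so that it also serves for weighted norms.
    Each order of derivation doubles the number of terms of the Leibniz rule. *)
Lemma rpartialM_bound k (f g : V -> R) x (A B : R) :
  rsmooth_on setT f -> rsmooth_on setT g ->
  (forall s, (size s <= k)%N -> `|rpartial s f x| <= A) ->
  (forall s, (size s <= k)%N -> `|rpartial s g x| <= B) ->
  forall s, (size s <= k)%N ->
    `|rpartial s (fun x => f x * g x) x| <= 2 ^+ k * (A * B).
Proof.
move=> sf sg fA gB.
have A0 : 0 <= A by apply: le_trans (fA [::] _).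
have B0 : 0 <= B by apply: le_trans (gB [::] _).
elim: k f g sf sg fA gB => [|k IH] f g sf sg fA gB s.
  by rewrite leqn0 size_eq0 => /eqP -> /=; rewrite mul1r normrM ler_pM//;
    [exact: (fA [::])|exact: (gB [::])].
case: (lastP s) => [_ /=|s' i].
  rewrite normrM; apply: (@le_trans _ _ (A * B)).
    by apply: ler_pM => //; [exact: (fA [::])|exact: (gB [::])].
  by rewrite ler_peMl ?mulr_ge0// exprn_ege1// ler1n.
rewrite size_rcons ltnS => sk; rewrite rpartial_rcons.
have sf' := rsmooth_pd i sf; have sg' := rsmooth_pd i sg.
have -> : pd i (fun x => f x * g x) = fun x => 1 * (f x * pd i g x) + 1 * (pd i f x * g x).
  apply/funext => y; rewrite !mul1r [_ * g y]mulrC; apply: pdM.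
    exact: (sf [::] y I).2.
  exact: (sg [::] y I).2.
rewrite (rpartial_lin _ _ _ (rsmooth_M sf sg') (rsmooth_M sf' sg)).
have fA' t : (size t <= k)%N -> `|rpartial t f x| <= A by move=> tk; apply: fA; exact: leqW.
have gB' t : (size t <= k)%N -> `|rpartial t g x| <= B by move=> tk; apply: gB; exact: leqW.
have dfA t : (size t <= k)%N -> `|rpartial t (pd i f) x| <= A.
  by move=> tk; rewrite -rpartial_rcons; apply: fA; rewrite size_rcons.
have dgB t : (size t <= k)%N -> `|rpartial t (pd i g) x| <= B.
  by move=> tk; rewrite -rpartial_rcons; apply: gB; rewrite size_rcons.
have h1 := IH f (pd i g) sf sg' fA' dgB s' sk.
have h2 := IH (pd i f) g sf' sg dfA gB' s' sk.
rewrite !mul1r; apply: le_trans (ler_normD _ _) _.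
have -> : 2 ^+ k.+1 * (A * B) = 2 ^+ k * (A * B) + 2 ^+ k * (A * B) by rewrite exprS; ring.
exact: lerD.
Qed.

Lemma partialM_bound k (f g : V -> R[i]^o) x (A B : R) :
  smooth_on setT f -> smooth_on setT g ->
  (forall s, (size s <= k)%N -> `|partial s f x| <= A%:C) ->
  (forall s, (size s <= k)%N -> `|partial s g x| <= B%:C) ->
  forall s, (size s <= k)%N ->
    `|partial s (fun x => f x * g x) x| <= (4 * 2 ^+ k * (A * B))%:C.
Proof.
move=> [f1 f2] [g1 g2] fA gB s sk.
have rf t : (size t <= k)%N -> `|rpartial t (re_part f) x| <= A.
  by move=> tk; rewrite -lecR; apply: le_trans (fA t tk); exact: (normc_Re (partial t f x)).
have mf t : (size t <= k)%N -> `|rpartial t (im_part f) x| <= A.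
  by move=> tk; rewrite -lecR; apply: le_trans (fA t tk); exact: (normc_Im (partial t f x)).
have rg t : (size t <= k)%N -> `|rpartial t (re_part g) x| <= B.
  by move=> tk; rewrite -lecR; apply: le_trans (gB t tk); exact: (normc_Re (partial t g x)).
have mg t : (size t <= k)%N -> `|rpartial t (im_part g) x| <= B.
  by move=> tk; rewrite -lecR; apply: le_trans (gB t tk); exact: (normc_Im (partial t g x)).
rewrite /partial re_partM im_partM (le_trans (normc_le _))// lecR /=.
rewrite !rpartial_lin; try exact: rsmooth_M.
have h1 := rpartialM_bound f1 g1 rf rg sk.
have h2 := rpartialM_bound f2 g2 mf mg sk.
have h3 := rpartialM_bound f1 g2 rf mg sk.
have h4 := rpartialM_bound f2 g1 mf rg sk.
set C := 2 ^+ k * (A * B) in h1 h2 h3 h4.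
have -> : 4 * 2 ^+ k * (A * B) = (C + C) + (C + C) by rewrite /C; ring.
apply: lerD; apply: le_trans (ler_normD _ _) _; apply: lerD;
  by rewrite ?mulN1r ?normrN ?mul1r.
Qed.

Lemma schwartz_is (f : schwartz R N) : is_schwartz f.
Proof. by have /asboolP := schwartzP f. Qed.

Lemma schwartz_bounded (f : schwartz R N) l k : exists M : R, 0 <= M /\
  forall s x, (size s <= k)%N ->
    ((1 + `|x|) ^+ l)%:C * `|partial s f x| <= M%:C.
Proof.
have /choice[F hF] : forall s, exists M : R, forall x,
    ((1 + `|x|) ^+ l)%:C * `|partial s f x| <= M%:C by exact: (schwartz_is f).2.
elim: k => [|k [M [M0 hM]]].
  exists `|F [::]|; split=> // s x; rewrite leqn0 size_eq0 => /eqP ->.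
  by apply: le_trans (hF [::] x) _; rewrite lecR ler_norm.
exists (`|M| + \sum_(t : k.+1.-tuple 'I_N) `|F t|); split.
  by rewrite addr_ge0// sumr_ge0.
move=> s x; rewrite leq_eqVlt => /predU1P[sk|]; last first.
  rewrite ltnS => /(hM s x) h; apply: le_trans h _; rewrite lecR.
  by apply: le_trans (ler_norm _) _; rewrite lerDl sumr_ge0.
have ss : size s == k.+1 by apply/eqP.
apply: le_trans (hF s x) _; rewrite lecR (bigD1 (Tuple ss))//=.
apply: le_trans (ler_norm _) _.
by rewrite addrCA lerDl addr_ge0// sumr_ge0.
Qed.

Lemma test_bounded (p : testfun R N) k : exists M : R, forall s x, (size s <= k)%N ->
  `|partial s p x| <= M%:C.
Proof.
have [M [_ hM]] := schwartz_bounded (schwartz_of_test p) 0 k.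
by exists M => s x sk; have := hM s x sk; rewrite expr0 mul1r.
Qed.

Lemma partial_nil (f : V -> R[i]^o) x : partial [::] f x = f x.
Proof. by rewrite [RHS]cplx_eta. Qed.

Lemma partial_cst s (c : R[i]) x : `|partial s (fun _ : V => c : R[i]^o) x| <= `|c|.
Proof.
have E (d : R) t : rpartial t (fun _ : V => d) = fun=> (t == [::])%:R * d.
  elim: t => [|i t IH] /=; first by apply/funext => y; rewrite mul1r.
  by rewrite IH; apply/funext => y; rewrite derive_cst mul0r.
have -> : partial s (fun _ : V => c : R[i]^o) x = (s == [::])%:R * c.
  rewrite /partial -[re_part _]/(fun _ : V => complex.Re c).
  rewrite -[im_part _]/(fun _ : V => complex.Im c) !E.
  by case: (s == [::]); rewrite ?mul1r ?mul0r//; case: (c).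
by rewrite normrM; case: (s == [::]); rewrite ?normr1 ?mul1r// normr0 mul0r.
Qed.

End Leibniz.

Section DistributionCalculus.
Variables (R : realType) (N : nat).
Local Notation V := 'rV[R]_N.
Implicit Types (T S : distr R N) (p q : testfun R N).

Lemma distr_is T : is_distribution T.
Proof. by have /asboolP := distrP T. Qed.

Lemma distrZD T (a : R[i]) p q : T (a *: p + q) = a * T p + T q.
Proof. exact: (distr_is T).1. Qed.

Lemma distrD T p q : T (p + q) = T p + T q.
Proof. by have := distrZD T 1 p q; rewrite scale1r mul1r. Qed.

Lemma distr0 T : T 0 = 0.
Proof. by apply: (addrI (T 0)); rewrite -distrD !addr0. Qed.

Lemma distrZ T (a : R[i]) p : T (a *: p) = a * T p.
Proof. by have := distrZD T a p 0; rewrite !addr0 distr0 addr0. Qed.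

Lemma distrB T p q : T (p - q) = T p - T q.
Proof. by rewrite -scaleN1r addrC distrZD mulN1r addrC. Qed.

Lemma to_distrE (F : testfun R N -> R[i]^o) : is_distribution F ->
  to_distr F = F :> (testfun R N -> R[i]^o).
Proof. by move=> dF; rewrite /to_distr /insubd insubT //=; exact/asboolP. Qed.

Lemma open_supp_compl T : open (~` supp T).
Proof. by rewrite setCK; apply: bigcup_open => U []. Qed.

Lemma open_sing_supp_compl T : open (~` sing_supp T).
Proof. by rewrite setCK; apply: bigcup_open => U []. Qed.

Lemma supp_vanishes T p : fsupp p `<=` ~` supp T -> T p = 0.
Proof.
apply: (@test_ind _ _ (fun p => T p = 0)); first exact: distr0.
  by move=> f g f0 g0; rewrite distrD f0 g0 addr0.
by move=> x; rewrite setCK => -[W [oW hW] Wx]; exists W; split.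
Qed.

Lemma fsupp_testD p q : fsupp (p + q) `<=` fsupp p `|` fsupp q.
Proof. exact: (@fsuppD _ _ p q). Qed.

Lemma tmul_onD (U : set V) (a : V -> R[i]^o) p q : open U -> smooth_on U a ->
  fsupp p `<=` U -> fsupp q `<=` U -> tmul a (p + q) = tmul a p + tmul a q.
Proof.
move=> oU sa pU qU; apply: test_ext => x; rewrite testD_val !(tmul_onE oU)//.
  by rewrite testD_val mulrDr.
by move=> y /fsupp_testD[/pU|/qU].
Qed.

Lemma ccs_tmul_on (U : set V) (a : V -> R[i]^o) p : open U -> smooth_on U a ->
  fsupp p `<=` U -> ccs (fun x => a x * p x).
Proof. by move=> oU sa pU; rewrite -(tmul_onE oU sa pU); exact: ccs_test. Qed.

(** By the fundamental lemma, a distribution is given by at most one smooth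
    function on an open set. *)
Lemma equals_smooth_unique T (U W : set V) (a b : V -> R[i]^o) : open U -> open W ->
  equals_smooth_on T U a -> equals_smooth_on T W b ->
  forall x, U x -> W x -> a x = b x.
Proof.
move=> oU oW [sa Ta] [sb Tb] x Ux Wx.
have oUW : open (U `&` W) by exact: openI.
have sa' := smooth_on_sub (@subIsetl _ U W) sa.
have sb' := smooth_on_sub (@subIsetr _ U W) sb.
apply/eqP; rewrite -subr_eq0; apply/eqP.
have sab : smooth_on (U `&` W) (fun x => a x - b x).
  have /smooth_onP[a1 a2] := sa'; have /smooth_onP[b1 b2] := sb'.
  apply/smooth_onP; split=> k.
    have := Ck_lin 1 (-1) oUW (a1 k) (b1 k); apply: Ck_eq_on => // y _.
    by rewrite mul1r mulN1r /re_part; case: (a y) (b y) => ? ? [].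
  have := Ck_lin 1 (-1) oUW (a2 k) (b2 k); apply: Ck_eq_on => // y _.
  by rewrite mul1r mulN1r /im_part; case: (a y) (b y) => ? ? [].
apply: (cint_orthogonal_on oUW sab) => // p pUW.
have pU : fsupp p `<=` U by move=> y /pUW[].
have pW : fsupp p `<=` W by move=> y /pUW[].
rewrite (_ : (fun x => _) = fun x => a x * p x + (-1) * (b x * p x)).
  have ha := ccs_tmul_on oU sa pU; have hb := ccs_tmul_on oW sb pW.
  rewrite cintD//; last by apply: ccs_mul => //; exact/smooth_ccont/smooth_on_cst.
  by rewrite cintZ// -(Ta _ pU) -(Tb _ pW) mulN1r subrr.
by apply/funext => y; rewrite mulrBl mulN1r.
Qed.

(** The smooth functions found locally agree where two of them are defined, so
    they glue; that the glued function represents [T] on test functions with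
    large supports is a partition of unity argument. *)
Lemma equals_smooth_sing_supp T :
  exists a, equals_smooth_on T (~` sing_supp T) a.
Proof.
have /choice[F hF] : forall x, exists Ua : set V * (V -> R[i]^o), (~` sing_supp T) x ->
    [/\ open Ua.1, Ua.1 x & equals_smooth_on T Ua.1 Ua.2].
  move=> x; have [|] := pselect ((~` sing_supp T) x); last by exists (set0, fun=> 0).
  by rewrite {1}setCK => -[U [oU [a ha]] Ux]; exists (U, a).
pose a x := (F x).2 x.
have aE x y : (~` sing_supp T) x -> (F x).1 y -> a y = (F x).2 y.
  move=> /hF[oU Ux Ta] Uy.
  have /hF[oW Wy Tb] : (~` sing_supp T) y.
    by rewrite setCK; exists (F x).1 => //; split=> //; exists (F x).2.
  exact: (equals_smooth_unique oW oU Tb Ta).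
have loc x : (~` sing_supp T) x -> smooth_on (F x).1 a.
  move=> Sx; have [oU Ux [sa _]] := hF x Sx.
  by apply: smooth_on_eq sa => // y Uy; rewrite (aE x).
exists a; split.
  by apply: smooth_on_cover => x Sx; exists (F x).1; [by have [] := hF x Sx|exact: loc].
move=> p pS.
suff [] : fsupp p `<=` ~` sing_supp T /\ T p = cint (fun x => a x * p x) by [].
have sa : smooth_on (~` sing_supp T) a.
  by apply: smooth_on_cover => x Sx; exists (F x).1; [by have [] := hF x Sx|exact: loc].
have oS := @open_sing_supp_compl T.
apply: (@test_ind _ _ (fun p => fsupp p `<=` ~` sing_supp T /\
   T p = cint (fun x => a x * p x)) (~` sing_supp T)) pS.
- split; first exact: fsupp_test0.
  rewrite distr0 (_ : (fun x => _) = fun x => 0 * (0 : testfun R N) x).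
    by rewrite cintZ ?mul0r//; exact: ccs_test.
  by apply/funext => x; rewrite mulr0 mul0r.
- move=> f g [fS Tf] [gS Tg]; split; first by move=> x /fsupp_testD[/fS|/gS].
  rewrite distrD Tf Tg -cintD; [|exact: (ccs_tmul_on oS sa fS)|exact: (ccs_tmul_on oS sa gS)].
  by congr cint; apply/funext => x; rewrite testD_val mulrDr.
- move=> x Sx; have [oU Ux [sb Tb]] := hF x Sx.
  exists ((F x).1 `&` ~` sing_supp T); split=> //; first exact: openI.
  move=> f fU; split; first by move=> y /fU[].
  rewrite Tb; last by move=> y /fU[].
  congr cint; apply/funext => y.
  have [/fU[h _]|/fsupp_out ->] := pselect (fsupp f y); last by rewrite !mulr0.
  by rewrite (aE x).
Qed.

Lemma is_distribution_tmul T (g : testfun R N) :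
  is_distribution (fun p => T (tmul g p)).
Proof.
split.
  move=> a p q; rewrite -[RHS]distrZD; congr (T _); apply: test_ext => x.
  rewrite [RHS]testD_val tmulE; last exact: test_smooth.
  rewrite -[RHS]/(a * tmul g p x + tmul g q x) !tmulE; try exact: test_smooth.
  by rewrite -[(a *: p + q) x]/(a * p x + q x) mulrDr mulrCA.
move=> K cK; have [C [k h]] := (distr_is T).2 K cK.
have [M hM] := test_bounded g k.
exists (C * (4 * 2 ^+ k * M)), k => p M' pK hp; rewrite -mulrA.
apply: h => [|s x sk].
  by rewrite tmulE; [move=> x /fsuppM[_ /pK]|exact: test_smooth].
rewrite tmulE; last exact: test_smooth.
rewrite -mulrA; apply: partialM_bound sk; try exact: test_smooth.
  by move=> t; exact: hM.
by move=> t; exact: hp.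
Qed.

End DistributionCalculus.

(** * Integrating out part of the variables *)

Section PartialIntegral.
Variables (R : realType) (n m : nat).

Lemma row_mx_line (x : 'rV[R]_n) (y : 'rV[R]_m) (i : 'I_m) (h : R) :
  row_mx x (h *: 'e_i + y) = h *: 'e_(rshift n i) + row_mx x y.
Proof.
apply/rowP => j; rewrite !mxE eqxx /=; case: splitP => k jk.
  rewrite (_ : (j == _) = false) ?mulr0 ?add0r//.
  by apply/negbTE/eqP => jE; move: jk; rewrite jE /= => h'; have := ltn_ord k; rewrite -h' ltnNge leq_addr.
rewrite !mxE eqxx /=; congr (h * _%:R + _).
by have -> : j = rshift n k; [exact: val_inj|rewrite eq_rshift].
Qed.

Lemma row_mxl_continuous (y : 'rV[R]_m) : continuous (fun x : 'rV[R]_n => row_mx x y).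
Proof.
apply: (@comp_continuous _ _ _ (fun x : 'rV[R]_n => (x, y)) (fun p => row_mx p.1 p.2));
  last exact: row_mx_continuous.
by apply: pair_continuous => x; [exact: cvg_id|exact: cst_continuous].
Qed.

Lemma row_mxr_continuous (x : 'rV[R]_n) : continuous (fun y : 'rV[R]_m => row_mx x y).
Proof.
apply: (@comp_continuous _ _ _ (fun y : 'rV[R]_m => (x, y)) (fun p => row_mx p.1 p.2));
  last exact: row_mx_continuous.
by apply: pair_continuous => y; [exact: cst_continuous|exact: cvg_id].
Qed.

(** The derivative along the line through [z], at a parameter [t] other than
    zero: reparametrise the line from the point [t *: e_j + z]. *)
Lemma is_derive_line_at N (G : 'rV[R]_N -> R) z j (t : R) :
  (forall z, derivable G z 'e_j) ->
  is_derive t 1 (fun s : R => G (s *: 'e_j + z)) (pd j G (t *: 'e_j + z)).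
Proof.
move=> dG; have /is_derive_lineP h := derivableP (dG (t *: 'e_j + z)).
have h' : is_derive ((fun s : R => s - t) t) 1
    (fun s : R => G (s *: 'e_j + (t *: 'e_j + z))) (pd j G (t *: 'e_j + z)).
  by rewrite subrr.
have ds : is_derive t 1 (fun s : R => s - t) 1.
  exact: (@is_derive_shift _ t 1 (- t)).
have := @is_derive1_comp R _ (fun s : R => s - t) _ _ _ h' ds.
rewrite mulr1 (_ : _ \o _ = fun s : R => G (s *: 'e_j + z))//.
by apply/funext => s /=; rewrite addrA -scalerDl subrK.
Qed.

Lemma line_mean_value (g dg : R -> R) (d e h : R) :
  (forall t : R, is_derive t 1 g (dg t)) ->
  (forall t : R, `|t| <= `|h| -> `|dg t - d| <= e) ->
  `|g h - g 0 - h * d| <= e * `|h|.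
Proof.
move=> dgP he.
have cg (a b : R) : {within `[a, b], continuous g}.
  apply: continuous_subspaceT => t.
  by apply/differentiable_continuous/derivable1_diffP; case: (dgP t).
have [h0|h0|->] := ltgtP h 0.
- have [c + E] := MVT h0 (fun t _ => dgP t) (cg _ _).
  rewrite in_itv /= => /andP[c1 c2].
  have -> : g h - g 0 - h * d = (dg c - d) * h by move: E; lra.
  by rewrite normrM ler_wpM2r// he// !ltr0_norm//; lra.
- have [c + E] := MVT h0 (fun t _ => dgP t) (cg _ _).
  rewrite in_itv /= => /andP[c1 c2].
  have -> : g h - g 0 - h * d = (dg c - d) * h by move: E; lra.
  by rewrite normrM ler_wpM2r// he// !gtr0_norm//; lra.
- by rewrite normr0 mulr0 subrr mul0r subr0 normr0.
Qed.

Definition rpint (G : 'rV[R]_(n + m) -> R) (y : 'rV[R]_m) : R :=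
  rint (fun x : 'rV[R]_n => G (row_mx x y)).

Lemma pcc_row_mx (B : R) (G : 'rV[R]_(n + m) -> R) : cc B G ->
  pcc B (fun (y : 'rV[R]_m) (x : 'rV[R]_n) => G (row_mx x y)).
Proof.
move=> [cG G0]; split=> [|y x Bx]; last first.
  by apply: G0; apply: lt_le_trans Bx _; exact: norm_row_mxl.
apply: (@comp_continuous _ _ _ (fun p : 'rV[R]_m * 'rV[R]_n => row_mx p.2 p.1) G) => //.
apply: (@comp_continuous _ _ _ (fun p : 'rV[R]_m * 'rV[R]_n => (p.2, p.1))
  (fun p => row_mx p.1 p.2)); last exact: row_mx_continuous.
by apply: pair_continuous; [exact: snd_continuous|exact: fst_continuous].
Qed.

Lemma cc_pd N (B : R) (G : 'rV[R]_N -> R) j : rsmooth_on setT G -> cc B G -> cc B (pd j G).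
Proof.
move=> sG [cG G0]; split=> [x|x Bx]; first exact: (rsmooth_pd j sG [::] I).1.
have oB : open [set z : 'rV[R]_N | B < `|z|].
  have cn : continuous (fun z : 'rV[R]_N => `|z|) by exact: norm_continuous.
  by move/continuousP : cn => /(_ _ (@open_gt R B)).
rewrite (pd_eq_on j oB (g := cst 0)) //; first exact: derive_cst.
Qed.

(** Differentiation under the integral.  By the mean value theorem the difference
    quotient differs from the derivative at [y] by its oscillation near [y],
    which is small uniformly in the integration variable by [pcc_near]. *)
Lemma is_derive_rpint (B : R) (G : 'rV[R]_(n + m) -> R) y i : 0 <= B ->
  rsmooth_on setT G -> cc B G ->
  is_derive y 'e_i (rpint G) (rpint (pd (rshift n i) G) y).
Proof.
move=> B0 sG ccG; set j := rshift n i.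
have ccpd := cc_pd j sG ccG.
have pG := pcc_row_mx ccG; have ppd := pcc_row_mx ccpd.
have K0 : 0 <= (2 * B) ^+ n by rewrite exprn_ge0// mulr_ge0.
have dG z : derivable G z 'e_j by exact: (sG [::] z I).2.
suff h : (fun h : R => h^-1 *: ((rpint G \o shift y) (h *: 'e_i) - rpint G y)) @ 0^' -->
    (rpint (pd j G) y : R).
  by split; [apply/cvg_ex; eexists; exact: h|exact: cvg_lim h].
apply/cvgrPdist_le => e e0.
have e1 : 0 < e / ((2 * B) ^+ n + 1) by rewrite divr_gt0// ltr_wpDl.
have /nbhs_ballP[r /= r0 hr] := pcc_near y ppd e1.
have er : 0 < r / 2 by rewrite divr_gt0.
near=> h.
have hr2 : `|h| <= r / 2 by near: h; exact: dnbhs0_le.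
have h0 : h != 0 by near: h; exact: nbhs_dnbhs_neq.
have E : rpint (pd j G) y - h^-1 *: ((rpint G \o shift y) (h *: 'e_i) - rpint G y) =
   rint (fun x => 1 * pd j G (row_mx x y) + (- h^-1) *
     (1 * G (row_mx x (h *: 'e_i + y)) + (-1) * G (row_mx x y))).
  rewrite (rint_lin _ _ B0 (pcc_cc y ppd)); last first.
    by apply: cc_lin; [exact: (pcc_cc (h *: 'e_i + y) pG)|exact: (pcc_cc y pG)].
  rewrite (rint_lin _ _ B0 (pcc_cc (h *: 'e_i + y) pG) (pcc_cc y pG)).
  by rewrite !mul1r !mulN1r mulNr.
rewrite E; apply: (@le_trans _ _ (e / ((2 * B) ^+ n + 1) * (2 * B) ^+ n)).
  apply: rint_bound => //.
    apply: cc_lin; first exact: (pcc_cc y ppd).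
    by apply: cc_lin; [exact: (pcc_cc (h *: 'e_i + y) pG)|exact: (pcc_cc y pG)].
  move=> x; rewrite !mul1r mulN1r row_mx_line -/j.
  have := @line_mean_value (fun s : R => G (s *: 'e_j + row_mx x y))
    (fun s => pd j G (s *: 'e_j + row_mx x y)) (pd j G (row_mx x y))
    (e / ((2 * B) ^+ n + 1)) h (fun t => is_derive_line_at _ t dG).
  rewrite scale0r add0r => H; have {}H := H _.
  rewrite -(ler_pM2r (x := `|h|)) ?normr_gt0// -normrM.
  have -> (a b : R) : (a + - h^-1 * b) * h = h * a - b by field.
  rewrite distrC.
  apply: H => t th; rewrite -row_mx_line; apply: hr.
  rewrite -ball_normE /= opprD addrCA subrr addr0 normrN normrZ.
  apply: (@le_lt_trans _ _ `|t|).
    by rewrite ler_piMr//; apply/rV_norm_le => // k; rewrite mxE eqxx /=; case: eqP; rewrite ?normr1 ?normr0.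
  by apply: le_lt_trans (le_trans th hr2) _; lra.
rewrite mulrAC -mulrA ler_piMr ?(ltW e0)// ler_pdivrMr ?mul1r ?lerDl ?ltr_wpDl//.
Unshelve. all: by end_near. Qed.

Lemma rpint_smooth (B : R) (G : 'rV[R]_(n + m) -> R) : 0 <= B ->
  rsmooth_on setT G -> cc B G ->
  rsmooth_on setT (rpint G) /\
  forall s, rpartial s (rpint G) = rpint (rpartial (map (@rshift n m) s) G).
Proof.
move=> B0 sG ccG.
have rp s : rsmooth_on setT (rpartial s G) /\ cc B (rpartial s G).
  elim: s => [//|j s [IH1 IH2]]; split; [exact: rsmooth_pd|exact: cc_pd].
have H s : rpartial s (rpint G) = rpint (rpartial (map (@rshift n m) s) G).
  elim: s => [//|i s IH] /=; rewrite IH; apply/funext => y.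
  have [s1 s2] := rp (map (@rshift n m) s).
  by have [_] := is_derive_rpint y i B0 s1 s2.
split=> // s y _; rewrite H; have [s1 s2] := rp (map (@rshift n m) s); split.
  exact: (pcc_rint_continuous B0 (pcc_row_mx s2)).
by move=> i; have [] := is_derive_rpint y i B0 s1 s2.
Qed.

Definition pint (q : testfun R (n + m)) : 'rV[R]_m -> R[i]^o :=
  fun y => cint (fun x : 'rV[R]_n => q (row_mx x y)).

Lemma pint_smooth (q : testfun R (n + m)) : smooth_on setT (pint q).
Proof.
have [B B0 [c1 c2]] := ccs_parts (ccs_test q); have [s1 s2] := test_smooth q.
by split; [exact: (rpint_smooth B0 s1 c1).1|exact: (rpint_smooth B0 s2 c2).1].
Qed.

Lemma partial_pint (q : testfun R (n + m)) s y : partial s (pint q) y =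
  cint (fun x : 'rV[R]_n => partial (map (@rshift n m) s) q (row_mx x y)).
Proof.
have [B B0 [c1 c2]] := ccs_parts (ccs_test q); have [s1 s2] := test_smooth q.
by rewrite /partial (rpint_smooth B0 s1 c1).2 (rpint_smooth B0 s2 c2).2.
Qed.

Lemma cint0 N : cint (fun _ : 'rV[R]_N => 0) = 0.
Proof. by rewrite /cint !rint0. Qed.

Lemma fsupp_pint (q : testfun R (n + m)) : fsupp (pint q) `<=` rsubmx @` fsupp q.
Proof.
apply: fsupp_subset.
  apply: compact_closed; first exact: norm_hausdorff.
  apply: continuous_compact; last exact: test_compact.
  by apply: continuous_subspaceT; exact: rsubmx_continuous.
move=> y hy; rewrite /pint (_ : (fun x => _) = fun=> 0) ?cint0//.
apply/funext => x; apply: fsupp_out => h; apply: hy.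
by exists (row_mx x y) => //; rewrite row_mxKr.
Qed.

Lemma is_test_pint (q : testfun R (n + m)) : is_test (pint q).
Proof.
split; first exact: pint_smooth.
apply: (@subclosed_compact _ _ (rsubmx @` fsupp q)); first exact: closed_fsupp.
  apply: continuous_compact; last exact: test_compact.
  by apply: continuous_subspaceT; exact: rsubmx_continuous.
exact: fsupp_pint.
Qed.

Lemma pint_bound (q : testfun R (n + m)) (B M : R) k : 0 <= B ->
  (forall z, fsupp q z -> `|z| <= B) ->
  (forall s z, (size s <= k)%N -> `|partial s q z| <= M%:C) ->
  forall s y, (size s <= k)%N -> `|partial s (pint q) y| <= (2 * (2 * B) ^+ n * M)%:C.
Proof.
move=> B0 hB hM s y sk; rewrite partial_pint.
apply: (cint_bound (B := B)) => //.
- have [s1 s2] := test_smooth q; split.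
    apply: (@comp_continuous _ _ _ (fun x : 'rV[R]_n => row_mx x y)
      (rpartial (map (@rshift n m) s) (re_part q))).
      exact: row_mxl_continuous.
    by move=> z; exact: (s1 _ z I).1.
  apply: (@comp_continuous _ _ _ (fun x : 'rV[R]_n => row_mx x y)
    (rpartial (map (@rshift n m) s) (im_part q))).
    exact: row_mxl_continuous.
  by move=> z; exact: (s2 _ z I).1.
- move=> x Bx; apply: partial_eq0 => /hB; apply/negP; rewrite -ltNge.
  by apply: lt_le_trans Bx _; exact: norm_row_mxl.
- by move=> x; apply: hM; rewrite size_map.
Qed.

End PartialIntegral.

(** * Products of distributions *)

Section Products.
Variables (R : realType) (N : nat).
Local Notation V := 'rV[R]_N.
Implicit Types (f g h : distr R N) (p q : testfun R N).

Lemma vanishes_equals_smooth f : equals_smooth_on f (~` supp f) (fun=> 0).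
Proof.
split; first exact: smooth_on_cst.
move=> p pf; rewrite supp_vanishes//.
by rewrite (_ : (fun x => _) = fun=> 0) ?cint0//; apply/funext => x; rewrite mul0r.
Qed.

(** Off its support [g] is the smooth function zero, and so is the function by
    which [f] is multiplied there. *)
Lemma supp_is_mul_on f g h : is_mul_on (~` sing_supp g) f g h -> supp h `<=` supp g.
Proof.
move=> [a ga ha]; rewrite -[supp g]setCK => x + gx; apply.
have gS : ~` supp g `<=` ~` sing_supp g.
  move=> y gy; rewrite setCK; exists (~` supp g) => //; split.
    exact: (@open_supp_compl _ _ g).
  by exists (fun=> 0); exact: vanishes_equals_smooth.
exists (~` supp g) => //; split; first exact: (@open_supp_compl _ _ g).
move=> p pg; rewrite ha; last exact: subset_trans gS.
rewrite (_ : to_test _ = 0) ?distr0//; apply: to_test_ext => y.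
have [py|/fsupp_out ->] := pselect (fsupp p y); last by rewrite mulr0.
have gy := pg _ py.
by rewrite (equals_smooth_unique (@open_sing_supp_compl _ _ g)
  (@open_supp_compl _ _ g) ga (@vanishes_equals_smooth g)) ?mul0r//; exact: gS.
Qed.

Lemma fsupp_testN p : fsupp (- p) `<=` fsupp p.
Proof.
apply: fsupp_subset; first exact: closed_fsupp.
by move=> x /fsupp_out h; rewrite testN_val h oppr0.
Qed.

Lemma tmul_onN (U : set V) (a : V -> R[i]^o) p : open U -> smooth_on U a ->
  fsupp p `<=` U -> tmul a (- p) = - tmul a p.
Proof.
move=> oU sa pU; apply: test_ext => x; rewrite testN_val !(tmul_onE oU)//.
  by rewrite testN_val mulrN.
by move=> y /fsupp_testN/pU.
Qed.

Lemma distrN f p : f (- p) = - f p.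
Proof. by rewrite -scaleN1r distrZ mulN1r. Qed.

Lemma fsupp_tmul (t p : testfun R N) : fsupp (tmul t p) `<=` fsupp t.
Proof. by rewrite tmulE; [move=> x /fsuppM[]|exact: test_smooth]. Qed.

Lemma tmulA (U : set V) (a : V -> R[i]^o) (t p : testfun R N) : open U ->
  smooth_on U a -> fsupp t `<=` U -> tmul (tmul a t) p = tmul a (tmul t p).
Proof.
move=> oU sa tU; have tpU : fsupp (tmul t p) `<=` U.
  exact: subset_trans (@fsupp_tmul t p) tU.
apply: test_ext => x; rewrite (tmul_onE oU sa tpU) tmulE; last exact: test_smooth.
rewrite (tmul_onE oU sa tU) tmulE; last exact: test_smooth.
by rewrite mulrA.
Qed.

(** The two open sets cover the space, so a test function splits as
    [p = p1 + p2] with supports in them, and the product sends [p] to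
    [f (a p1) + g (b p2)].  The value does not depend on the splitting because on
    the overlap both terms are the integral of [a * b * p].  For continuity, split
    one cutoff of a compact set and multiply with it. *)
Lemma is_mul_exists f g : sing_supp g `&` sing_supp f = set0 -> exists h, is_mul f g h.
Proof.
move=> fg0.
have [a [sa ga]] := @equals_smooth_sing_supp _ _ g.
have [b [sb fb]] := @equals_smooth_sing_supp _ _ f.
have oG := @open_sing_supp_compl _ _ g; have oF := @open_sing_supp_compl _ _ f.
set UG := ~` sing_supp g in sa ga oG *; set UF := ~` sing_supp f in sb fb oF *.
pose D p (z : R[i]) := exists p1 p2, [/\ p = p1 + p2, fsupp p1 `<=` UG, fsupp p2 `<=` UF &
  z = f (tmul a p1) + g (tmul b p2)].
have DD p q z w : D p z -> D q w -> D (p + q) (z + w).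
  move=> [p1 [p2 [-> p1G p2F ->]]] [q1 [q2 [-> q1G q2F ->]]].
  exists (p1 + q1), (p2 + q2); split.
  - by rewrite addrACA.
  - by move=> x /fsupp_testD[/p1G|/q1G].
  - by move=> x /fsupp_testD[/p2F|/q2F].
  - by rewrite (tmul_onD oG)// (tmul_onD oF)// !distrD addrACA.
have DN p z : D p z -> D (- p) (- z).
  move=> [p1 [p2 [-> p1G p2F ->]]]; exists (- p1), (- p2); split.
  - by rewrite opprD.
  - by move=> x /fsupp_testN/p1G.
  - by move=> x /fsupp_testN/p2F.
  - by rewrite (tmul_onN oG)// (tmul_onN oF)// !distrN opprD.
have D0 z : D 0 z -> z = 0.
  move=> [p1 [p2 [E p1G p2F ->]]].
  have {}E : p1 = - p2 by apply/eqP; rewrite -addr_eq0 -E.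
  have p2G : fsupp p2 `<=` UG by move=> x; rewrite -[p2]opprK -E => /fsupp_testN/p1G.
  rewrite E (tmul_onN oG)// distrN fb; last first.
    by rewrite (tmul_onE oG)// => x /fsuppM[_ /p2F].
  rewrite ga; last by rewrite (tmul_onE oF)// => x /fsuppM[_ /p2G].
  apply/eqP; rewrite addrC subr_eq0; apply/eqP; congr cint; apply/funext => x.
  by rewrite (tmul_onE oF)// (tmul_onE oG)// mulrCA.
have DU p z w : D p z -> D p w -> z = w.
  move=> Dz Dw; apply/eqP; rewrite -subr_eq0; apply/eqP/D0.
  by have := DD _ _ _ _ Dz (DN _ _ Dw); rewrite subrr.
have DZ (c : R[i]) p z : D p z -> D (c *: p) (c * z).
  move=> [p1 [p2 [-> p1G p2F ->]]].
  have suppZ q (U : set V) : fsupp q `<=` U -> fsupp (c *: q) `<=` U.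
    move=> qU; apply: subset_trans qU; apply: fsupp_subset; first exact: closed_fsupp.
    by move=> x /fsupp_out h; rewrite -[LHS]/(c * q x) h mulr0.
  have mulZ (U : set V) (e : V -> R[i]^o) q : open U -> smooth_on U e -> fsupp q `<=` U ->
      tmul e (c *: q) = c *: tmul e q.
    move=> oU se qU; apply: test_ext => x; rewrite -[RHS]/(c * tmul e q x).
    rewrite !(tmul_onE oU)//; last exact: suppZ.
    by rewrite -[(c *: q) x]/(c * q x) mulrCA.
  exists (c *: p1), (c *: p2); split; [by rewrite scalerDr|exact: suppZ|exact: suppZ|].
  by rewrite (mulZ _ _ _ oG)// (mulZ _ _ _ oF)// !distrZ mulrDr.
have Dtot p : exists z, D p z.
  have decomp : exists p1 p2, [/\ p = p1 + p2, fsupp p1 `<=` UG & fsupp p2 `<=` UF].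
    apply: (@test_ind _ _ (fun p => exists p1 p2,
      [/\ p = p1 + p2, fsupp p1 `<=` UG & fsupp p2 `<=` UF]) setT) => //.
    - by exists 0, 0; split; rewrite ?addr0//; exact: fsupp_test0.
    - move=> q r [q1 [q2 [-> q1G q2F]]] [r1 [r2 [-> r1G r2F]]].
      exists (q1 + r1), (q2 + r2); split; first by rewrite addrACA.
        by move=> x /fsupp_testD[/q1G|/r1G].
      by move=> x /fsupp_testD[/q2F|/r2F].
    - have s0 U := @fsupp_test0 R N U.
      move=> x _; have [Gx|Gx] := pselect (UG x).
        by exists UG; split=> // q qG; exists q, 0; rewrite addr0.
      have Fx : UF x.
        move=> Fx; move: Gx; apply => Gx.
        by have : (sing_supp g `&` sing_supp f) x by []; rewrite fg0.
      by exists UF; split=> // q qF; exists 0, q; rewrite add0r.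
  have [p1 [p2 [E p1G p2F]]] := decomp.
  by exists (f (tmul a p1) + g (tmul b p2)), p1, p2.
have /choice[H DH] := Dtot.
have isd : is_distribution (H : testfun R N -> R[i]^o).
  split=> [c p q|K cK].
    by apply: (DU (c *: p + q)) => //; apply: DD => //; exact: DZ.
  have [t [_ [W [oW KW] t1]]] := cutoff cK openT (@subsetT _ K).
  have [z [t1' [t2 [tE t1G t2F _]]]] := Dtot t.
  pose A := tmul a t1'; pose B := tmul b t2.
  have [C1 [k1 h1]] := (is_distribution_tmul f A).2 K cK.
  have [C2 [k2 h2]] := (is_distribution_tmul g B).2 K cK.
  exists (C1 + C2), (maxn k1 k2) => p M pK pM.
  have -> : H p = f (tmul A p) + g (tmul B p).
    apply: (DU p) => //; exists (tmul t1' p), (tmul t2 p); split.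
    - apply: test_ext => x; rewrite testD_val !tmulE; try exact: test_smooth.
      rewrite -mulrDl -testD_val -tE.
      by have [/pK/KW/t1 ->|/fsupp_out ->] := pselect (fsupp p x); rewrite ?mul1r ?mulr0.
    - exact: subset_trans (@fsupp_tmul _ _) t1G.
    - exact: subset_trans (@fsupp_tmul _ _) t2F.
    - by rewrite (tmulA _ oG sa t1G) (tmulA _ oF sb t2F).
  rewrite (le_trans (ler_normD _ _))// mulrDl rmorphD; apply: lerD.
    by apply: h1 => // s x sk; apply: pM; rewrite leq_max sk.
  by apply: h2 => // s x sk; apply: pM; rewrite leq_max sk orbT.
have s0 U := @fsupp_test0 R N U.
have m0 (e : V -> R[i]^o) : to_test (fun x => e x * (0 : testfun R N) x) = 0.
  by apply: to_test_ext => x; rewrite mulr0.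
exists (to_distr (H : testfun R N -> R[i]^o)); split.
  exists a; first by split.
  move=> p pG; rewrite to_distrE//; apply: (DU p) => //; exists p, 0.
  by split; rewrite ?addr0 ?[tmul b 0]m0 ?distr0 ?addr0.
exists b; first by split.
move=> p pF; rewrite to_distrE//; apply: (DU p) => //; exists 0, p.
by split; rewrite ?add0r ?[tmul a 0]m0 ?distr0 ?add0r.
Qed.

End Products.

(** * Tensor products *)

Section TensorProducts.
Variables (R : realType) (n m : nat).
Implicit Types (v : testfun R n) (f : testfun R (n + m)) (phi : testfun R m).

Lemma lsubmx_line (i : 'I_(n + m)) :
  (forall x (h : R), @lsubmx R 1 n m (h *: 'e_i + x) = lsubmx x) \/
  exists j c, forall x (h : R), @lsubmx R 1 n m (h *: 'e_i + x) = h * c *: 'e_j + lsubmx x.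
Proof.
case: (splitP i) => k ik; [right|left].
  exists k, 1 => x h; apply/rowP => j; rewrite !mxE mulr1 eqxx /=; congr (h * _%:R + _).
  by have -> : i = lshift m k; [exact: val_inj|rewrite eq_lshift].
move=> x h; apply/rowP => j; rewrite !mxE eqxx /=.
by have -> : i = rshift n k; [exact: val_inj|rewrite eq_lrshift mulr0 add0r].
Qed.

Lemma rsubmx_line (i : 'I_(n + m)) :
  (forall x (h : R), @rsubmx R 1 n m (h *: 'e_i + x) = rsubmx x) \/
  exists j c, forall x (h : R), @rsubmx R 1 n m (h *: 'e_i + x) = h * c *: 'e_j + rsubmx x.
Proof.
case: (splitP i) => k ik; [left|right].
  move=> x h; apply/rowP => j; rewrite !mxE eqxx /=.
  by have -> : i = lshift m k; [exact: val_inj|rewrite eq_rlshift mulr0 add0r].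
exists k, 1 => x h; apply/rowP => j; rewrite !mxE mulr1 eqxx /=; congr (h * _%:R + _).
by have -> : i = rshift n k; [exact: val_inj|rewrite eq_rshift].
Qed.

Lemma smooth_lsubmx v : smooth_on setT (fun z : 'rV[R]_(n + m) => v (lsubmx z)).
Proof.
apply: (@smooth_on_comp _ _ _ (@lsubmx R 1 n m) setT setT v) => //; try exact: openT.
- exact: lsubmx_continuous.
- exact: lsubmx_line.
- exact: test_smooth.
Qed.

Lemma smooth_on_rsubmx (U : set 'rV[R]_m) (g : 'rV[R]_m -> R[i]^o) : open U ->
  smooth_on U g ->
  smooth_on [set z : 'rV[R]_(n + m) | U (rsubmx z)] (fun z => g (rsubmx z)).
Proof.
move=> oU sg; apply: (@smooth_on_comp _ _ _ (@rsubmx R 1 n m) U) => //.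
- have cr := @rsubmx_continuous R n m.
  by move/continuousP : cr; apply.
- exact: rsubmx_continuous.
- exact: rsubmx_line.
Qed.

Lemma fsupp_tensor (g : 'rV[R]_n -> R[i]^o) (g' : 'rV[R]_m -> R[i]^o) :
  fsupp (fun z : 'rV[R]_(n + m) => g (lsubmx z) * g' (rsubmx z)) `<=`
  [set z | fsupp g (lsubmx z) /\ fsupp g' (rsubmx z)].
Proof.
apply: fsupp_subset.
  apply: closedI.
    apply: (@preimage_closed _ _ (@lsubmx R 1 n m)); last exact: closed_fsupp.
    by move=> x _; exact: lsubmx_continuous.
  apply: (@preimage_closed _ _ (@rsubmx R 1 n m)); last exact: closed_fsupp.
  by move=> x _; exact: rsubmx_continuous.
by move=> z /not_andP[/fsupp_out ->|/fsupp_out ->]; rewrite ?mul0r ?mulr0.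
Qed.

Lemma tensor_testE v phi : tensor_test v phi =
  (fun z => v (lsubmx z) * phi (rsubmx z)) :> ('rV[R]_(n + m) -> _).
Proof.
apply: to_testE; split.
  apply: smooth_on_M; [exact: openT|exact: smooth_lsubmx|].
  exact: (smooth_on_rsubmx openT (test_smooth phi)).
apply: (@subclosed_compact _ _
  ((fun p : 'rV[R]_n * 'rV[R]_m => row_mx p.1 p.2) @` (fsupp v `*` fsupp phi))).
- exact: closed_fsupp.
- apply: continuous_compact.
    by apply: continuous_subspaceT; exact: row_mx_continuous.
  by apply: compact_setX; exact: test_compact.
- move=> z /fsupp_tensor[/= h1 h2]; exists (lsubmx z, rsubmx z) => //=.
  exact: hsubmxK.
Qed.

Lemma tensor_test_row v phi x y : tensor_test v phi (row_mx x y) = v x * phi y.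
Proof. by rewrite tensor_testE row_mxKl row_mxKr. Qed.

Lemma fsupp_tensor_test v phi : fsupp (tensor_test v phi) `<=`
  [set z | fsupp v (lsubmx z) /\ fsupp phi (rsubmx z)].
Proof. by rewrite tensor_testE; exact: fsupp_tensor. Qed.

(** The integrand of the tensor product as a test function of both variables, so
    that differentiation under the integral applies to it. *)
Definition lmul v f : testfun R (n + m) := tmul (fun z => v (lsubmx z)) f.

Lemma lmulE v f : lmul v f = (fun z => v (lsubmx z) * f z) :> ('rV[R]_(n + m) -> _).
Proof. by rewrite /lmul tmulE//; exact: smooth_lsubmx. Qed.

Definition slice_int v f : testfun R m := to_test (pint (lmul v f)).

Lemma slice_intE v f y : slice_int v f y = cint (fun x => v x * f (row_mx x y)).
Proof.
rewrite /slice_int to_testE; last exact: is_test_pint.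
by rewrite /pint; congr cint; apply/funext => x; rewrite lmulE row_mxKl.
Qed.

Lemma fsupp_slice_int v f : fsupp (slice_int v f) `<=` rsubmx @` fsupp f.
Proof.
rewrite /slice_int to_testE; last exact: is_test_pint.
apply: subset_trans (@fsupp_pint _ _ _ _) _ => _ [z hz <-]; exists z => //.
by move: hz; rewrite lmulE => /fsuppM[].
Qed.

Lemma slice_ccs f y : ccs (fun x : 'rV[R]_n => f (row_mx x y)).
Proof.
have [cf [B B0 f0]] := ccs_test f; split.
  exact: (ccont_comp (@row_mxl_continuous R n m y) cf).
by exists B => // x Bx; apply: f0; apply: lt_le_trans Bx _; exact: norm_row_mxl.
Qed.

Lemma mul_slice_ccs v f y : ccs (fun x : 'rV[R]_n => v x * f (row_mx x y)).
Proof. by apply: ccs_mul; [exact/smooth_ccont/test_smooth|exact: slice_ccs]. Qed.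

Lemma slice_int_scale v f (g : testfun R (n + m)) (c : R[i]) y :
  (forall x, f (row_mx x y) = c * g (row_mx x y)) ->
  slice_int v f y = c * slice_int v g y.
Proof.
move=> h; have E1 := slice_intE v f y; have E2 := slice_intE v g y.
have E3 := cintZ c (mul_slice_ccs v g y).
have E : cint (fun x => v x * f (row_mx x y)) =
    cint (fun x => c * (v x * g (row_mx x y))).
  by congr cint; apply/funext => x; rewrite h mulrCA.
exact: (etrans E1 (etrans E (etrans E3 (congr1 ( *%R c) (esym E2))))).
Qed.

(** Derivatives in [y] pass to the integrand, where Leibniz bounds apply once [v],
    which does not have compact support as a function of both variables, is cut
    off around the given compact set. *)
Lemma is_distribution_slice_int v (u : distr R m) :
  is_distribution (fun f => u (slice_int v f)).
Proof.
split=> [c f g|K cK].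
  rewrite -[RHS]distrZD; congr (u _); apply: test_ext => y.
  rewrite testZD_val !slice_intE -cintZ; last exact: mul_slice_ccs.
  have hf : ccs (fun x => c * (v x * f (row_mx x y))).
    by apply: ccs_mul; [exact/smooth_ccont/smooth_on_cst|exact: mul_slice_ccs].
  rewrite -(cintD hf (mul_slice_ccs v g y)); congr cint; apply/funext => x.
  by rewrite testZD_val mulrDr mulrCA.
have [B B0 hB] : exists2 M : R, 0 <= M & forall x, K x -> `|x| <= M.
  by apply: (compact_ubound (h := id)) => // x.
have cK' : compact (@rsubmx R 1 n m @` K).
  apply: continuous_compact => //.
  by apply: continuous_subspaceT; exact: rsubmx_continuous.
have [C [k hu]] := (distr_is u).2 _ cK'.
have [t [_ [W [oW KW] t1]]] := cutoff cK openT (@subsetT _ K).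
have [M hM] := test_bounded (lmul v t) k.
exists (C * (2 * (2 * B) ^+ n * (4 * 2 ^+ k * M))), k => f L fK hf.
rewrite -!mulrA; apply: hu.
  by apply: subset_trans (@fsupp_slice_int v f) _ => _ [z /fK Kz <-]; exists z.
have E : lmul v f = tmul (lmul v t) f.
  apply: test_ext => z; rewrite tmulE; last exact: test_smooth.
  rewrite !lmulE; have [/fK/KW/t1 ->|/fsupp_out ->] := pselect (fsupp f z).
    by rewrite mulr1.
  by rewrite !mulr0.
move=> s y sk; rewrite /slice_int to_testE; last exact: is_test_pint.
have -> : 2 * ((2 * B) ^+ n * (4 * (2 ^+ k * (M * L)))) =
  2 * (2 * B) ^+ n * (4 * 2 ^+ k * (M * L)) by rewrite !mulrA.
apply: (pint_bound (k := k)) => //.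
  by move=> z; rewrite lmulE => /fsuppM[_ /fK/hB].
move=> s' z sk'; rewrite E tmulE; last exact: test_smooth.
apply: (partialM_bound (k := k)) => //; try exact: test_smooth.
  by move=> s'' sk''; exact: hM.
by move=> s'' sk''; exact: hf.
Qed.

Lemma tensorE v (u : distr R m) f : tensor v u f = u (slice_int v f).
Proof.
have E : (fun f : testfun R (n + m) =>
    u (to_test (fun y => cint (fun x => v x * f (row_mx x y))))) =
    (fun f => u (slice_int v f)).
  apply/funext => g; congr (u _); apply: to_test_ext => y.
  by rewrite slice_intE.
by rewrite /tensor E to_distrE//; exact: is_distribution_slice_int.
Qed.

Lemma supp_tensor v (u : distr R m) :
  supp (tensor v u) `<=` [set z | fsupp v (lsubmx z)].
Proof.
move=> z; apply: contraPP => hz; apply; exists (~` [set z | fsupp v (lsubmx z)]) => //.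
split.
  apply: closed_openC; apply: (@preimage_closed _ _ (@lsubmx R 1 n m)).
    by move=> x _; exact: lsubmx_continuous.
  exact: closed_fsupp.
move=> f fv; rewrite tensorE (_ : slice_int v f = 0) ?distr0//.
apply: test_ext => y; rewrite slice_intE (_ : (fun x => _) = fun=> 0) ?cint0//.
apply/funext => x; have [fx|/fsupp_out ->] := pselect (fsupp f (row_mx x y)).
  by have := fv _ fx; rewrite /= row_mxKl => /fsupp_out ->; rewrite mul0r.
by rewrite mulr0.
Qed.

(** The tube lemma for two compact factors, by [compact_ind] on each of them. *)
Lemma tube (A : set 'rV[R]_n) (C : set 'rV[R]_m) (U : set 'rV[R]_(n + m)) :
  compact A -> compact C -> open U -> (forall x y, A x -> C y -> U (row_mx x y)) ->
  exists G H, [/\ open G, open H, A `<=` G, C `<=` H &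
    forall x y, G x -> H y -> U (row_mx x y)].
Proof.
move=> cA cC oU ACU.
have step x : (forall y, C y -> U (row_mx x y)) -> exists G H,
    [/\ open G, open H, G x, C `<=` H & forall x y, G x -> H y -> U (row_mx x y)].
  move=> xC; apply: (@compact_ind _ (fun C => exists G H,
    [/\ open G, open H, G x, C `<=` H & forall x y, G x -> H y -> U (row_mx x y)])) cC _ _ _ _.
  - by exists setT, set0; split=> //; first [exact: openT|exact: open0].
  - move=> C1 C2 [G1 [H1 [oG1 oH1 Gx1 CH1 U1]]] [G2 [H2 [oG2 oH2 Gx2 CH2 U2]]].
    exists (G1 `&` G2), (H1 `|` H2); split=> //.
    + exact: openI.
    + exact: openU.
    + exact: setUSS.
    + by move=> x' y [g1 g2] [h1|h2]; [exact: U1|exact: U2].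
  - move=> C1 C2 C12 [G [H [oG oH Gx CH HU]]]; exists G, H; split=> //.
    exact: subset_trans CH.
  - move=> y /xC Uxy.
    have : nbhs (x, y) ((fun p : 'rV[R]_n * 'rV[R]_m => row_mx p.1 p.2) @^-1` U).
      by apply: (@row_mx_continuous R n m); exact: open_nbhs_nbhs.
    move=> [[P Q] /= [+ +] PQ]; rewrite !nbhsE => -[G [oG Gx] GP] [H [oH Hy] HQ].
    exists H; split=> //; exists G, H; split=> // x' y' Gx' Hy'.
    by apply: (PQ (x', y')); split; [exact: GP|exact: HQ].
apply: (@compact_ind _ (fun A => exists G H,
    [/\ open G, open H, A `<=` G, C `<=` H & forall x y, G x -> H y -> U (row_mx x y)])) cA _ _ _ _.
- by exists set0, setT; split=> //; first [exact: openT|exact: open0].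
- move=> C1 C2 [G1 [H1 [oG1 oH1 Gx1 CH1 U1]]] [G2 [H2 [oG2 oH2 Gx2 CH2 U2]]].
  exists (G1 `|` G2), (H1 `&` H2); split=> //.
  + exact: openU.
  + exact: openI.
  + exact: setUSS.
  + by move=> y Cy; split; [exact: CH1|exact: CH2].
  + by move=> x' y [g1|g2] [h1 h2]; [exact: U1|exact: U2].
- move=> C1 C2 C12 [G [H [oG oH AG CH HU]]]; exists G, H; split=> //.
  exact: subset_trans AG.
- move=> x Ax; have [|G [H [oG oH Gx CH HU]]] := step x; first by move=> y; exact: ACU.
  by exists G; split=> //; exists G, H; split.
Qed.

End TensorProducts.

(** * The extended pairing with a tensor product *)

Section TensorSmoothness.
Variables (R : realType) (n m : nat) (v : testfun R n) (u : distr R m).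
Local Notation w := (tensor v u).

Lemma smooth_slice (U : set 'rV[R]_(n + m)) (b : 'rV[R]_(n + m) -> R[i]^o)
    (x : 'rV[R]_n) : open U -> smooth_on U b ->
  open [set y : 'rV[R]_m | U (row_mx x y)] /\
  smooth_on [set y : 'rV[R]_m | U (row_mx x y)] (fun y => b (row_mx x y)).
Proof.
move=> oU sb; have cL := @row_mxr_continuous R n m x.
have oW : open [set y : 'rV[R]_m | U (row_mx x y)] by move/continuousP : cL; apply.
split=> //; apply: (@smooth_on_comp _ _ _ (fun y : 'rV[R]_m => row_mx x y) U) => //.
by move=> i; right; exists (rshift n i), 1 => y h; rewrite mulr1 row_mx_line.
Qed.

Lemma ccs_slice_outer (q : testfun R (n + m)) x :
  ccs (fun y : 'rV[R]_m => q (row_mx x y)).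
Proof.
have [cq [B B0 q0]] := ccs_test q; split.
  exact: (ccont_comp (@row_mxr_continuous R n m x) cq).
by exists B => // y By; apply: q0; apply: lt_le_trans By _; exact: norm_row_mxr.
Qed.

Lemma ccont_inner_int (q : testfun R (n + m)) :
  ccont (fun x : 'rV[R]_n => cint (fun y : 'rV[R]_m => q (row_mx x y)) : R[i]^o).
Proof.
have [cq [B B0 q0]] := ccs_test q.
apply: (cint_param_ccont (B := B)) => //.
  exact: (ccont_comp (@row_mx_continuous R n m) cq).
by move=> x y By; apply: q0; apply: lt_le_trans By _; exact: norm_row_mxr.
Qed.

Lemma tensor_tensor_test (rho : testfun R n) (phi : testfun R m) :
  w (tensor_test rho phi) = cint (fun x => v x * rho x) * u phi.
Proof.
rewrite tensorE -distrZ; congr (u _); apply: test_ext => y.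
rewrite slice_intE -[RHS]/(_ * phi y) mulrC -cintZ.
  by congr cint; apply/funext => x; rewrite tensor_test_row mulrA mulrC.
by apply: ccs_mul; [exact/smooth_ccont/test_smooth|exact: ccs_test].
Qed.

(** On the slice through [x0], [u] is [b(x0, y) / v(x0)].  To see this without
    dividing by [v] near [x0], test [w] on [(rho eta) (x) phi] for arbitrary [rho]
    and a fixed cutoff [eta]: both [v eta u(phi)] and the inner integral of
    [b eta phi] then have the same integral against every [rho], so they agree,
    in particular at [x0]. *)
Lemma tensor_smooth_right x0 y0 : v x0 != 0 -> ~ sing_supp w (row_mx x0 y0) ->
  ~ sing_supp u y0.
Proof.
move=> vx0 Uxy0.
have [b [sb wb]] := @equals_smooth_sing_supp _ _ w.
have oU := @open_sing_supp_compl _ _ w.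
set U := ~` sing_supp w in sb wb oU.
have [oW sW] := smooth_slice x0 oU sb.
set W := [set y : 'rV[R]_m | U (row_mx x0 y)] in oW sW.
pose beta y := (v x0)^-1 * b (row_mx x0 y).
suff uW : equals_smooth_on u W beta.
  by apply; exists W => //; split=> //; exists beta.
split; first exact: (smooth_on_M oW (@smooth_on_cst _ _ _ _) sW).
move=> phi phiW.
have [G [H [oG oH xG phiH GHU]]] : exists G H, [/\ open G, open H, [set x0] `<=` G,
    fsupp phi `<=` H & forall x y, G x -> H y -> U (row_mx x y)].
  apply: tube => //; [exact: compact_set1|exact: test_compact|].
  by move=> x y -> /phiW.
have [r [eta [r0 etaG eta1 _]]] := bump_at oG (xG x0 erefl).
have etax0 : eta x0 = 1 by apply: eta1; rewrite subrr normr0.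
pose T := tensor_test eta phi.
have TU : fsupp T `<=` U.
  by move=> z /fsupp_tensor_test[/etaG Gz /phiH Hz]; rewrite -(hsubmxK z); exact: GHU.
pose g x : R[i]^o := cint (fun y : 'rV[R]_m => tmul b T (row_mx x y)).
have bT x y : tmul b T (row_mx x y) = b (row_mx x y) * (eta x * phi y).
  by rewrite (tmul_onE oU)// tensor_test_row.
have key : v x0 * eta x0 * u phi + (-1) * g x0 = 0.
  apply: (@cint_orthogonal R n (fun x => v x * eta x * u phi + (-1) * g x)).
    have c1 : ccont (fun x => v x * eta x * u phi : R[i]^o).
      apply: ccontM; last exact/smooth_ccont/smooth_on_cst.
      by apply: ccontM; exact/smooth_ccont/test_smooth.
    have c2 : ccont (fun x => -1 * g x : R[i]^o).
      by apply: ccontM; [exact/smooth_ccont/smooth_on_cst|exact: ccont_inner_int].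
    case: c1 c2 => c1 c1' [c2 c2']; split=> x.
      rewrite (_ : (fun x => _) = fun x => complex.Re (v x * eta x * u phi) + complex.Re (-1 * g x)).
        exact: (cvgD (c1 x) (c2 x)).
      by apply/funext => x'; exact: raddfD.
    rewrite (_ : (fun x => _) = fun x => complex.Im (v x * eta x * u phi) + complex.Im (-1 * g x)).
      exact: (cvgD (c1' x) (c2' x)).
    by apply/funext => x'; exact: raddfD.
  move=> rho.
  pose P := tensor_test (tmul rho eta) phi.
  have PU : fsupp P `<=` U.
    move=> z /fsupp_tensor_test[+ /phiH Hz].
    rewrite tmulE; last exact: test_smooth.
    by move=> /fsuppM[_ /etaG Gz]; rewrite -(hsubmxK z); exact: GHU.
  have E1 := tensor_tensor_test (tmul rho eta) phi; rewrite -/P in E1.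
  have E2 : w P = cint (fun x => g x * rho x).
    rewrite wb// cint_iter; congr cint; apply/funext => x.
    rewrite /g mulrC -cintZ; last exact: ccs_slice_outer.
    congr cint; apply/funext => y.
    rewrite bT /P tensor_test_row tmulE; last exact: test_smooth.
    by ring.
  have -> : (fun x => (v x * eta x * u phi + -1 * g x) * rho x) =
      (fun x => u phi * (v x * tmul rho eta x) + (-1) * (g x * rho x)).
    by apply/funext => x; rewrite tmulE; [ring|exact: test_smooth].
  have cvr : ccs (fun x => v x * tmul rho eta x).
    by apply: ccs_mul; [exact/smooth_ccont/test_smooth|exact: ccs_test].
  have cgr : ccs (fun x => g x * rho x).
    by apply: ccs_mul; [exact: ccont_inner_int|exact: ccs_test].
  have cc1 := @smooth_ccont _ _ _ (@smooth_on_cst R n setT (u phi)).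
  have cc2 := @smooth_ccont _ _ _ (@smooth_on_cst R n setT (-1)).
  rewrite (cintD (ccs_mul cc1 cvr) (ccs_mul cc2 cgr)) !cintZ//.
  by rewrite -E2 E1 mulrC mulN1r subrr.
have {}key : v x0 * u phi = g x0.
  by apply/eqP; rewrite -subr_eq0 -mulN1r -[v x0]mulr1 -{1}etax0 key.
rewrite -[LHS]mul1r -(mulVf vx0) -mulrA key /g -cintZ; last exact: ccs_slice_outer.
by congr cint; apply/funext => y; rewrite bT etax0 mul1r mulrA.
Qed.

(** Fubini: the definition of [v (x) u] integrates [x] first, the smooth function
    is integrated with [x] outermost. *)
Lemma tensor_equals_smooth (beta : 'rV[R]_m -> R[i]^o) :
  equals_smooth_on u (~` sing_supp u) beta ->
  equals_smooth_on w [set z | (~` sing_supp u) (rsubmx z)]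
    (fun z => v (lsubmx z) * beta (rsubmx z)).
Proof.
have oY := @open_sing_supp_compl _ _ u; set Y := ~` sing_supp u in oY *.
move=> [sbeta ubeta].
have cr := @rsubmx_continuous R n m.
have oZ : open [set z : 'rV[R]_(n + m) | Y (rsubmx z)] by move/continuousP : cr; apply.
have sb : smooth_on [set z : 'rV[R]_(n + m) | Y (rsubmx z)]
    (fun z => v (lsubmx z) * beta (rsubmx z)).
  apply: (smooth_on_M oZ); last exact: smooth_on_rsubmx.
  exact: (smooth_on_sub (@subsetT _ _) (@smooth_lsubmx R n m v)).
split=> // f fZ.
rewrite tensorE ubeta; last first.
  by apply: subset_trans (@fsupp_slice_int _ _ _ v f) _ => _ [z /fZ hz <-].
rewrite (cint_fubini (ccs_tmul_on oZ sb fZ)); congr cint; apply/funext => y.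
rewrite slice_intE -cintZ; last exact: mul_slice_ccs.
by congr cint; apply/funext => x; rewrite row_mxKl row_mxKr mulrCA mulrA.
Qed.

Lemma sub_sing_supp_tensor z : ~ sing_supp u (rsubmx z) -> ~ sing_supp w z.
Proof.
move=> uz; have [beta ub] := @equals_smooth_sing_supp _ _ u.
apply; exists [set z | (~` sing_supp u) (rsubmx z)] => //.
split; last by exists (fun z => v (lsubmx z) * beta (rsubmx z)); exact: tensor_equals_smooth.
have cr := @rsubmx_continuous R n m.
by move/continuousP : cr; apply; exact: open_sing_supp_compl.
Qed.

(** Otherwise [w] is smooth near [(x, y)], hence at some [(x0, y)] with [v x0] nonzero
    as [x] is a limit of such points, which makes [u] smooth at [y]. *)
Lemma sing_supp_tensor_sup x y : fsupp v x -> sing_supp u y ->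
  sing_supp w (row_mx x y).
Proof.
move=> vx uy; apply: contrapT => Uxy.
have cL := @row_mxl_continuous R n m y.
have oW : open [set x' : 'rV[R]_n | (~` sing_supp w) (row_mx x' y)].
  by move/continuousP : cL; apply; exact: open_sing_supp_compl.
have [x' [/= vx' Ux']] := vx _ (open_nbhs_nbhs (conj oW Uxy)).
exact: (tensor_smooth_right vx' Ux' uy).
Qed.

End TensorSmoothness.

Section Core.
Variables (R : realType) (n m : nat) (K : distr R (n + m)) (v : testfun R n)
  (u : distr R m) (psi : 'rV[R]_m -> R[i]^o).
Hypothesis spsi : smooth_on setT psi.
Hypothesis kernel : forall phi : testfun R m,
  K (tensor_test v phi) = cint (fun y => phi y * psi y).
Local Notation w := (tensor v u).
Hypothesis disj : sing_supp K `&` sing_supp w = set0.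

(** The heart of the matter: the singularities of [u] and those of [K] above the
    support of [v] are separated by a function [th] of [y] alone. *)
Lemma product_on_tensor_test (h : distr R (n + m)) (chi : testfun R m) :
  is_mul w K h -> exists2 eta : testfun R n, equals1_around (fsupp v) eta &
    h (tensor_test eta chi) = u (tmul psi chi).
Proof.
move=> [[a [sa Ka] ha] [b [sb wb] hb]].
have oK := @open_sing_supp_compl _ _ K; have oW := @open_sing_supp_compl _ _ w.
have [beta ub] := @equals_smooth_sing_supp _ _ u; have [sbeta ubeta] := ub.
have oY := @open_sing_supp_compl _ _ u.
have wvb := tensor_equals_smooth v ub.
set U1 := ~` sing_supp K in sa Ka ha oK; set U2 := ~` sing_supp w in sb wb hb oW.
set Y := ~` sing_supp u in sbeta ubeta oY wvb ub.
set Z := [set z : 'rV[R]_(n + m) | Y (rsubmx z)] in wvb.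
have oZ : open Z.
  have cr := @rsubmx_continuous R n m.
  by move/continuousP : cr; apply.
have ZU2 : Z `<=` U2 by move=> z; exact: sub_sing_supp_tensor.
have bE z : Z z -> b z = v (lsubmx z) * beta (rsubmx z).
  move=> Zz; exact: (equals_smooth_unique oW oZ (conj sb wb) wvb (ZU2 _ Zz) Zz).
have cS : compact (fsupp chi `&` sing_supp u).
  apply: (@subclosed_compact _ _ (fsupp chi)).
  - apply: closedI; first exact: closed_fsupp.
    by rewrite -[sing_supp u]setCK; exact: open_closedC.
  - exact: test_compact.
  - exact: subIsetl.
have [G [H [oG oH vG SH GHU]]] : exists G H, [/\ open G, open H, fsupp v `<=` G,
    fsupp chi `&` sing_supp u `<=` H & forall x y, G x -> H y -> U1 (row_mx x y)].
  apply: tube => //; first exact: test_compact.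
  move=> x y vx [_ uy] Ks.
  have ws := sing_supp_tensor_sup vx uy.
  by have : (sing_supp K `&` sing_supp w) (row_mx x y) by []; rewrite disj.
have [eta [etaG [G1 [oG1 vG1] eta1]]] := cutoff (@test_compact _ _ v) oG vG.
have [th [thH [H1 [oH1 SH1] th1]]] := cutoff cS oH SH.
exists eta; first by exists G1.
have veta x : v x * eta x = v x.
  by have [/vG1/eta1 ->|/fsupp_out ->] := pselect (fsupp v x); rewrite ?mulr1 ?mul0r.
(* the part of [chi] that lives where [u] is smooth *)
pose kap := chi - tmul th chi.
have kapE y : kap y = chi y - th y * chi y.
  by rewrite /kap testB_val tmul_testP.
have kapY : fsupp kap `<=` Y.
  have : fsupp kap `<=` fsupp chi `&` ~` H1.
    apply: fsupp_subset.
      apply: closedI; first exact: closed_fsupp.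
      exact: open_closedC.
    move=> y /not_andP[/fsupp_out|/contrapT/th1]; rewrite kapE => ->.
      by rewrite mulr0 subr0.
    by rewrite mul1r subrr.
  by move=> sub y /sub[cy nH1] uy; apply/nH1/SH1.
pose q1 := tensor_test eta (tmul th chi); pose q2 := tensor_test eta kap.
have -> : tensor_test eta chi = q1 + q2.
  apply: test_ext => z; rewrite testD_val /q1 /q2 !tensor_testE kapE.
  by rewrite tmul_testP; ring.
pose F := tensor_test eta th.
have FU1 : fsupp F `<=` U1.
  by move=> z /fsupp_tensor_test[/etaG Gz /thH Hz]; rewrite -(hsubmxK z); exact: GHU.
have q1U1 : fsupp q1 `<=` U1.
  move=> z /fsupp_tensor_test[/etaG Gz /fsupp_tmul/thH Hz].
  by rewrite -(hsubmxK z); exact: GHU.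
have q2Z : fsupp q2 `<=` Z by move=> z /fsupp_tensor_test[_ /kapY].
have q1E x y : q1 (row_mx x y) = eta x * (th y * chi y).
  by rewrite tensor_test_row tmul_testP.
have q2E z : q2 z = eta (lsubmx z) * kap (rsubmx z) by rewrite tensor_testE.
have FE x y : F (row_mx x y) = eta x * th y by rewrite tensor_test_row.
clearbody q1 q2 F.
(* above the support of [th] the integral of [v * a] in [x] is [psi] *)
have J y : slice_int v (tmul a F) y = th y * psi y.
  have sJ := smooth_ccont (test_smooth (slice_int v (tmul a F))).
  apply/eqP; rewrite -subr_eq0; apply/eqP.
  have cp : ccont (fun y => th y * psi y : R[i]^o).
    by apply: ccontM; [exact/smooth_ccont/test_smooth|exact/smooth_ccont].
  pose tp := tmul psi th.
  have tpE y' : tp y' = th y' * psi y' by rewrite /tp (tmulP _ _ spsi) mulrC.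
  rewrite -tpE -testB_val.
  apply: (@cint_orthogonal R m (slice_int v (tmul a F) - tp)).
    exact/smooth_ccont/test_smooth.
  move=> phi.
  have -> : (fun y => (slice_int v (tmul a F) - tp) y * phi y) =
      (fun y => slice_int v (tmul a F) y * phi y + (-1) * (tp y * phi y)).
    by apply/funext => y'; rewrite testB_val; ring.
  have c1 : ccs (fun y => slice_int v (tmul a F) y * phi y).
    by apply: ccs_mul => //; exact: ccs_test.
  have c2 : ccs (fun y => tp y * phi y).
    by apply: ccs_mul; [exact/smooth_ccont/test_smooth|exact: ccs_test].
  have cc2 := @smooth_ccont _ _ _ (@smooth_on_cst R m setT (-1)).
  rewrite (cintD c1 (ccs_mul cc2 c2)) cintZ//.
  pose T := tensor_test v (tmul th phi).
  have TU1 : fsupp T `<=` U1.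
    move=> z /fsupp_tensor_test[/vG Gz /fsupp_tmul/thH Hz].
    by rewrite -(hsubmxK z); exact: GHU.
  have E1 : cint (fun y => slice_int v (tmul a F) y * phi y) = K T.
    rewrite Ka// (cint_fubini (ccs_tmul_on oK sa TU1)); congr cint.
    apply/funext => y'; rewrite slice_intE mulrC -cintZ; last exact: mul_slice_ccs.
    congr cint; apply/funext => x.
    rewrite (tmul_onE oK sa FU1) FE /T tensor_test_row tmul_testP.
    by rewrite -[v x in RHS]veta; ring.
  rewrite E1 /T kernel (_ : (fun y => tp y * phi y) = fun y => tmul th phi y * psi y).
    by rewrite mulN1r subrr.
  by apply/funext => y'; rewrite tpE tmul_testP; ring.
have E1 : h q1 = u (tmul psi (tmul th chi)).
  rewrite ha// -/(tmul a q1) tensorE; congr (u _); apply: test_ext => y.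
  rewrite (tmulP _ _ spsi) tmul_testP.
  transitivity (chi y * slice_int v (tmul a F) y); last by rewrite J; ring.
  apply: slice_int_scale => x.
  rewrite (tmul_onE oK sa q1U1) (tmul_onE oK sa FU1) q1E FE.
  by ring.
have E2 : h q2 = u (tmul psi kap).
  rewrite hb; last exact: subset_trans ZU2.
  have -> : to_test (fun z => b z * q2 z) = tensor_test v (tmul beta kap).
    apply: to_test_ext => z; rewrite tensor_testE (tmul_onE oY sbeta kapY).
    rewrite q2E; have [->|k0] := eqVneq (kap (rsubmx z)) 0.
      by rewrite !mulr0.
    have Zz : Z z by apply: kapY; exact: subset_closure.
    by rewrite bE// -[v _ in RHS]veta; ring.
  rewrite kernel ubeta; last by rewrite (tmulE _ spsi) => y /fsuppM[_ /kapY].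
  congr cint; apply/funext => y; rewrite (tmul_onE oY sbeta kapY) (tmulP _ _ spsi).
  by ring.
have tT (p : testfun R m) : fsupp p `<=` setT by [].
rewrite distrD E1 E2 -distrD -(tmul_onD openT spsi (tT _) (tT _)).
congr (u (tmul psi _)); apply: test_ext => y.
by rewrite testD_val kapE tmul_testP; ring.
Qed.

Lemma tensor_testB_around (A : set 'rV[R]_(n + m)) (p : testfun R (n + m))
    (eta : testfun R n) (chi : testfun R m) :
  equals1_around A p -> equals1_around (lsubmx @` A) eta ->
  equals1_around (rsubmx @` A) chi -> fsupp (p - tensor_test eta chi) `<=` ~` A.
Proof.
move=> [U [oU AU] p1] [G [oG AG] eta1] [H [oH AH] chi1].
have cl := @lsubmx_continuous R n m; have cr := @rsubmx_continuous R n m.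
have oG' : open [set z : 'rV[R]_(n + m) | G (lsubmx z)] by move/continuousP : cl; apply.
have oH' : open [set z : 'rV[R]_(n + m) | H (rsubmx z)] by move/continuousP : cr; apply.
have sub : fsupp (p - tensor_test eta chi) `<=`
    ~` (U `&` ([set z | G (lsubmx z)] `&` [set z | H (rsubmx z)])).
  apply: fsupp_subset; first by apply: open_closedC; do 2?apply: openI.
  move=> z /contrapT[Uz [Gz Hz]].
  by rewrite testB_val tensor_testE p1// eta1// chi1// mulr1 subrr.
move=> z /sub hz Az; apply: hz; split; first exact: AU.
by split; [apply: AG|apply: AH]; exists z.
Qed.

Hypothesis compact_supports : compact (supp K `&` supp w).

Lemma pairing_tensor (chi : testfun R m) :
  equals1_around (rsubmx @` (supp K `&` supp w)) chi ->
  pairing K w = u (tmul psi chi).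
Proof.
move=> chi1.
have mh : is_mul w K (distr_mul w K).
  apply: (@xgetPex _ 0 [set h | is_mul w K h]).
  exact: is_mul_exists disj.
rewrite /pairing; set h := distr_mul w K in mh *.
have hK : supp h `<=` supp K by apply: supp_is_mul_on mh.1.
have hw : supp h `<=` supp w by apply: supp_is_mul_on mh.2.
have ch : compact (supp h).
  apply: (@subclosed_compact _ _ (supp K `&` supp w)) => //.
    by rewrite -[supp h]setCK; apply: open_closedC; exact: open_supp_compl.
  by move=> z hz; split; [exact: hK|exact: hw].
have [p0 [_ [U0 [oU0 hU0] p01]]] := cutoff ch openT (@subsetT _ _).
have := @xgetPex _ 0 [set p : testfun R (n + m) | equals1_around (supp h) p].
move=> /(_ (ex_intro _ p0 (ex_intro2 _ _ U0 (conj oU0 hU0) p01))).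
set p := xget _ _ => /= p1.
have [eta [G [oG vG] eta1] <-] := product_on_tensor_test chi mh.
apply/eqP; rewrite -subr_eq0 -distrB; apply/eqP/supp_vanishes.
apply: tensor_testB_around => //.
  exists G => //; split=> // _ [z hz <-]; apply: vG.
  exact: (@supp_tensor _ _ _ v u z (hw _ hz)).
have [H [oH CH] chi1'] := chi1; exists H => //; split=> // _ [z hz <-]; apply: CH.
by exists z => //; split; [exact: hK|exact: hw].
Qed.

End Core.

(** * Weak-star continuous maps have transposes *)

Section WeakDuality.
Variable R : realType.

Lemma linear_at0 (X Y : lmodType R[i]) (f : X -> Y) : linear f -> f 0 = 0.
Proof.
by move=> lf; have := lf 1 0 0; rewrite !scale1r addr0 => h; apply: (addrI (f 0)); rewrite -h addr0.
Qed.

(** The classical fact that a linear functional which vanishes on the common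
    kernel of finitely many others is a combination of them; as [ev] is linear in
    its second argument, the combination is evaluation at one element. *)
Lemma span_of_kernels (X I : lmodType R[i]) (ev : X -> I -> R[i]^o) :
  (forall i, linear (ev^~ i)) -> (forall x, linear (ev x)) ->
  forall (s : seq I) (L : X -> R[i]^o), linear L ->
  (forall x, (forall i, i \in s -> ev x i = 0) -> L x = 0) ->
  exists i, forall x, L x = ev x i.
Proof.
move=> lx li.
have ev0 x : ev x 0 = 0 by exact: linear_at0 (li x).
have evZ x c i : ev x (c *: i) = c * ev x i.
  by have := li x c i 0; rewrite ev0 !addr0.
have evD x i j : ev x (i + j) = ev x i + ev x j.
  by have := li x 1 i j; rewrite !scale1r.
elim=> [|i s IH] L lL hL; first by exists 0 => x; rewrite ev0 hL.
(* either [ev i] is redundant, or subtracting a multiple of it reduces to [s] *)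
have [[x0 [x0s x0i]]|none] :=
    pselect (exists x0, (forall j, j \in s -> ev x0 j = 0) /\ ev x0 i != 0); last first.
  apply: IH => // x xs; apply: hL => j; rewrite inE => /predU1P[->|]; last exact: xs.
  by apply/eqP; apply: contra_notT none => xi; exists x.
pose c := L x0 / ev x0 i.
have [k hk] : exists k, forall x, L x - c * ev x i = ev x k.
  apply: (IH (fun x => L x - c * ev x i)).
    move=> a x y; rewrite lL (lx i) -![_ *: _]/(_ * _).
    by ring.
  move=> x xs.
  have := hL (- (ev x i / ev x0 i) *: x0 + x) _.
  rewrite lL => H.
  have {}H := H _.
  have -> : c * ev x i = ev x i / ev x0 i * L x0 by rewrite /c; ring.
  rewrite -[RHS](H _) -?[_ *: L x0]/(_ * _); first by rewrite mulNr addrC.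
  move=> j; rewrite inE lx -[_ *: _]/(_ * _) => /predU1P[->|js].
    by rewrite mulNr mulfVK// addNr.
  by rewrite (x0s j js) (xs j js) mulr0 addr0.
exists (k + c *: i) => x; rewrite evD evZ -hk.
by rewrite subrK.
Qed.

(** Apply the continuity of [L] to the filter of weak neighbourhoods of zero: [L]
    is bounded by 1 where finitely many evaluations are small, hence vanishes where
    they vanish. *)
Lemma weak_functional (X I : lmodType R[i]) (ev : X -> I -> R[i]^o) (L : X -> R[i]^o) :
  (forall i, linear (ev^~ i)) -> (forall x, linear (ev x)) -> linear L ->
  (forall F : set_system X, Filter F ->
    (forall i, (ev^~ i) @ F --> (0 : R[i]^o)) -> F [set x | `|L x| < 1]) ->
  exists i, forall x, L x = ev x i.
Proof.
move=> lx li lL cL.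
pose F : set_system X := [set A | exists (s : seq I) (e : R), 0 < e /\
  forall x, (forall i, i \in s -> `|ev x i| < e%:C) -> A x].
have FF : Filter F.
  split.
  - by exists [::], 1; split.
  - move=> A B [s [e [e0 hA]]] [t [d [d0 hB]]].
    exists (s ++ t), (Num.min e d); split=> [|x hx]; first by rewrite lt_min e0.
    split; [apply: hA|apply: hB] => i ist.
      apply: (lt_le_trans (hx i _)); first by rewrite mem_cat ist.
      by rewrite lecR ge_min lexx.
    apply: (lt_le_trans (hx i _)); first by rewrite mem_cat ist orbT.
    by rewrite lecR ge_min lexx orbT.
  - by move=> A B AB [s [e [e0 hA]]]; exists s, e; split=> // x /hA/AB.
have [s [e [e0 hs]]] : F [set x | `|L x| < 1].
  apply: cL => i; apply/cvgr0Pnorm_lt => e e0; exists [:: i], (complex.Re e).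
  have eE : (complex.Re e)%:C = e by rewrite RRe_real// gtr0_real.
  split; first by rewrite -ltcR eE.
  by move=> x hx; rewrite -eE; apply: hx; rewrite inE.
apply: (@span_of_kernels _ _ ev lx li s L lL) => x xs.
apply/eqP; apply: contraT => Lx0.
have LZ c y : L (c *: y) = c * L y.
  by have := lL c y 0; rewrite (linear_at0 lL) !addr0.
have /= := hs ((L x)^-1 *: x) _.
rewrite LZ mulVf// normr1 ltxx; apply => i is_.
have ex0 : ev 0 i = 0 by exact: linear_at0 (lx i).
by have := lx i (L x)^-1 x 0; rewrite addr0 ex0 xs// scaler0 addr0 => ->; rewrite normr0 ltcR.
Qed.

Lemma cvg_initial (S : choiceType) (T : topologicalType) (f : S -> T)
    (F : set_system S) (s : S) : Filter F ->
  F --> (s : initial_topology f) <-> f @ F --> f s.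
Proof.
move=> FF; split=> [h|h A].
  apply: cvg_comp h _; exact: initial_continuous.
move=> [_ [[B Bop <-] Bfs sBfA]].
have FB : F (f @^-1` B) by apply: h; exact: open_nbhs_nbhs.
exact: filterS FB.
Qed.

Lemma cvg_ptws (U : Type) (V : topologicalType) (F : set_system {ptws U -> V})
    (g : {ptws U -> V}) : Filter F ->
  F --> g <-> forall t, (fun f : U -> V => f t) @ F --> g t.
Proof.
move=> FF; rewrite cvg_sup; split=> h t.
  exact: (@cvg_initial _ V (fun f : U -> V => f t) F g FF).1 (h t).
exact: (@cvg_initial _ V (fun f : U -> V => f t) F g FF).2 (h t).
Qed.

Lemma distr_cvgP N (F : set_system (distr R N)) (T : distr R N) : Filter F ->
  F --> T <-> forall f : testfun R N, (fun S : distr R N => S f) @ F --> T f.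
Proof.
move=> FF.
have H1 := @cvg_initial (distr R N) {ptws testfun R N -> R[i]^o} (@distr_val R N) F T FF.
have H2 := @cvg_ptws _ (R[i]^o) (@distr_val R N @ F) (distr_val T) _.
by split=> [/H1/H2//|h]; apply/H1/H2.
Qed.

Lemma tempered_cvgP N (F : set_system (tempered R N)) (T : tempered R N) : Filter F ->
  F --> T <-> forall f : schwartz R N, (fun S : tempered R N => S f) @ F --> T f.
Proof.
move=> FF.
have H1 := @cvg_initial (tempered R N) {ptws schwartz R N -> R[i]^o} (@tempered_val R N) F T FF.
have H2 := @cvg_ptws _ (R[i]^o) (@tempered_val R N @ F) (tempered_val T) _.
by split=> [/H1/H2//|h]; apply/H1/H2.
Qed.

Lemma distr_transpose n (A : {linear distr R n -> distr R n}) (v : testfun R n) :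
  continuous A -> exists psi : testfun R n, forall u, A u v = u psi.
Proof.
move=> cA.
apply: (@weak_functional (distr R n) (testfun R n) (fun u f => u f) (fun u => A u v)).
- by [].
- by move=> u; exact: (distr_is u).1.
- by move=> a x y; rewrite linearP.
- move=> F FF hF.
  have F0 : F --> (0 : distr R n) by apply/distr_cvgP => f; exact: hF.
  have AF : A @ F --> (0 : distr R n).
    by apply: cvg_comp F0 _; have := cA 0; rewrite /continuous_at linear0.
  have h : (fun u => A u v) @ F --> (0 : R[i]^o) by exact: (distr_cvgP _ _).1 AF v.
  exact: ((@cvgr0Pnorm_lt _ _ _ F FF _).1 h 1 ltr01).
Qed.

Lemma tempered_is n (u : tempered R n) : is_tempered u.
Proof. by have /asboolP := temperedP u. Qed.

Lemma tempered_transpose n (A : {linear tempered R n -> tempered R n})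
    (f : schwartz R n) :
  continuous A -> exists psi : schwartz R n, forall u, A u f = u psi.
Proof.
move=> cA.
apply: (@weak_functional (tempered R n) (schwartz R n) (fun u f => u f) (fun u => A u f)).
- by [].
- by move=> u; exact: (tempered_is u).1.
- by move=> a x y; rewrite linearP.
- move=> F FF hF.
  have F0 : F --> (0 : tempered R n) by apply/tempered_cvgP => g; exact: hF.
  have AF : A @ F --> (0 : tempered R n).
    by apply: cvg_comp F0 _; have := cA 0; rewrite /continuous_at linear0.
  have h : (fun u => A u f) @ F --> (0 : R[i]^o) by exact: (tempered_cvgP _ _).1 AF f.
  exact: ((@cvgr0Pnorm_lt _ _ _ F FF _).1 h 1 ltr01).
Qed.

End WeakDuality.

(** * Truncation and the extended kernel formula *)

Section Dilations.
Variables (R : realType) (N : nat).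
Local Notation V := 'rV[R]_N.

Lemma rpartial_dilation (c : R) (f : V -> R) s : rsmooth_on setT f ->
  rpartial s (fun x => f (c *: x)) = fun x => c ^+ size s * rpartial s f (c *: x).
Proof.
move=> sf; elim: s => [|i s IH] /=; first by apply/funext => x; rewrite mul1r.
rewrite IH; apply/funext => x.
have ss : rsmooth_on setT (rpartial s f) by elim: (s) => [//|j t ih]; exact: rsmooth_pd.
have df := derivableP ((ss [::] (c *: x) I).2 i).
have L (h : R) : c *: (h *: 'e_i + x) = h * c *: 'e_i + c *: x.
  by rewrite scalerDr scalerA mulrC.
have D := is_derive_comp_affine L df.
have := is_deriveZ (c ^+ size s) D; case=> _.
by move=> E; apply: (etrans E); rewrite -[LHS]/(_ * (c * _)) exprSr mulrA.
Qed.

Lemma test_dilation (chi : testfun R N) (c : R) : 0 < c ->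
  is_test (fun x => chi (c *: x)).
Proof.
move=> c0; split.
  apply: (@smooth_on_comp _ _ _ (fun x : V => c *: x) setT setT chi) => //; try exact: openT.
  - by move=> x; exact: scaler_continuous.
  - by move=> i; right; exists i, c => x h; rewrite scalerDr scalerA mulrC.
  - exact: test_smooth.
have [_ [B B0 chi0]] := ccs_test chi.
apply: (@subclosed_compact _ _ [set x : V | `|x| <= c^-1 * B]).
- exact: closed_fsupp.
- exact: rV_ball_compact.
- apply: fsupp_subset.
    by apply: compact_closed; [exact: norm_hausdorff|exact: rV_ball_compact].
  move=> x /= /negP; rewrite -ltNge => h; apply: chi0.
  by rewrite normrZ gtr0_norm// -ltr_pdivrMl.
Qed.

Lemma dilation_bound (chi : testfun R N) k : exists D : R, 0 <= D /\
  forall c : R, 0 < c -> c <= 1 -> forall s x, (size s <= k)%N ->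
    `|partial s (fun x => chi (c *: x)) x| <= D%:C.
Proof.
have [D hD] := test_bounded chi k; exists D; split.
  by rewrite -lecR; exact: le_trans (normr_ge0 _) (hD [::] 0 isT).
move=> c c0 c1 s x sk; have [s1 s2] := test_smooth chi.
have -> : partial s (fun x => chi (c *: x)) x = (c ^+ size s)%:C * partial s chi (c *: x).
  rewrite /partial -[re_part _]/(fun x => re_part chi (c *: x)).
  rewrite -[im_part _]/(fun x => im_part chi (c *: x)).
  rewrite (rpartial_dilation _ _ s1) (rpartial_dilation _ _ s2).
  by simpc.
rewrite normrM -[D%:C]mul1r; apply: ler_pM => //; last exact: hD.
by rewrite normc_def /= expr0n addr0 sqrtr_sqr normrX gtr0_norm// lecR exprn_ile1// ltW.
Qed.

(** Only points with [r <= |x|] contribute, and there one power of [1 + |x|] can be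
    spared from the decay of [psi].  The derivatives of the dilated cutoff are
    bounded uniformly in [r]. *)
Lemma schwartz_truncation (psi : schwartz R N) (chi : testfun R N) k :
  (forall x, `|x| <= 1 -> chi x = 1) -> exists E : R, forall r : R, 1 <= r ->
  forall s x, (size s <= k)%N ->
    ((1 + `|x|) ^+ k)%:C *
    `|partial s (fun x => psi x * chi (r^-1 *: x) - psi x : R[i]^o) x| <= (E / r)%:C.
Proof.
move=> chi1; have [D [D0 hD]] := dilation_bound chi k.
have [M [M0 hM]] := schwartz_bounded psi k.+1 k.
exists (4 * 2 ^+ k * (M * (D + 1))) => r r1 s x sk.
have r0 : 0 < r by lra.
have ri0 : 0 < r^-1 by rewrite invr_gt0.
have ri1 : r^-1 <= 1 by rewrite invf_le1.
pose g (x : V) : R[i]^o := chi (r^-1 *: x) - 1.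
have sg1 : smooth_on setT (fun x : V => chi (r^-1 *: x)) by exact: (test_dilation chi ri0).1.
have gE : g = 1 *: (fun x : V => chi (r^-1 *: x)) + (fun=> -1).
  by apply/funext => y; rewrite -[RHS]/(1 *: _ + -1) scale1r.
have sc : smooth_on setT (fun _ : V => -1 : R[i]^o) by exact: smooth_on_cst.
have sg : smooth_on setT g by rewrite gE; exact: (smoothZD 1 sg1 sc).
have -> : (fun x => psi x * chi (r^-1 *: x) - psi x : R[i]^o) = fun x => psi x * g x.
  by apply/funext => y; rewrite mulrBr mulr1.
have [xr|rx] := ltP `|x| r.
  rewrite partial_eq0 ?normr0 ?mulr0 ?lecR.
    by rewrite divr_ge0 ?mulr_ge0 ?exprn_ge0 ?addr_ge0// ltW.
  have sub : fsupp (fun x => psi x * g x) `<=` ~` [set y | `|y| < r].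
    apply: fsupp_subset.
      apply: open_closedC; have := @open_norm_ball R N 0 r.
      by under eq_set do rewrite subr0.
    move=> y /contrapT /= yr; rewrite /g chi1 ?subrr ?mulr0//.
    by rewrite normrZ gtr0_norm// ler_pdivrMl// mulr1 ltW.
  by move=> /sub; apply.
have w0 : 0 < 1 + `|x| by rewrite ltr_wpDr.
have wk0 : 0 < (1 + `|x|) ^+ k.+1 by rewrite exprn_gt0.
have hpsi t : (size t <= k)%N -> `|partial t psi x| <= (M / (1 + `|x|) ^+ k.+1)%:C.
  move=> tk; have := hM t x tk.
  rewrite rmorphM /= -ler_pdivlMl; last by rewrite ltcR.
  by rewrite mulrC fmorphV.
have hg t : (size t <= k)%N -> `|partial t g x| <= (D + 1)%:C.
  move=> tk; rewrite gE (partialZD 1 t x sg1 sc).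
  rewrite mul1r (le_trans (ler_normD _ _))// rmorphD; apply: lerD; first exact: hD.
  by apply: le_trans (partial_cst _ _ _) _; rewrite normrN normr1.
have := partialM_bound (schwartz_is psi).1 sg hpsi hg sk.
move=> h; apply: (@le_trans _ _ (((1 + `|x|) ^+ k)%:C *
    (4 * 2 ^+ k * (M / (1 + `|x|) ^+ k.+1 * (D + 1)))%:C)).
  by apply: ler_wpM2l => //; rewrite lecR exprn_ge0// ltW.
rewrite -rmorphM lecR.
have wk : (1 + `|x|) ^+ k != 0 by rewrite gt_eqF// exprn_gt0.
have -> : (1 + `|x|) ^+ k * (4 * 2 ^+ k * (M / (1 + `|x|) ^+ k.+1 * (D + 1))) =
    4 * 2 ^+ k * (M * (D + 1)) / (1 + `|x|).
  rewrite exprS; field; by rewrite wk gt_eqF.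
rewrite ler_wpM2l//; first by rewrite !mulr_ge0 ?exprn_ge0 ?addr_ge0.
by rewrite lef_pV2 ?posrE//; lra.
Qed.

End Dilations.

Section SmoothDistributions.
Variables (R : realType) (N : nat).

Lemma cint_mul_bound (f : testfun R N) : exists C : R,
  forall (g : 'rV[R]_N -> R[i]^o) (M : R), smooth_on setT g ->
    (forall x, `|g x| <= M%:C) -> `|cint (fun x => f x * g x)| <= (C * M)%:C.
Proof.
have [D hD] := test_bounded f 0; have [cf [B B0 f0]] := ccs_test f.
exists (2 * (2 * B) ^+ N * D) => g M sg hM; rewrite -mulrA.
apply: cint_bound => //.
- by apply: ccontM; [exact: cf|exact: smooth_ccont].
- by move=> x /f0 ->; rewrite mul0r.
- move=> x; rewrite normrM rmorphM; apply: ler_pM => //.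
  by rewrite -partial_nil; exact: hD.
Qed.

Lemma cint_mul_linear (f : testfun R N) (c : R[i]) (g h : 'rV[R]_N -> R[i]^o) :
  ccont g -> ccont h -> cint (fun x => f x * (c * g x + h x)) =
  c * cint (fun x => f x * g x) + cint (fun x => f x * h x).
Proof.
move=> cg ch.
have fg : ccs (fun x => f x * g x).
  by rewrite (_ : (fun x => _) = fun x => g x * f x);
    [exact: ccs_mul (ccs_test f)|apply/funext => x; rewrite mulrC].
have fh : ccs (fun x => f x * h x).
  by rewrite (_ : (fun x => _) = fun x => h x * f x);
    [exact: ccs_mul (ccs_test f)|apply/funext => x; rewrite mulrC].
have cc := @smooth_ccont _ _ _ (@smooth_on_cst R N setT c).
rewrite -(cintZ c fg) -(cintD (ccs_mul cc fg) fh); congr cint.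
by apply/funext => x; rewrite mulrDr mulrCA.
Qed.

Lemma distr_of_testE (f g : testfun R N) :
  distr_of_test f g = cint (fun x => f x * g x).
Proof.
rewrite /distr_of_test to_distrE//; split.
  by move=> c p q; exact: (cint_mul_linear _ _
    (smooth_ccont (test_smooth p)) (smooth_ccont (test_smooth q))).
move=> K _; have [C hC] := cint_mul_bound f; exists C, 0%N => p M _ hp.
apply: hC; first exact: test_smooth.
by move=> x; rewrite -partial_nil; exact: hp.
Qed.

Lemma tempered_of_testE (f : testfun R N) (g : schwartz R N) :
  tempered_of_test f g = cint (fun x => f x * g x).
Proof.
have T : is_tempered (fun g : schwartz R N => cint (fun x => f x * g x) : R[i]^o).
  split.
    move=> c p q; exact: (cint_mul_linear _ _
      (smooth_ccont (schwartz_is p).1) (smooth_ccont (schwartz_is q).1)).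
  have [C hC] := cint_mul_bound f; exists C, 0%N => p M hp.
  apply: hC; first exact: (schwartz_is p).1.
  by move=> x; have := hp [::] x isT; rewrite expr0 mul1r partial_nil.
by rewrite /tempered_of_test /to_tempered /insubd insubT //=; exact/asboolP.
Qed.

End SmoothDistributions.

Section Main.
Variables (R : realType) (n : nat).

(** Here [psi] has compact support, so [chi] can be taken equal to 1 on it. *)
Lemma kernel_pairing_distr (A : {linear distr R n -> distr R n})
    (K : distr R (n + n)) :
  continuous A -> is_kernel A K ->
  forall (u : distr R n) (v : testfun R n),
    compact (supp K `&` supp (tensor v u)) ->
    sing_supp K `&` sing_supp (tensor v u) = set0 ->
    A u v = pairing K (tensor v u).
Proof.
move=> cA kA u v cKw sKw.
have [psi hpsi] := distr_transpose v cA.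
have ker phi : K (tensor_test v phi) = cint (fun y => phi y * psi y).
  by rewrite -kA hpsi distr_of_testE.
have cC : compact (fsupp psi `|` rsubmx @` (supp K `&` supp (tensor v u))).
  apply: compactU; first exact: test_compact.
  apply: continuous_compact => //.
  by apply: continuous_subspaceT; exact: rsubmx_continuous.
have [chi [_ [G [oG CG] chi1]]] := cutoff cC openT (@subsetT _ _).
rewrite (@pairing_tensor _ _ _ _ _ _ _ (test_smooth psi) ker sKw cKw chi).
  rewrite hpsi; congr (u _); apply: test_ext => y; rewrite tmul_testP.
  have [py|/fsupp_out ->] := pselect (fsupp psi y); last by rewrite mul0r.
  by rewrite chi1 ?mulr1//; apply: CG; left.
by exists G => //; split=> // y hy; apply: CG; right.
Qed.

(** Here the pairing equals [u (chi psi)] for all large dilations [chi] of one cutoff,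
    and the difference with [u psi] is of order [1/r]. *)
Lemma kernel_pairing_tempered (A : {linear tempered R n -> tempered R n})
    (K : tempered R (n + n)) :
  continuous A -> is_tempered_kernel A K ->
  forall (u : tempered R n) (v : testfun R n),
    let K' := distr_of_tempered K in
    let w := tensor v (distr_of_tempered u) in
    compact (supp K' `&` supp w) ->
    sing_supp K' `&` sing_supp w = set0 ->
    A u (schwartz_of_test v) = pairing K' w.
Proof.
move=> cA kA u v K' w cKw sKw.
have [psi hpsi] := tempered_transpose (schwartz_of_test v) cA.
have spsi := (schwartz_is psi).1.
have ker phi : K' (tensor_test v phi) = cint (fun y => phi y * psi y).
  by rewrite -[LHS]/(K (schwartz_of_test (tensor_test v phi))) -kA hpsi tempered_of_testE.
have [rho [_ [G [oG CG] rho1]]] := cutoff (@rV_ball_compact R n 1) openT (@subsetT _ _).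
have {}rho1 x : `|x| <= 1 -> rho x = 1 by move=> x1; apply/rho1/CG.
have cC : compact (@rsubmx R 1 n n @` (supp K' `&` supp w)).
  apply: continuous_compact => //.
  by apply: continuous_subspaceT; exact: rsubmx_continuous.
have [B B0 hB] : exists2 M : R, 0 <= M &
    forall x, (@rsubmx R 1 n n @` (supp K' `&` supp w)) x -> `|x| <= M.
  by apply: (compact_ubound (h := id)) => // x.
have [lu [C [k hC]]] := tempered_is u.
have [E hE] := schwartz_truncation psi k rho1.
set z := pairing K' w.
suff bound r : 1 <= r -> B + 1 <= r -> `|z - u psi| <= (C * (E / r))%:C.
  rewrite hpsi; apply/eqP; rewrite eq_sym -subr_eq0 -normr_eq0; apply/negPn/negP => d0.
  have dE : (complex.Re `|z - u psi|)%:C = `|z - u psi| by rewrite RRe_real// normr_real.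
  pose d := complex.Re `|z - u psi|.
  have {}d0 : 0 < d by rewrite -ltcR dE lt_def d0 normr_ge0.
  (* large enough that [C * E / r] falls below [d] *)
  pose r := 1 + B + `|C * E| / d.
  have r1 : 1 <= r by rewrite /r -addrA lerDl addr_ge0// divr_ge0// ltW.
  have rB : B + 1 <= r by rewrite /r [1 + B]addrC lerDl divr_ge0// ltW.
  have := bound r r1 rB; rewrite -dE lecR -/d mulrA ler_pdivlMr ?(lt_le_trans ltr01)//.
  rewrite /r mulrDr mulrCA mulfV ?gt_eqF// mulr1 => h.
  have := le_trans h (ler_norm _); apply/negP; rewrite -ltNge ltrDr mulr_gt0//.
  by rewrite ltr_wpDr.
move=> r1 rB; have r0 : 0 < r by lra.
have ri0 : 0 < r^-1 by rewrite invr_gt0.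
pose chi : testfun R n := to_test (fun x => rho (r^-1 *: x)).
have chiE x : chi x = rho (r^-1 *: x) by rewrite (to_testE (test_dilation rho ri0)).
have chi1 x : `|x| < r -> chi x = 1.
  move=> xr; rewrite chiE rho1// normrZ gtr0_norm// ler_pdivrMl// mulr1.
  exact: ltW.
have -> : z = u (schwartz_of_test (tmul psi chi)).
  apply: (@pairing_tensor _ _ _ K' v (distr_of_tempered u) psi) => //.
  exists [set y | `|y| < r].
    split; first by have := @open_norm_ball R n 0 r; under eq_set do rewrite subr0.
    by move=> y /hB yB /=; lra.
  by move=> y; exact: chi1.
have -> : u (schwartz_of_test (tmul psi chi)) - u psi =
    u (schwartz_of_test (tmul psi chi) - psi).
  have := lu (-1) psi (schwartz_of_test (tmul psi chi)).
  by rewrite !scaleN1r ![- _ + _]addrC => ->.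
apply: hC => s x sk.
have -> : (schwartz_of_test (tmul psi chi) - psi : schwartz R n) =
    (fun x => psi x * rho (r^-1 *: x) - psi x) :> ('rV[R]_n -> R[i]^o).
  by apply/funext => y; rewrite -[LHS]/(tmul psi chi y - psi y) (tmulP _ _ spsi) chiE.
exact: hE.
Qed.

End Main.

Local Close Scope complex_scope.
Unset Implicit Arguments.
Set Strict Implicit.
Set Printing Implicit Defensive.

Theorem theorem7p4 (R : realType) (n : nat) :
  (forall (A : {linear tempered R n -> tempered R n})
          (K : tempered R (n + n)),
     continuous A -> is_tempered_kernel A K ->
     forall (u : tempered R n) (v : testfun R n),
       let K' := distr_of_tempered K in
       let w := tensor v (distr_of_tempered u) in
       compact (supp K' `&` supp w) ->
       sing_supp K' `&` sing_supp w = set0 ->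
       A u (schwartz_of_test v) = pairing K' w) /\
  (forall (A : {linear distr R n -> distr R n}) (K : distr R (n + n)),
     continuous A -> is_kernel A K ->
     forall (u : distr R n) (v : testfun R n),
       compact (supp K `&` supp (tensor v u)) ->
       sing_supp K `&` sing_supp (tensor v u) = set0 ->
       A u v = pairing K (tensor v u)).
Proof.
split; first exact: kernel_pairing_tempered.
exact: kernel_pairing_distr.
Qed.
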